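(* Let $(\Gamma,G)$ be a matched pair of a countable discrete group $\Gamma$ and a compact group $G$, with associated action $\alpha$ of $\Gamma$ on $G$, and let $\mathbb{G}$ be the bicrossed product. The following are equivalent: \begin{enumerate} \item The pair $(G,\mathbb{G})$ does not have the relative co-property $(T)$. \item There exists a sequence $(\mu_n)_{n\in\mathbb{N}}$ of Borel probability measures on $G$ such that (a) $\mu_n(\{e\})=0$ for all $n\in\mathbb{N}$; (b) $\mu_n\to\delta_e$ weak*; (c) $\|\alpha_\gamma(\mu_n)-\mu_n\|\to0$ for all $\gamma\in\Gamma$. \end{enumerate}
   Context: Compact groups are Hausdorff and second countable. Matched pair $(\Gamma,G)$: $\Gamma$ and $G$ are closed subgroups of a locally compact group $H$ with $\Gamma\cap G=\{e\}$ and complement of $\Gamma G$ of Haar measure zero. Since $G$ is compact, $\Gamma G=H$, and $\gamma g=\alpha_\gamma(g)\beta_g(\gamma)$ defines a continuous left action $\alpha$ of $\Gamma$ on the space $G$ and a continuous right action $\beta$ of $G$ on the set $\Gamma$ (with finite orbits $\gamma\cdot G$). The bicrossed product $\mathbb{G}$ is the compact quantum group with $C_m(\mathbb{G})$ equal to the full crossed product of $C(G)$ by $\Gamma$ (generated by a copy $\alpha(C(G))$ of $C(G)$ and unitaries $u_\gamma$ with $u_\gamma\alpha(F)u_\gamma^*=\alpha(F\circ\alpha_{\gamma^{-1}})$), $\Delta_{\mathbb{G}}\circ\alpha=(\alpha\otimes\alpha)\circ\Delta_G$, $\Delta_{\mathbb{G}}(u_\gamma)=\sum_{r\in\gamma\cdot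 G}u_\gamma\alpha(v_{\gamma,r})\otimes u_r$, where $v_{\gamma,r}\in C(G)$ is the indicator function of $\{g\in G:\beta_g(\gamma)=r\}$; its counit satisfies $\varepsilon_{\mathbb{G}}(u_\gamma\alpha(F))=F(e)$. Relative co-property $(T)$: given compact quantum groups $G,\mathbb{G}$ and an injective unital $*$-homomorphism $\alpha:C_m(G)\to C_m(\mathbb{G})$ with $\Delta_{\mathbb{G}}\circ\alpha=(\alpha\otimes\alpha)\circ\Delta_G$, the pair $(G,\mathbb{G})$ has the relative co-property $(T)$ if for every representation $\pi:C_m(\mathbb{G})\to\mathcal B(H)$, $\varepsilon_{\mathbb{G}}\prec\pi$ implies $\varepsilon_G\subset\pi\circ\alpha$. Here $\varepsilon_{\mathbb{G}}\prec\pi$ means there are unit vectors $\xi_n\in H$ with $\|\pi(x)\xi_n-\varepsilon_{\mathbb{G}}(x)\xi_n\|\to0$ for all $x\in C_m(\mathbb{G})$, and $\varepsilon_G\subset\pi\circ\alpha$ means there is $0\neq\xi\in H$ with $\pi(\alpha(a))\xi=\varepsilon_G(a)\xi$ for all $a\in C_m(G)$. For the classical group $G$, $C_m(G)=C(G)$ and $\varepsilon_G(F)=F(e)$. $\alpha_\gamma(\mu)$ denotes the push-forward of $\mu$ under $\alpha_\gamma$, $\|\cdot\|$ is the total variation norm (norm of $C(G)^*$). *)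

(* Defs.v *)
From HB Require Import structures.
From mathcomp Require Import all_boot all_order all_algebra.
From mathcomp Require Import all_classical all_reals all_analysis.
From mathcomp Require Import complex lra.
Import Order.TTheory GRing.Theory Num.Theory.
Import numFieldNormedType.Exports.
Set Implicit Arguments. Unset Strict Implicit. Unset Printing Implicit Defensive.
Local Open Scope classical_set_scope.
Local Open Scope ring_scope.

Definition Cx (R : realType) : numClosedFieldType := R[i].

(* Unital C*-algebras. The multiplication is part of the mixin because the
   library's hierarchy has no common substructure of rings and normed modules
   above numDomainType, so that algType and normedModType cannot be joined. *)
HB.mixin Record isCStarAlgebra (C : numClosedFieldType) A
    of CompleteNormedModule C A := {
  cmul : A -> A -> A;
  cone : A;
  star : A -> A;
  cmul_bilinear : bilinear_for *:%R *:%R cmul;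
  cmulA : associative cmul;
  cmul1x : left_id cone cmul;
  cmulx1 : right_id cone cmul;
  starD : {morph star : x y / x + y};
  starZ : forall (a : C) (x : A), star (a *: x) = a^* *: star x;
  starM : forall x y : A, star (cmul x y) = cmul (star y) (star x);
  starK : involutive star;
  norm_cmul : forall x y : A, `|cmul x y| <= `|x| * `|y|;
  norm_star_cmul : forall x : A, `|cmul (star x) x| = `|x| ^+ 2 }.

#[short(type="cstarAlgType")]
HB.structure Definition CStarAlgebra (C : numClosedFieldType) :=
  {A of CompleteNormedModule C A & isCStarAlgebra C A}.

HB.mixin Record isCompactSpace T of PointedTopological T := {
  compact_space : compact [set: T] }.
#[short(type="compactType")]
HB.structure Definition CompactSpace :=
  {T of PointedTopological T & isCompactSpace T}.

Section prod_compact.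
Variables K L : compactType.
Let compact_prod : compact [set: K * L].
Proof. by rewrite -setXTT; apply: compact_setX; exact: compact_space. Qed.
HB.instance Definition _ := isCompactSpace.Build (K * L)%type compact_prod.
End prod_compact.

Section complex_topology.
Variable R : realType.
Implicit Types z : Cx R.

Definition Cx_re z : R := complex.Re (z : R[i]).
Definition Cx_im z : R := complex.Im (z : R[i]).
Definition Cx_mod z : R := Num.sqrt (Cx_re z ^+ 2 + Cx_im z ^+ 2).

Lemma Cx_normE z : `|z| = (Cx_mod z)%:C%C :> R[i].
Proof. exact: normc_def. Qed.

Lemma real_leC (a b : R) : ((a%:C%C : Cx R) <= (b%:C%C : Cx R)) = (a <= b).
Proof. exact: lecR. Qed.

Lemma real_ltC (a b : R) : ((a%:C%C : Cx R) < (b%:C%C : Cx R)) = (a < b).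
Proof. exact: ltcR. Qed.

Lemma Cx_mod_le z (b : R) : (`|z| <= (b%:C%C : Cx R)) = (Cx_mod z <= b).
Proof. by rewrite [`|z|]Cx_normE real_leC. Qed.

Lemma ge0_Cx (e : Cx R) : 0 <= e -> e = (Cx_re e)%:C%C.
Proof. by move: e => [a b]; rewrite lecE /= => /andP[/eqP -> _]. Qed.

Lemma Cx_mod0 : Cx_mod 0 = 0.
Proof. by rewrite /Cx_mod /= !expr0n addr0 sqrtr0. Qed.

Lemma Cx_mod_ge0 z : 0 <= Cx_mod z. Proof. exact: sqrtr_ge0. Qed.


Lemma Cx_normr_real (a : R) : `|a%:C%C : Cx R| = (`|a|%:C%C : Cx R).
Proof.
by rewrite [LHS]Cx_normE /Cx_mod /Cx_re /Cx_im /= expr0n addr0 sqrtr_sqr.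
Qed.

Lemma Cx_mod_dist z w : `|Cx_mod z - Cx_mod w| <= Cx_mod (z - w).
Proof.
have E : `|z| - `|w| = (Cx_mod z - Cx_mod w)%:C%C :> Cx R.
  by rewrite !Cx_normE; apply/esym; exact: (rmorphB (real_complex R)).
by have := ler_dist_dist z w; rewrite E Cx_normr_real [`|z - w|]Cx_normE real_leC.
Qed.

Lemma Cx_re_le z : `|Cx_re z| <= Cx_mod z.
Proof.
by rewrite -real_leC -Cx_normE; exact: (@normc_ge_Re R z).
Qed.

Lemma Cx_im_le z : `|Cx_im z| <= Cx_mod z.
Proof.
by rewrite /Cx_mod -[X in X <= _]sqrtr_sqr ler_wsqrtr// lerDr sqr_ge0.
Qed.

Lemma Cx_mod_le_re_im z : Cx_mod z <= `|Cx_re z| + `|Cx_im z|.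
Proof.
rewrite -[X in _ <= X]ger0_norm ?addr_ge0// -[X in _ <= X]sqrtr_sqr.
rewrite ler_wsqrtr// sqrrD !real_normK ?num_real//.
by rewrite -addrA [X in _ <= _ + X]addrC lerD2l lerDl mulrn_wge0// mulr_ge0.
Qed.

Lemma Cx_mod_continuous : continuous (Cx_mod : Cx R -> R).
Proof.
move=> z; apply/(@cvgrPdist_lt _ _ _ (nbhs z)) => e e0.
have e0' : (0 : Cx R) < e%:C%C by rewrite -[0]/(0%:C%C : Cx R) real_ltC.
near=> w.
have : ball z (e%:C%C : Cx R) w by near: w; exact: nbhsx_ballx.
rewrite -ball_normE /= [`|z - w|]Cx_normE real_ltC.
exact: le_lt_trans (Cx_mod_dist _ _).
Unshelve. all: by end_near. Qed.

Lemma Cx_complete (F : set_system (Cx R)) :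
  ProperFilter F -> cauchy F -> exists l : Cx R, F --> l.
Proof.
move=> FF Fc.
have cvg_part (p : Cx R -> R) : (forall z w, p (z - w) = p z - p w) ->
    (forall z, `|p z| <= Cx_mod z) -> cvg (p @ F).
  move=> pB ple; apply: cauchy_cvg; apply/cauchyP => e e0.
  have e0' : (0 : Cx R) < e%:C%C by rewrite -[0]/(0%:C%C : Cx R) real_ltC.
  have /cauchyP/(_ _ e0')[z Fz] := Fc; exists (p z).
  apply: (@filterS _ F _ _ (p @^-1` ball (p z) e)) Fz => w; rewrite /preimage -!ball_normE /= [`|z - w|]Cx_normE real_ltC.
  by apply: le_lt_trans; rewrite -pB.
have /cvg_part/(_ Cx_re_le) re_cvg : forall z w : Cx R,
  Cx_re (z - w) = Cx_re z - Cx_re w by move=> [? ?] [? ?].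
have /cvg_part/(_ Cx_im_le) im_cvg : forall z w : Cx R,
  Cx_im (z - w) = Cx_im z - Cx_im w by move=> [? ?] [? ?].
exists ((lim (Cx_re @ F) +i* lim (Cx_im @ F))%C : Cx R).
apply/cvgrPdist_lt => e e0.
have er : e = (Cx_re e)%:C%C by apply: ge0_Cx; exact: ltW.
have re0 : 0 < Cx_re e / 2.
  by rewrite divr_gt0// -real_ltC -er.
move/cvgrPdist_lt/(_ _ re0) : re_cvg => H1.
move/cvgrPdist_lt/(_ _ re0) : im_cvg => H2.
apply: filterS2 H1 H2 => z H1 H2.
rewrite Cx_normE er real_ltC (splitr (Cx_re e)).
apply: (le_lt_trans (Cx_mod_le_re_im _)).
by case: z H1 H2 => a b H1 H2; exact: ltrD.
Qed.

End complex_topology.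

(* C(K), with the supremum norm when K is compact *)
Definition Cfun (R : realType) (K : topologicalType) := continuousType K (Cx R).

Section Cfun_module.
Variables (R : realType) (K : topologicalType).
Local Notation CK := (Cfun R K).

Lemma CfunP (F G : CK) : F =1 G -> F = G.
Proof. by move/(continuousEP F G). Qed.

HB.instance Definition _ := Choice.on CK.

Definition Cfun_add (F G : CK) : CK := mkcts (fun x => cvgD (@cts_fun _ _ F x) (@cts_fun _ _ G x)).
Definition Cfun_opp (F : CK) : CK := mkcts (fun x => cvgN (@cts_fun _ _ F x)).
Definition Cfun_mul (F G : CK) : CK := mkcts (fun x => cvgM (@cts_fun _ _ F x) (@cts_fun _ _ G x)).
Definition Cfun_scale (a : Cx R) (F : CK) : CK := Cfun_mul (cst a) F.

Let addA : associative Cfun_add.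
Proof. by move=> F G H; apply: CfunP => x; exact: addrA. Qed.
Let addC : commutative Cfun_add.
Proof. by move=> F G; apply: CfunP => x; exact: addrC. Qed.
Let add0 : left_id (cst 0 : CK) Cfun_add.
Proof. by move=> F; apply: CfunP => x; exact: add0r. Qed.
Let addN : left_inverse (cst 0 : CK) Cfun_opp Cfun_add.
Proof. by move=> F; apply: CfunP => x; exact: addNr. Qed.
HB.instance Definition _ := GRing.isZmodule.Build CK addA addC add0 addN.

Let scaleA a b F : Cfun_scale a (Cfun_scale b F) = Cfun_scale (a * b) F.
Proof. by apply: CfunP => x; exact: mulrA. Qed.
Let scale1 : left_id 1 Cfun_scale.
Proof. by move=> F; apply: CfunP => x; exact: mul1r. Qed.
Let scaleDr : right_distributive Cfun_scale +%R.
Proof. by move=> a F G; apply: CfunP => x; exact: mulrDr. Qed.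
Let scaleDl F : {morph Cfun_scale^~ F : a b / a + b}.
Proof. by move=> a b; apply: CfunP => x; exact: mulrDl. Qed.
HB.instance Definition _ :=
  GRing.Zmodule_isLmodule.Build (Cx R) CK scaleA scale1 scaleDr scaleDl.

Lemma Cfun_conj_continuous (F : CK) : continuous (fun x => (F x)^*).
Proof.
move=> x; apply/(@cvgrPdist_lt _ _ _ (nbhs x)) => e e0.
have /cvgrPdist_lt/(_ _ e0) := @cts_fun _ _ F x.
by apply: filterS => y; rewrite -rmorphB norm_conjC.
Qed.
Definition Cfun_conj (F : CK) : CK := mkcts (Cfun_conj_continuous (F := F)).

Lemma CfunD F G x : (F + G : CK) x = F x + G x. Proof. by []. Qed.
Lemma CfunN F x : (- F : CK) x = - F x. Proof. by []. Qed.
Lemma CfunZ a F x : (a *: F : CK) x = a * F x. Proof. by []. Qed.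
End Cfun_module.

Section Cfun_cstar.
Variables (R : realType) (K : compactType).
Local Notation CK := (Cfun R K).
Implicit Types F G : CK.

Definition sup_mod F : R := sup (range (fun x => Cx_mod (F x))).
Definition Cfun_norm F : Cx R := (sup_mod F)%:C%C.

Lemma mod_has_sup F : has_sup (range (fun x => Cx_mod (F x))).
Proof.
split; first by exists (Cx_mod (F point)), point.
have Fc : {within [set: K], continuous (fun x => Cx_mod (F x))}.
  apply: continuous_subspaceT => x; apply: continuous_comp.
    exact: (@cts_fun _ _ F).
  exact: Cx_mod_continuous.
have K0 : [set: K] !=set0 by exists point.
have [c _ cmax] := compact_EVT_max K0 compact_space Fc.
by exists (Cx_mod (F c)) => _ [x _ <-]; apply: cmax; rewrite inE.
Qed.

Lemma le_sup_mod F x : Cx_mod (F x) <= sup_mod F.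
Proof. by apply: sup_upper_bound (mod_has_sup F) _ _; exists x. Qed.

Lemma sup_mod_le F (b : R) : (forall x, Cx_mod (F x) <= b) -> sup_mod F <= b.
Proof.
move=> Fb; apply: ge_sup; first by exists (Cx_mod (F point)), point.
by move=> _ [x _ <-].
Qed.

Let normD F G : Cfun_norm (F + G) <= Cfun_norm F + Cfun_norm G.
Proof.
rewrite -(rmorphD (real_complex R)) real_leC; apply: sup_mod_le => x.
rewrite -real_leC -Cx_normE (le_trans (ler_normD _ _))// !Cx_normE.
by rewrite -(rmorphD (real_complex R)) real_leC lerD// le_sup_mod.
Qed.

Lemma Cx_modM (z w : Cx R) : Cx_mod (z * w) = Cx_mod z * Cx_mod w.
Proof.
apply: (@complexI R); rewrite rmorphM.
by have := normrM z w; rewrite !Cx_normE => ->.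
Qed.

Lemma Cx_mod_eq0 (z : Cx R) : Cx_mod z = 0 -> z = 0.
Proof. by move=> z0; apply/normr0_eq0; rewrite Cx_normE z0. Qed.

Let normZ (a : Cx R) F : Cfun_norm (a *: F) = `|a| * Cfun_norm F.
Proof.
suff E : sup_mod (a *: F) = Cx_mod a * sup_mod F.
  by rewrite Cx_normE -(rmorphM (real_complex R)) -E.
have le_ (b : Cx R) G : sup_mod (b *: G) <= Cx_mod b * sup_mod G.
  apply: sup_mod_le => x; rewrite CfunZ Cx_modM.
  by rewrite ler_wpM2l ?Cx_mod_ge0// le_sup_mod.
apply/eqP; rewrite eq_le le_/=; have [->|a0] := eqVneq a 0.
  by rewrite Cx_mod0 mul0r (le_trans (Cx_mod_ge0 _) (le_sup_mod _ point)).
have a0' : 0 < Cx_mod a.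
  rewrite lt_neqAle Cx_mod_ge0 andbT eq_sym; apply: contra_neq a0.
  exact: Cx_mod_eq0.
have Ea : Cx_mod a^-1 = (Cx_mod a)^-1.
  apply: (mulfI (lt0r_neq0 a0')); rewrite -Cx_modM !mulfV ?(lt0r_neq0 a0')//.
  by rewrite /Cx_mod /Cx_re /Cx_im/= expr1n expr0n addr0 sqrtr1.
rewrite -ler_pdivlMl// -Ea; have := le_ a^-1 (a *: F).
by rewrite scalerA mulVf// scale1r.
Qed.

Let norm0 F : Cfun_norm F = 0 -> F = 0.
Proof.
move=> /(@complexI R) F0; apply: CfunP => x; apply: Cx_mod_eq0.
by apply/eqP; rewrite eq_le Cx_mod_ge0 andbT -F0 le_sup_mod.
Qed.

HB.instance Definition _ := Lmodule_isNormed.Build (Cx R) CK normD normZ norm0.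

Lemma Cfun_normE F : `|F| = (sup_mod F)%:C%C :> Cx R. Proof. by []. Qed.

Let Cfun_complete (D : set_system CK) : ProperFilter D -> cauchy D -> cvg D.
Proof.
move=> DD Dc.
have approx (r : R) : 0 < r ->
    exists F0 : CK, D [set F | forall x, Cx_mod (F0 x - F x) < r].
  move=> r0; have r0' : (0 : Cx R) < r%:C%C by rewrite -[0]/(0%:C%C : Cx R) real_ltC.
  have /cauchyP/(_ _ r0')[F0 DF0] := Dc; exists F0.
  apply: filterS DF0 => F; rewrite -ball_normE /= Cfun_normE real_ltC => FF0 x.
  exact: le_lt_trans (le_sup_mod (F0 - F) x) FF0.
have pt_cvg x : exists l : Cx R, (fun F : CK => F x) @ D --> l.
  apply: Cx_complete; apply/cauchyP => e e0.
  have er : e = (Cx_re e)%:C%C by apply: ge0_Cx; exact: ltW.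
  have re0 : 0 < Cx_re e by rewrite -real_ltC -er.
  have [F0 DF0] := approx _ re0; exists (F0 x).
  apply: (@filterS _ D _ _ ((fun F : CK => F x) @^-1` ball (F0 x) e)) DF0 => F F0F.
  by rewrite /preimage/= -ball_normE /= Cx_normE er real_ltC.
have [g gE] := choice pt_cvg.
have near_g (r : R) : 0 < r -> exists F0 : CK,
    D [set F | forall x, Cx_mod (F0 x - F x) < r] /\
    forall x, Cx_mod (F0 x - g x) <= r.
  move=> r0; have [F0 DF0] := approx _ r0; exists F0; split=> // x.
  apply/ler_addgt0Pr => s s0.
  have s0' : (0 : Cx R) < s%:C%C by rewrite -[0]/(0%:C%C : Cx R) real_ltC.
  have /cvgrPdist_lt/(_ _ s0') Dg := gE x.
  have [F [/= F0F]] := filter_ex (filterI DF0 Dg).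
  rewrite distrC Cx_normE real_ltC => Fg.
  rewrite -real_leC -Cx_normE -(subrKA (F x)) (le_trans (ler_normD _ _))//.
  by rewrite !Cx_normE -(rmorphD (real_complex R)) real_leC lerD// ltW.
have g_cont : continuous g.
  move=> x; apply/(@cvgrPdist_lt _ _ _ (nbhs x)) => e e0.
  have er : e = (Cx_re e)%:C%C by apply: ge0_Cx; exact: ltW.
  have r0 : 0 < Cx_re e / 3 by rewrite divr_gt0// -real_ltC -er.
  have [F0 [_ F0g]] := near_g _ r0.
  have r0' : (0 : Cx R) < (Cx_re e / 3)%:C%C.
    by rewrite -[0]/(0%:C%C : Cx R) real_ltC.
  have /cvgrPdist_lt/(_ _ r0') := @cts_fun _ _ F0 x.
  apply: filterS => y F0xy.
  rewrite -(subrKA (F0 x)) -(subrKA (F0 y) (F0 x)) (le_lt_trans (ler_normD _ _))//.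
  rewrite [X in X + _]distrC.
  rewrite (@le_lt_trans _ _ (`|F0 x - g x| + (`|F0 x - F0 y| + `|F0 y - g y|)))//.
    by rewrite lerD2l ler_normD.
  move: F0xy; rewrite !Cx_normE real_ltC -!(rmorphD (real_complex R)) er real_ltC.
  move=> F0xy; have := F0g x; have := F0g y; move: F0xy; rewrite /=.
  move: (Cx_mod (F0 x - F0 y)) (Cx_mod (F0 x - g x)) (Cx_mod (F0 y - g y)).
  by move=> a b c; lra.
apply/cvg_ex; exists (mkcts g_cont : CK); apply/cvgrPdist_lt => e e0.
have er : e = (Cx_re e)%:C%C by apply: ge0_Cx; exact: ltW.
have r0 : 0 < Cx_re e / 3 by rewrite divr_gt0// -real_ltC -er.
have [F0 [DF0 F0g]] := near_g _ r0.
apply: filterS DF0 => F F0F.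
rewrite Cfun_normE er real_ltC (@le_lt_trans _ _ (Cx_re e / 3 + Cx_re e / 3))//; last first.
  by move: r0; lra.
apply: sup_mod_le => x; rewrite -real_leC -Cx_normE.
rewrite [X in `|X|](_ : _ = g x - F x)// -(subrKA (F0 x)) (le_trans (ler_normD _ _))//.
by rewrite distrC !Cx_normE -(rmorphD (real_complex R)) real_leC lerD// ltW.
Qed.

HB.instance Definition _ := Uniform_isComplete.Build CK Cfun_complete.

Let mul_bilinear : bilinear_for *:%R *:%R (@Cfun_mul R K).
Proof.
split=> H a F G; apply: CfunP => x.
- by rewrite -[LHS]/((a * F x + G x) * H x) mulrDl -mulrA.
- by rewrite -[LHS]/(H x * (a * F x + G x)) mulrDr mulrCA.
Qed.
Let mulA : associative (@Cfun_mul R K).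
Proof. by move=> F G H; apply: CfunP => x; exact: mulrA. Qed.
Let mul1x : left_id (cst 1 : CK) (@Cfun_mul R K).
Proof. by move=> F; apply: CfunP => x; exact: mul1r. Qed.
Let mulx1 : right_id (cst 1 : CK) (@Cfun_mul R K).
Proof. by move=> F; apply: CfunP => x; exact: mulr1. Qed.
Let conjD : {morph (@Cfun_conj R K) : F G / F + G}.
Proof. by move=> F G; apply: CfunP => x; exact: rmorphD. Qed.
Let conjZ (a : Cx R) F : Cfun_conj (a *: F) = a^* *: Cfun_conj F.
Proof. by apply: CfunP => x; exact: rmorphM. Qed.
Let conjM F G :
  Cfun_conj (Cfun_mul F G) = Cfun_mul (Cfun_conj G) (Cfun_conj F).
Proof. by apply: CfunP => x; rewrite /= /mkcts/= rmorphM mulrC. Qed.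
Let conjK' : involutive (@Cfun_conj R K).
Proof. by move=> F; apply: CfunP => x; exact: conjCK. Qed.
Let normM F G : `|Cfun_mul F G| <= `|F| * `|G|.
Proof.
rewrite !Cfun_normE -(rmorphM (real_complex R)) real_leC.
apply: sup_mod_le => x; rewrite [X in Cx_mod X](_ : _ = F x * G x)// Cx_modM.
by rewrite ler_pM ?Cx_mod_ge0 ?le_sup_mod.
Qed.
Let norm_conjM F : `|Cfun_mul (Cfun_conj F) F| = `|F| ^+ 2.
Proof.
suff E : sup_mod (Cfun_mul (Cfun_conj F) F) = sup_mod F ^+ 2.
  by rewrite !Cfun_normE E (rmorphXn (real_complex R)).
have modE x : Cx_mod (Cfun_mul (Cfun_conj F) F x) = Cx_mod (F x) ^+ 2.
  rewrite [X in Cx_mod X](_ : _ = (F x)^* * F x)// Cx_modM expr2; congr (_ * _).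
  by apply: (@complexI R); have := norm_conjC (F x); rewrite !Cx_normE.
have s0 : 0 <= sup_mod F by rewrite (le_trans (Cx_mod_ge0 _) (le_sup_mod _ point)).
apply/eqP; rewrite eq_le; apply/andP; split.
  by apply: sup_mod_le => x; rewrite modE ler_pXn2r ?nnegrE ?Cx_mod_ge0 ?le_sup_mod.
rewrite -[leRHS]sqr_sqrtr; last first.
  by rewrite (le_trans (Cx_mod_ge0 _) (le_sup_mod _ point)).
rewrite ler_pXn2r ?nnegrE ?sqrtr_ge0//; apply: sup_mod_le => x.
rewrite -[leLHS]ger0_norm ?Cx_mod_ge0// -sqrtr_sqr ler_wsqrtr// -modE.
exact: le_sup_mod.
Qed.

HB.instance Definition _ := isCStarAlgebra.Build (Cx R) CK mul_bilinear
  mulA mul1x mulx1 conjD conjZ conjM conjK' normM norm_conjM.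

End Cfun_cstar.

Definition Cfun_comp (R : realType) (K L : topologicalType) (F : Cfun R L)
  (f : continuousType K L) : Cfun R K := F \o f.

Lemma fst_cts (K L : topologicalType) : continuous (fst : K * L -> K).
Proof. by move=> p; exact: cvg_fst. Qed.

Lemma snd_cts (K L : topologicalType) : continuous (snd : K * L -> L).
Proof. by move=> p; exact: cvg_snd. Qed.

(* F \otimes E, via C(K) \otimes C(L) = C(K x L) *)
Definition Cfun_tensor (R : realType) (K L : topologicalType)
    (F : Cfun R K) (E : Cfun R L) : Cfun R (K * L)%type :=
  Cfun_mul (Cfun_comp F (mkcts (@fst_cts K L)))
           (Cfun_comp E (mkcts (@snd_cts K L))).

Lemma Cfun_tensorE (R : realType) (K L : topologicalType)
    (F : Cfun R K) (E : Cfun R L) p : Cfun_tensor F E p = F p.1 * E p.2.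
Proof. by []. Qed.

Lemma Cfun_delta_cts (R : realType) (X : discreteTopologicalType) (r : X) :
  continuous (fun x : X => (x == r)%:R : Cx R).
Proof.
move=> x A /nbhs_singleton Ax.
suff : nbhs x ((fun x : X => (x == r)%:R : Cx R) @^-1` A) by [].
by rewrite nbhs_principalE; apply/principal_filterP.
Qed.

Definition Cfun_delta (R : realType) (X : discreteTopologicalType) (r : X) :
  Cfun R X := mkcts (@Cfun_delta_cts R X r).

(* The library's sesquilinear forms are linear in their first argument. *)
HB.mixin Record isHilbertSpace (C : numClosedFieldType) H
    of CompleteNormedModule C H := {
  inner : {dot H for Num.conj};
  norm_inner : forall x : H, `|x| ^+ 2 = inner x x }.

#[short(type="hilbertType")]
HB.structure Definition HilbertSpace (C : numClosedFieldType) :=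
  {H of CompleteNormedModule C H & isHilbertSpace C H}.

Section cstar_theory.
Variable C : numClosedFieldType.

Definition star_hom (A B : cstarAlgType C) (f : A -> B) : Prop :=
  [/\ linear f, f cone = cone, {morph f : x y / cmul x y} &
      {morph f : x / star x}].

Definition character (A : cstarAlgType C) (f : A -> C) : Prop :=
  [/\ scalar f, f cone = 1, forall x y, f (cmul x y) = f x * f y &
      forall x, f (star x) = (f x)^*].

(* unital *-homomorphism from A to the bounded operators on H *)
Definition representation (A : cstarAlgType C) (H : hilbertType C)
    (p : A -> H -> H) : Prop :=
  [/\ forall a, linear (p a) /\ continuous (p a),
      forall x, linear (fun a => p a x),
      forall x, p cone x = x,
      forall a b x, p (cmul a b) x = p a (p b x) &
      forall a x y, inner (p (star a) x) y = inner x (p a y)].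

Definition unitary_rep (G : groupType) (H : hilbertType C)
    (U : G -> H -> H) : Prop :=
  [/\ forall g, linear (U g),
      forall x, U 1%g x = x,
      forall g h x, U (g * h)%g x = U g (U h x) &
      forall g x y, inner (U g x) (U g y) = inner x y].

(* S spans a dense subspace *)
Definition total_set (V : normedModType C) (S : set V) : Prop :=
  dense [set v | exists n (a : 'I_n -> C) (s : 'I_n -> V),
    (forall i, S (s i)) /\ v = \sum_(i < n) a i *: s i].

Definition hilbert_tensor (H1 H2 H : hilbertType C) (t : H1 -> H2 -> H) :=
  [/\ bilinear_for *:%R *:%R t,
      forall x1 y1 x2 y2,
        inner (t x1 x2) (t y1 y2) = inner x1 y1 * inner x2 y2 &
      total_set [set z | exists x1 x2, z = t x1 x2]].

(* T is the minimal (spatial) tensor product of A and B, where iA a is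
   a \otimes 1 and iB b is 1 \otimes b: it is the closed span of the elementary
   tensors, acting faithfully on H1 \otimes H2 for some faithful
   representations of A on H1 and of B on H2. *)
Definition min_tensor (A B T : cstarAlgType C) (iA : A -> T) (iB : B -> T) :=
  [/\ star_hom iA, star_hom iB,
      forall a b, cmul (iA a) (iB b) = cmul (iB b) (iA a),
      total_set [set z | exists a b, z = cmul (iA a) (iB b)] &
      exists (H1 H2 H : hilbertType C) (t : H1 -> H2 -> H)
        (pA : A -> H1 -> H1) (pB : B -> H2 -> H2) (p : T -> H -> H),
      [/\ hilbert_tensor t,
          representation pA /\ injective pA,
          representation pB /\ injective pB,
          representation p /\ injective p &
          forall a b x y, p (cmul (iA a) (iB b)) (t x y) = t (pA a x) (pB b y)]].

Definition weakly_contained (A : cstarAlgType C) (eps : A -> C)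
    (H : hilbertType C) (p : A -> H -> H) : Prop :=
  exists xi : nat -> H, (forall n, `|xi n| = 1) /\
    forall x : A, `|p x (xi n) - eps x *: xi n| @[n --> \oo] --> (0 : C).

Definition contained (A : cstarAlgType C) (eps : A -> C)
    (H : hilbertType C) (p : A -> H -> H) : Prop :=
  exists xi : H, xi != 0 /\ forall a, p a xi = eps a *: xi.

(* The pair of compact quantum groups enters only through the following data:
   A and B are the maximal C*-algebras of two compact quantum groups, epsA and
   epsB their counits, and alpha : A -> B is the embedding. *)
Definition relative_co_property_T (A B : cstarAlgType C)
    (epsA : A -> C) (epsB : B -> C) (alpha : A -> B) : Prop :=
  forall (H : hilbertType C) (p : B -> H -> H), representation p ->
    weakly_contained epsB p -> contained epsA (fun a => p (alpha a)).

End cstar_theory.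

HB.mixin Record isTopologicalGroup G of Group G & PointedTopological G := {
  mulg_continuous : continuous (fun p : G * G => (p.1 * p.2)%g);
  invg_continuous : continuous (fun x : G => x^-1%g) }.

(* The library's measurable types are pointed, hence PointedTopological. *)
#[short(type="topologicalGroupType")]
HB.structure Definition TopologicalGroup :=
  {G of Group G & PointedTopological G & isTopologicalGroup G}.

HB.mixin Record isHausdorffSecondCountable T of Topological T := {
  hausdorff_subproof : hausdorff_space T;
  second_countable_subproof : @second_countable T }.

#[short(type="compactGroupType")]
HB.structure Definition CompactGroup :=
  {G of TopologicalGroup G & CompactSpace G & isHausdorffSecondCountable G}.

#[short(type="discreteGroupType")]
HB.structure Definition DiscreteGroup :=
  {G of TopologicalGroup G & Discrete_ofNbhs G}.

Definition borel (T : ptopologicalType) := g_sigma_algebraType (@open T).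

Definition left_haar_measure (R : realType) (H : topologicalGroupType)
    (mu : {measure set (borel H) -> \bar R}) : Prop :=
  [/\ mu setT != 0%E /\ (forall K : set H, compact K -> (mu K < +oo)%E),
      forall (x : H) (A : set (borel H)), measurable A ->
        mu [set (x * y : H)%g | y in A] = mu A,
      forall A : set (borel H), measurable A ->
        mu A = ereal_inf [set mu U | U in [set U : set H | open U /\ A `<=` U]] &
      forall U : set H, open U ->
        mu U = ereal_sup [set mu K | K in [set K : set H | compact K /\ K `<=` U]]].

Definition closed_embedding (K H : topologicalGroupType) (i : K -> H) : Prop :=
  [/\ {morph i : x y / (x * y)%g}, injective i, continuous i &
      forall A, closed A -> closed (i @` A)].

(* The closed subgroups are given by embeddings of Gam and G into the ambient
   group. Here mp_alpha g is \alpha_g and mp_beta g x is \beta_x(g), so that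
   range (mp_beta g) is the orbit g \cdot G; both are determined by
   mp_factorization, since the two subgroups intersect trivially. *)
Record matched_pair (R : realType) (Gam : discreteGroupType)
    (G : compactGroupType) := MatchedPair {
  mp_group : topologicalGroupType;
  mp_hausdorff : hausdorff_space mp_group;
  mp_locally_compact : locally_compact [set: mp_group];
  mp_i : Gam -> mp_group;
  mp_j : G -> mp_group;
  mp_i_closed : closed_embedding mp_i;
  mp_j_closed : closed_embedding mp_j;
  mp_trivial : range mp_i `&` range mp_j = [set 1%g];
  mp_conull : exists2 mu : {measure set (borel mp_group) -> \bar R},
    left_haar_measure mu &
    mu.-negligible (~` [set (mp_i g * mp_j x)%g | g in setT & x in setT]);
  mp_alpha : Gam -> continuousType G G;
  mp_beta : Gam -> continuousType G Gam;
  mp_factorization : forall g x,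
    (mp_i g * mp_j x = mp_j (mp_alpha g x) * mp_i (mp_beta g x))%g }.

Section bicrossed_product.
Variables (R : realType) (Gam : discreteGroupType) (G : compactGroupType).
Variable mp : matched_pair R Gam G.

Definition covariant_rep (H : hilbertType (Cx R))
    (p : Cfun R G -> H -> H) (U : Gam -> H -> H) : Prop :=
  [/\ representation p, unitary_rep U &
      forall g F x, U g (p F x) = p (Cfun_comp F (mp_alpha mp g^-1%g)) (U g x)].

(* v_{g,r}, the indicator function of {x | \beta_x(g) = r} *)
Definition orbit_indicator (g r : Gam) : Cfun R G :=
  Cfun_comp (Cfun_delta R r) (mp_beta mp g).

(* the comultiplication of C(G), with values in C(G x G) *)
Definition Cfun_comult (F : Cfun R G) : Cfun R (G * G)%type :=
  Cfun_comp F (mkcts (@mulg_continuous G)).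

(* bp_alg is the full crossed product of C(G) by Gam, bp_iota is the embedding
   \alpha of C(G) into it, bp_tens is bp_alg \otimes bp_alg, and bp_iota2 is
   \alpha \otimes \alpha. *)
Record bicrossed_product := BicrossedProduct {
  bp_alg : cstarAlgType (Cx R);
  bp_iota : Cfun R G -> bp_alg;
  bp_u : Gam -> bp_alg;
  bp_iota_hom : star_hom bp_iota;
  bp_iota_inj : injective bp_iota;
  bp_u1 : bp_u 1%g = cone;
  bp_uM : {morph bp_u : g h / (g * h)%g >-> cmul g h};
  bp_u_unitary : forall g, cmul (star (bp_u g)) (bp_u g) = cone /\
    cmul (bp_u g) (star (bp_u g)) = cone;
  bp_covariant : forall g F,
    cmul (cmul (bp_u g) (bp_iota F)) (star (bp_u g)) =
    bp_iota (Cfun_comp F (mp_alpha mp g^-1%g));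
  bp_generated : total_set [set z | exists g F, z = cmul (bp_u g) (bp_iota F)];
  bp_universal : forall (H : hilbertType (Cx R))
    (p : Cfun R G -> H -> H) (U : Gam -> H -> H), covariant_rep p U ->
    exists q : bp_alg -> H -> H, [/\ representation q,
      forall F x, q (bp_iota F) x = p F x & forall g x, q (bp_u g) x = U g x];
  bp_tens : cstarAlgType (Cx R);
  bp_inl : bp_alg -> bp_tens;
  bp_inr : bp_alg -> bp_tens;
  bp_min_tensor : min_tensor bp_inl bp_inr;
  bp_iota2 : Cfun R (G * G)%type -> bp_tens;
  bp_iota2_hom : star_hom bp_iota2;
  bp_iota2E : forall F E, bp_iota2 (Cfun_tensor F E) =
    cmul (bp_inl (bp_iota F)) (bp_inr (bp_iota E));
  bp_comult : bp_alg -> bp_tens;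
  bp_comult_hom : star_hom bp_comult;
  bp_comult_iota : forall F, bp_comult (bp_iota F) = bp_iota2 (Cfun_comult F);
  bp_comult_u : forall g, bp_comult (bp_u g) =
    \sum_(r \in range (mp_beta mp g))
      cmul (bp_inl (cmul (bp_u g) (bp_iota (orbit_indicator g r))))
           (bp_inr (bp_u r));
  bp_counit : bp_alg -> Cx R;
  bp_counit_character : character bp_counit;
  bp_counitE : forall g F, bp_counit (cmul (bp_u g) (bp_iota F)) = F 1%g }.

End bicrossed_product.

Definition Cfun_integral (R : realType) (K : ptopologicalType)
    (mu : {measure set (borel K) -> \bar R}) (F : Cfun R K) : Cx R :=
  ((\int[mu]_x Cx_re (F x)) +i* (\int[mu]_x Cx_im (F x)))%C.

Definition weak_star_cvg (R : realType) (K : ptopologicalType)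
    (mu_ : nat -> {measure set (borel K) -> \bar R})
    (mu : {measure set (borel K) -> \bar R}) : Prop :=
  forall F : Cfun R K,
    Cfun_integral (mu_ n) F @[n --> \oo] --> Cfun_integral mu F.

(* For a signed measure nu; on a compact group this is the norm of nu as a
   functional on continuous functions. *)
Definition variation_norm (R : realType) d (T : measurableType d)
    (nu : set T -> \bar R) : \bar R :=
  ereal_sup [set s | exists n (A : 'I_n -> set T),
    [/\ forall i, measurable (A i), trivIset setT A, \bigcup_i A i = setT &
        s = (\sum_(i < n) `|nu (A i)|)%E]].

(* Main.v *)
(** A compact group being second countable, a unit vector [xi] in a representation
   of the bicrossed product gives a Borel probability measure on [G], namely the
   Riesz measure of [F |-> inner (q (iota F) xi) xi], and the covariance relation
   turns almost invariance of [xi] under [u g] into almost invariance of the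
   measure. An atom at [1] would give a nonzero vector fixed by [C(G)] in the sense
   [q (iota F) eta = F 1 *: eta], namely the limit of the [q (iota (F n)) xi] for
   continuous [F n] decreasing to the indicator function of [{1}].

   Conversely, given the measures [mu n], let [rho] be a convergent sum of
   positive multiples of all translates of all [mu n]. It is quasi-invariant with
   [rho {1} = 0], so that multiplication operators and the Koopman operators (with
   the square roots of the Radon-Nikodym derivatives) form a covariant
   representation on [L2 rho] without fixed vector. The square roots of the
   densities of the [mu n] are almost invariant unit vectors, because the squared
   Hellinger distance is dominated by the total variation distance. *)
Require Import Defs.
From HB Require Import structures.
From mathcomp Require Import all_boot all_order all_algebra.
From mathcomp Require Import all_classical all_reals all_analysis.
From mathcomp Require Import measurable_realfun complex ring lra.
Import Order.TTheory GRing.Theory Num.Theory.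
Import numFieldNormedType.Exports.
Set Implicit Arguments.
Unset Strict Implicit.
Unset Printing Implicit Defensive.
Local Open Scope classical_set_scope.
Local Open Scope ring_scope.

(** * Representations of C*-algebras *)

(** A failure of co-property (T) supplies one representation with almost invariant unit vectors and
    no fixed vector, so every measure built from these vectors avoids [1]. Conversely all the
    measures must give vectors of one Hilbert space, which is why a single [rho] dominates them
    together with their translates; it has no atom at [1] because the action fixes [1] and moves no
    other point to it.

    The definition of [representation] bounds each operator separately, whereas almost invariance is
    checked on generators and extended by density, which takes a bound of [q a] in terms of the norm
    of [a]. The bound comes from the positivity of [1 - x^* x] for small [x], that is, from a square
    root inside the algebra.

    The Riesz theorem is proved with a Daniell upper integral over series of continuous functions.
    Indicators of open sets are increasing limits of sequences of continuous functions; this gives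
    the measurability of Borel sets, the passage from test functions to Borel sets in the total
    variation, and both arguments about vectors concentrated at [1]. *)

Section geometric_cvg.
Variable R : realType.

Lemma half_pow_tail (V : normedModType (Cx R)) (u : nat -> V) (c : R) :
  (forall k, `|u k.+1 - u k| <= (c * (2^-1) ^+ k)%:C%C) ->
  forall k m, `|u (k + m)%N - u k| <= (2 * c * (2^-1) ^+ k)%:C%C.
Proof.
move=> uc k m.
have c0 : 0 <= c.
  have := le_trans (normr_ge0 _) (uc 0%N).
  by rewrite expr0 mulr1 -[0]/(0%:C%C : Cx R) real_leC.
(* The exact partial sum of the geometric series makes the induction close; the bound to be proved
   is not inductive. *)
have tail n : `|u (k + n)%N - u k| <= (2 * c * (2^-1) ^+ k * (1 - (2^-1) ^+ n))%:C%C.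
  elim: n => [|n IH]; first by rewrite addn0 subrr normr0 expr0 subrr mulr0.
  rewrite addnS -(subrKA (u (k + n)%N)) (le_trans (ler_normD _ _))//.
  rewrite (le_trans (lerD (uc _) IH))// -(rmorphD (real_complex R)) real_leC.
  rewrite exprD exprS; lra.
by rewrite (le_trans (tail m))// real_leC ler_piMr// ?gerBl ?mulr_ge0 ?exprn_ge0.
Qed.

Lemma le_half_pow_cvg (V : completeNormedModType (Cx R)) (u : nat -> V) (c : R) :
  (forall k, `|u k.+1 - u k| <= (c * (2^-1) ^+ k)%:C%C) -> cvgn u.
Proof.
move=> /half_pow_tail tail.
apply/cauchy_cvgP/cauchyP => e e0.
have er : e = (Cx_re e)%:C%C by apply: ge0_Cx; exact: ltW.
have re0 : 0 < Cx_re e by rewrite -real_ltC -er.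
have [k ck] : exists k, 2 * c * (2^-1) ^+ k < Cx_re e / 2.
  have : (fun k => 2 * c * (2^-1) ^+ k) @ \oo --> 2 * c * 0.
    apply: cvgMr; apply: cvg_expr; rewrite ger0_norm//; lra.
  rewrite mulr0 => /cvgrPdist_lt/(_ (Cx_re e / 2)) [|k _ /(_ k)/= kk]; first lra.
  exists k; apply: le_lt_trans (kk (leqnn _)).
  by rewrite sub0r normrN ler_norm.
exists (u k); exists k => // n /= kn; rewrite -ball_normE /= distrC -(subnKC kn).
by rewrite (le_lt_trans (tail _ _))// er real_ltC; lra.
Qed.

End geometric_cvg.

Section cstar_basics.
Variables (R : realType) (A : cstarAlgType (Cx R)).
Implicit Types x y z : A.

Lemma cmulDl : left_distributive (@cmul _ A) +%R.
Proof.
move=> x y z; have := (@cmul_bilinear _ A).1 z 1 x y; rewrite scale1r => ->.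
by congr (_ + _); exact: scale1r.
Qed.

Lemma cmulDr : right_distributive (@cmul _ A) +%R.
Proof.
move=> x y z; have := (@cmul_bilinear _ A).2 x 1 y z; rewrite scale1r => ->.
by congr (_ + _); exact: scale1r.
Qed.

Lemma cmul0l : left_zero 0 (@cmul _ A).
Proof. by move=> x; apply: (addIr (cmul 0 x)); rewrite -cmulDl !add0r. Qed.

Lemma cmul0r : right_zero 0 (@cmul _ A).
Proof. by move=> x; apply: (addIr (cmul x 0)); rewrite -cmulDr !add0r. Qed.

Lemma cmulZl (a : Cx R) x y : cmul (a *: x) y = a *: cmul x y.
Proof. by have := (@cmul_bilinear _ A).1 y a x 0; rewrite cmul0l !addr0. Qed.

Lemma cmulZr (a : Cx R) x y : cmul x (a *: y) = a *: cmul x y.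
Proof. by have := (@cmul_bilinear _ A).2 x a y 0; rewrite cmul0r !addr0. Qed.

Lemma cmulNl x y : cmul (- x) y = - cmul x y.
Proof. by rewrite -scaleN1r cmulZl scaleN1r. Qed.

Lemma cmulNr x y : cmul x (- y) = - cmul x y.
Proof. by rewrite -scaleN1r cmulZr scaleN1r. Qed.

Lemma star_cone : star cone = cone :> A.
Proof. by rewrite -[LHS]cmul1x -{1}(@starK _ A cone) -starM cmul1x starK. Qed.

Lemma norm_star x : `|star x| = `|x|.
Proof.
suff le_star y : `|y| <= `|star y|.
  by apply/eqP; rewrite eq_le le_star andbT -[X in _ <= `|X|]starK le_star.
have [->|y0] := eqVneq y 0; first by rewrite normr0.
have : `|y| * `|y| <= `|star y| * `|y| by rewrite -expr2 -norm_star_cmul norm_cmul.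
by rewrite ler_pM2r// normr_gt0.
Qed.

Lemma star0 : star 0 = 0 :> A.
Proof. by apply: (addIr (star 0)); rewrite -starD !add0r. Qed.

Lemma starN x : star (- x) = - star x.
Proof. by apply: (addIr (star x)); rewrite -starD !addNr star0. Qed.

(* The square root is [1 - y], where [y] solves [y = (x + y^2) / 2]; the right
   hand side is a contraction of ratio 1/2 on the ball of radius 1/2. *)
Lemma sqrt_cone_sub x : star x = x -> `|x| <= 2^-1 ->
  exists h : A, star h = h /\ cmul h h = cone - x.
Proof.
move=> sx x2; pose T y : A := 2^-1 *: (x + cmul y y).
pose u n : A := iter n T 0.
have half : (2^-1 : Cx R) = (2^-1)%:C%C.
  by apply/esym; rewrite fmorphV rmorphD rmorph1.
have half1 : 2^-1 + 2^-1 = 1 :> Cx R by rewrite -[LHS]mulr2n -[LHS]mulr_natr mulVf ?pnatr_eq0.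
have nh : `|2^-1 : Cx R| = 2^-1 by rewrite ger0_norm// invr_ge0 ler0n.
have u2 n : `|u n| <= 2^-1.
  elim: n => [|n IH]; first by rewrite normr0 invr_ge0 ler0n.
  rewrite /u iterS -/(u n) /T normrZ nh ler_piMr ?invr_ge0 ?ler0n//.
  rewrite (le_trans (ler_normD _ _))// (le_trans (lerD x2 (norm_cmul _ _)))//.
  rewrite (le_trans (lerD (lexx _) (ler_pM _ _ IH IH)))//.
  rewrite half -(rmorphM (real_complex R)) -(rmorphD (real_complex R)).
  by rewrite [leRHS](_ : _ = 1%:C%C)// real_leC; lra.
have ulip n : `|u n.+2 - u n.+1| <= 2^-1 * `|u n.+1 - u n|.
  rewrite {1}/u 2!iterS -/(u n.+1) {1}/u iterS -/(u n) /T -/(u n).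
  rewrite -/(T (u n)) -[T (u n)]/(u n.+1) -scalerBr normrZ nh.
  rewrite ler_wpM2l ?invr_ge0 ?ler0n// opprD addrACA subrr add0r.
  have -> : cmul (u n.+1) (u n.+1) - cmul (u n) (u n) =
      cmul (u n.+1) (u n.+1 - u n) + cmul (u n.+1 - u n) (u n).
    by rewrite cmulDr cmulDl cmulNr cmulNl addrA subrK.
  rewrite (le_trans (ler_normD _ _))// (le_trans (lerD (norm_cmul _ _) (norm_cmul _ _)))//.
  rewrite (le_trans (lerD (ler_wpM2r _ (u2 _)) (ler_wpM2l _ (u2 _))))//.
  by rewrite [X in _ + X]mulrC -mulrDl half1 mul1r.
have cu : cvgn u.
  apply: (@le_half_pow_cvg R _ _ (2^-1)) => k.
  elim: k => [|k IH]; first by rewrite subr0 expr0 mulr1 -half.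
  rewrite (le_trans (ulip k))// (le_trans (ler_wpM2l _ IH)) ?invr_ge0 ?ler0n//.
  by rewrite exprS half -(rmorphM (real_complex R)) real_leC; lra.
have su n : star (u n) = u n.
  elim: n => [|n IH]; first exact: star0.
  by rewrite /u iterS -/(u n) /T starZ starD starM IH sx geC0_conj ?invr_ge0 ?ler0n.
pose y := limn u.
have uy (e : R) : 0 < e -> exists n, `|y - u n| <= e%:C%C /\ `|y - u n.+1| <= e%:C%C.
  move=> e0; have e0' : (0 : Cx R) < e%:C%C by rewrite -[0]/(0%:C%C : Cx R) real_ltC.
  have /cvgrPdist_lt/(_ _ e0')[n _ yn] := cu.
  by exists n; split; apply: ltW; apply: yn => /=.
have y2 : `|y| <= 1.
  have [n [yn _]] := uy 2^-1 ltac:(lra).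
  rewrite -[y](subrK (u n)) (le_trans (ler_normD _ _))// (le_trans (lerD yn (u2 n)))//.
  by rewrite -half half1.
(* The two identities about the limit [y] have the form [z = 0] and are proved by bounding [z]
   through the errors of [u n] and [u n.+1]; this replaces the continuity of [cmul] and [star]. *)
have small (z : A) : (forall n, `|z| <= 2 * (`|y - u n| + `|y - u n.+1|)) -> z = 0.
  move=> zc; apply/normr0_eq0/eqP; rewrite eq_le normr_ge0 andbT.
  have nz := ge0_Cx (normr_ge0 z); rewrite nz [leRHS](_ : _ = 0%:C%C)// real_leC; apply/ler_addgt0Pr => e e0.
  rewrite add0r -real_leC -nz.
  have [n [yn yn1]] := uy (e / 4) ltac:(lra).
  rewrite (le_trans (zc n))// (le_trans (ler_wpM2l _ (lerD yn yn1))) ?ler0n//.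
  by rewrite -(rmorph_nat (real_complex R)) -(rmorphD (real_complex R)) -(rmorphM (real_complex R)) real_leC; lra.
have yT : y = T y.
  apply/eqP; rewrite -subr_eq0; apply/eqP/small => n.
  rewrite -(subrKA (u n.+1)) (le_trans (ler_normD _ _))// mulrDr addrC lerD//.
    rewrite {1}/u iterS -/(u n) /T -scalerBr normrZ nh opprD addrACA subrr add0r.
    have -> : cmul (u n) (u n) - cmul y y = cmul (u n) (u n - y) + cmul (u n - y) y.
      by rewrite cmulDr cmulDl cmulNr cmulNl addrA subrK.
    have c2 : `|cmul (u n) (u n - y) + cmul (u n - y) y| <= 2 * `|y - u n|.
      rewrite (le_trans (ler_normD _ _))//.
      rewrite (le_trans (lerD (norm_cmul _ _) (norm_cmul _ _)))// distrC.
      rewrite (le_trans (lerD (ler_wpM2r _ (u2 _)) (ler_wpM2l _ y2)))//.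
      by rewrite mulr1 [leRHS]mulr_natl [leRHS]mulr2n lerD2r ler_piMl// invf_le1 ?ltr0n ?ler1n.
    by apply: le_trans c2; rewrite ler_piMl// invf_le1 ?ltr0n ?ler1n.
  by rewrite ler_peMl// ler1n.
have sy : star y = y.
  apply/eqP; rewrite -subr_eq0; apply/eqP/small => n.
  rewrite -(subrKA (u n)) -[X in _ - X + _]su -starN -starD.
  rewrite (le_trans (ler_normD _ _))// norm_star [X in _ + X <= _]distrC.
  by rewrite -[leLHS]mulr2n -[leLHS]mulr_natl ler_wpM2l ?ler0n// lerDl.
exists (cone - y); rewrite starD starN star_cone sy; split=> //.
rewrite cmulDl cmulNl cmul1x cmulDr cmulNr cmulx1 opprB.
have -> : cmul y y = 2 *: y - x.
  have -> : 2 *: y = x + cmul y y by rewrite {1}yT scalerA mulfV ?pnatr_eq0// scale1r.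
  by rewrite addrC addKr.
by rewrite scaler_nat mulr2n [_ - x - y]addrAC addrK addrA subrK.
Qed.

End cstar_basics.
Section hilbert_basics.
Variables (R : realType) (H : hilbertType (Cx R)).
Implicit Types x y z : H.

Lemma innerDl x y z : inner (x + y) z = inner x z + inner y z.
Proof. exact: linearDl. Qed.

Lemma innerNl x z : inner (- x) z = - inner x z.
Proof. exact: linearNl. Qed.

Lemma innerZl (a : Cx R) x z : inner (a *: x) z = a * inner x z.
Proof. exact: linearZl_LR. Qed.

Lemma inner_conj x y : inner x y = (inner y x)^*.
Proof. by rewrite hermC expr0 mul1r. Qed.

Lemma innerDr x y z : inner z (x + y) = inner z x + inner z y.
Proof. exact: linearDr. Qed.

Lemma innerNr x z : inner z (- x) = - inner z x.
Proof. exact: linearNr. Qed.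

Lemma innerZr (a : Cx R) x z : inner z (a *: x) = a^* * inner z x.
Proof. exact: linearZr_LR. Qed.

Lemma cauchy_schwarz x y : `|inner x y| <= `|x| * `|y|.
Proof.
have [->|y0] := eqVneq y 0; first by rewrite linear0r !normr0 mulr0.
have yp : 0 < `|y| ^+ 2 by rewrite exprn_gt0// normr_gt0.
(* [|y| ^+ 2] times the component of [x] orthogonal to [y], which avoids a division. *)
pose z := `|y| ^+ 2 *: x - inner x y *: y.
have : 0 <= inner z z by rewrite -norm_inner exprn_ge0.
have yr : (`|y| ^+ 2)^* = `|y| ^+ 2 by rewrite geC0_conj// exprn_ge0.
rewrite /z innerDl innerNl !innerZl !innerDr !innerNr !innerZr yr.
rewrite -!norm_inner [inner y x]inner_conj.
have -> : `|y| ^+ 2 * (`|y| ^+ 2 * `|x| ^+ 2 - (inner x y)^* * inner x y) -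
    inner x y * (`|y| ^+ 2 * (inner x y)^* - (inner x y)^* * `|y| ^+ 2) =
    `|y| ^+ 2 * ((`|x| * `|y|) ^+ 2 - `|inner x y| ^+ 2).
  by rewrite normCK; ring.
by rewrite pmulr_rge0// subr_ge0 ler_pXn2r// nnegrE mulr_ge0.
Qed.

End hilbert_basics.

Section linear_functions.
Variables (K : pzRingType) (U V : lmodType K) (f : U -> V).
Hypothesis fl : linear f.

Lemma linf0 : f 0 = 0.
Proof. by have := fl (-1) 0 0; rewrite !scaleN1r oppr0 addr0 addNr. Qed.

Lemma linfZ a x : f (a *: x) = a *: f x.
Proof. by have := fl a x 0; rewrite linf0 !addr0. Qed.

Lemma linfD x y : f (x + y) = f x + f y.
Proof. by have := fl 1 x y; rewrite !scale1r. Qed.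

Lemma linfN x : f (- x) = - f x.
Proof. by rewrite -scaleN1r linfZ scaleN1r. Qed.

Lemma linfB x y : f (x - y) = f x - f y.
Proof. by rewrite linfD linfN. Qed.

Lemma linf_sum (I : Type) (s : seq I) (g : I -> U) :
  f (\sum_(i <- s) g i) = \sum_(i <- s) f (g i).
Proof.
by elim: s => [|i s IH]; rewrite ?big_nil ?linf0// !big_cons linfD IH.
Qed.

End linear_functions.

Section rep_bound.
Variables (R : realType) (A : cstarAlgType (Cx R)).

(** The radius 1/2 is that of [sqrt_cone_sub]; [x^* x] inherits it because the square of a number
    below 1 is smaller than the number. *)
Let sqrt_bound (x : A) : `|x| <= 2^-1 ->
  exists h : A, star h = h /\ cmul h h = cone - cmul (star x) x.
Proof.
move=> x2; apply: sqrt_cone_sub; first by rewrite starM starK.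
rewrite norm_star_cmul (le_trans _ x2)// expr2 ler_piMr// (le_trans x2)//.
by rewrite invf_le1 ?ltr0n ?ler1n.
Qed.

Let scaled (f : A -> Cx R) : (forall a x, f (a *: x) = `|a| * f x) ->
  (forall x, `|x| <= 2^-1 -> f x <= 1) -> forall x, f x <= 2 * `|x|.
Proof.
move=> fZ f1 x; have [->|x0] := eqVneq x 0.
  by rewrite -(scale0r 0) fZ normr0 mul0r scale0r normr0 mulr0.
have n0 : 0 < 2 * `|x| by rewrite mulr_gt0 ?ltr0n ?normr_gt0.
have : f ((2 * `|x|)^-1 *: x) <= 1.
  apply: f1; rewrite normrZ ger0_norm ?invr_ge0 ?(ltW n0)// invfM -mulrA mulVf ?mulr1//.
  by rewrite normr_eq0.
by rewrite fZ ger0_norm ?invr_ge0 ?(ltW n0)// ler_pdivrMl// mulr1.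
Qed.

(* The constant 2 spares a limit argument; any bound suffices below. *)
Lemma representation_bound (H : hilbertType (Cx R)) (p : A -> H -> H) :
  representation p -> forall a x, `|p a x| <= 2 * `|a| * `|x|.
Proof.
move=> [pl pa p1 pM ps] a x.
have [->|x0] := eqVneq x 0; first by rewrite (linf0 (pl a).1) !normr0 mulr0.
have xp : 0 < `|x| by rewrite normr_gt0.
rewrite -ler_pdivrMr//.
apply: (scaled (f := fun a => `|p a x| / `|x|)) => [c b|b b2].
  by rewrite (linfZ (pa x)) normrZ mulrA.
have [h [sh hh]] := sqrt_bound b2.
rewrite ler_pdivrMr// mul1r -(@ler_pXn2r _ 2)// ?nnegrE// !norm_inner -subr_ge0.
(* With [h] self-adjoint and [h h = 1 - b^* b], the difference is the square norm of [p h x]. *)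
have -> : inner x x - inner (p b x) (p b x) = inner (p (cmul h h) x) x.
  by rewrite hh (linfB (pa x)) p1 pM innerDl innerNl ps.
by rewrite pM -{1}sh ps -norm_inner exprn_ge0.
Qed.

(** The same square root: [1 - |f x| ^+ 2 = |f h| ^+ 2] on the ball of radius 1/2. *)
Lemma character_bound (f : A -> Cx R) : character f -> forall a, `|f a| <= 2 * `|a|.
Proof.
move=> [fl f1 fM fs]; have {}fl : linear (f : A -> (Cx R)^o) by exact: fl.
apply: scaled => [a x|x x2]; first by rewrite (linfZ fl) normrM.
have [h [sh hh]] := sqrt_bound x2.
rewrite -(@ler_pXn2r _ 2)// ?nnegrE// expr1n -subr_ge0 normCKC -fs -fM -f1.
by rewrite -(linfB fl) -hh fM -{1}sh fs -normCKC exprn_ge0.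
Qed.

End rep_bound.
Section norm_cvg0.
Variables (R : realType) (V : normedModType (Cx R)).

Lemma realC_gt0 (e : R) : ((0 : Cx R) < e%:C%C) = (0 < e).
Proof. by rewrite -[0]/(0%:C%C : Cx R) real_ltC. Qed.

(** Convergence in [Cx R] quantifies over complex radii; the estimates below produce real ones. *)
Lemma norm_cvg0_near (u : nat -> V) :
  (`|u n| @[n --> \oo] --> (0 : Cx R)) <->
  (forall e : R, 0 < e -> \forall n \near \oo, `|u n| <= e%:C%C).
Proof.
split=> [/cvgrPdist_lt u0 e e0|u0].
  have := u0 _ (etrans (realC_gt0 e) e0); apply: filterS => n.
  by rewrite sub0r normrN normr_id => /ltW.
apply/cvgrPdist_lt => e e0; have er := ge0_Cx (ltW e0).
have re0 : 0 < Cx_re e by rewrite -realC_gt0 -er.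
have := u0 (Cx_re e / 2) ltac:(lra); apply: filterS => n un.
rewrite sub0r normrN normr_id (le_lt_trans un)// er real_ltC; lra.
Qed.

Lemma total_approx (S : set V) : total_set S -> forall (x : V) (e : R), 0 < e ->
  exists n (a : 'I_n -> Cx R) (s : 'I_n -> V),
    (forall i, S (s i)) /\ `|x - \sum_(i < n) a i *: s i| <= e%:C%C.
Proof.
move=> tS x e e0; have e0' := etrans (realC_gt0 e) e0.
have x_ball : ball x (e%:C%C : Cx R) !=set0 by exists x; exact: ballxx.
have [v [xv [n [a [s [Ss vE]]]]]] := tS _ x_ball (@ball_open _ V x _).
exists n, a, s; split=> //; rewrite -vE; move: xv => /=; rewrite -ball_normE => /ltW.
by []. Qed.

Lemma cvg0_sum (I : Type) (r : seq I) (f : I -> nat -> V) :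
  (forall i, f i n @[n --> \oo] --> (0 : V)) ->
  \sum_(i <- r) f i n @[n --> \oo] --> (0 : V).
Proof.
move=> f0; elim: r => [|i r IH].
  under eq_fun do rewrite big_nil.
  exact: cvg_cst.
under eq_fun do rewrite big_cons.
by have := cvgD (f0 i) IH; rewrite addr0; exact.
Qed.

End norm_cvg0.

(** Linear combinations of elements of [S] are immediate; for their limits, [p] and [eps] have to be
    bounded by the norm of the algebra, uniformly along the unit vectors [xi n]. *)
Lemma weakly_contained_total (R : realType) (A : cstarAlgType (Cx R))
    (H : hilbertType (Cx R)) (eps : A -> Cx R) (p : A -> H -> H) (S : set A)
    (xi : nat -> H) :
  character eps -> representation p -> total_set S -> (forall n, `|xi n| = 1) ->
  (forall s, S s -> `|p s (xi n) - eps s *: xi n| @[n --> \oo] --> (0 : Cx R)) ->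
  weakly_contained eps p.
Proof.
move=> ce rp tS xi1 Scvg; exists xi; split=> // x; apply/norm_cvg0_near => e e0.
(* [p] and [eps] are bounded by 2 each, so the approximation costs [4 * (e / 8) = e / 2]. *)
have [n [a [s [Ss xs]]]] := total_approx tS x (ltac:(lra) : 0 < e / 8).
have [pl pa _ _ _] := rp; have [el' _ _ _] := ce.
have {el'}el : linear (eps : A -> (Cx R)^o) by exact: el'.
set v := \sum_(i < n) _ in xs.
have v0 : \forall m \near \oo, `|p v (xi m) - eps v *: xi m| <= (e / 2)%:C%C.
  move: (e / 2) (ltac:(lra) : 0 < e / 2); apply/norm_cvg0_near.
  apply/norm_cvg0P.
  have -> : (fun m => p v (xi m) - eps v *: xi m) =
      (fun m => \sum_(i < n) a i *: (p (s i) (xi m) - eps (s i) *: xi m)).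
    apply/funext => m; rewrite /v (linf_sum (pa _)) (linf_sum el).
    rewrite scaler_suml -sumrB; apply: eq_bigr => i _.
    by rewrite (linfZ (pa _)) (linfZ el) scalerBr scalerA.
  apply: cvg0_sum => i; rewrite -(scaler0 _ (a i)).
  by apply: cvgZl_tmp; apply/norm_cvg0P/Scvg.
apply: filterS v0 => m vm;
have -> : p x (xi m) - eps x *: xi m =
    p (x - v) (xi m) - eps (x - v) *: xi m + (p v (xi m) - eps v *: xi m).
  by rewrite (linfB (pa _)) (linfB el) scalerBl opprB addrACA subrK addrAC subrr add0r.
rewrite (le_trans (ler_normD _ _))// (le_trans (lerD (ler_normB _ _) vm))//.
rewrite normrZ xi1 mulr1.
have h1 := representation_bound rp (x - v) (xi m).
have h2 := character_bound ce (x - v).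
rewrite (le_trans (lerD (lerD h1 h2) (lexx _)))// xi1 mulr1.
rewrite -mulrDl -(natrD _ 2 2).
rewrite (le_trans (lerD (ler_wpM2l _ xs) (lexx _))) ?ler0n//.
rewrite -(rmorph_nat (real_complex R)) -(rmorphM (real_complex R)) -(rmorphD (real_complex R)) real_leC; lra.
Qed.

(** * Borel sets of a compact metrizable space *)

Section open_exhaustion.
Variables (R : realType) (K : compactType).
Hypotheses (hK : hausdorff_space K) (sK : @second_countable K).

(** By regularity every point of [U] lies in a basic open set whose closure is contained in [U]; one
    Urysohn function for each of these countably many sets suffices. *)
Lemma open_countable_urysohn (U : set K) : open U ->
  exists f : nat -> K -> R, [/\ forall n, continuous (f n),
    forall n x, 0 <= f n x <= 1, forall n x, ~ U x -> f n x = 0 &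
    forall x, U x -> exists n, f n x = 1].
Proof.
move=> oU; have [B cB [Bo Bb]] := sK.
have nK := compact_normal hK compact_space.
have sep V : closure V `<=` U -> exists f : K -> R, [/\ continuous f,
    forall x, 0 <= f x <= 1, forall x, ~ U x -> f x = 0 & forall x, V x -> f x = 1].
  move=> VU; have cU := open_closedC oU.
  have disj : ~` U `&` closure V = set0.
    by apply/disjoints_subset; exact: subsetC.
  have /(@uniform_separatorP _ R) [f [fc f01 f0 f1]] :=
    (@normal_separatorP R _).1 nK _ _ cU (@closed_closure _ V) disj.
  exists f; split=> // x.
  - by have := f01 (f x) (ex_intro2 _ _ x I erefl); rewrite /= in_itv.
  - by move=> Ux; apply: f0; exists x.
  - by move=> Vx; apply: f1; exists x => //; exact: subset_closure.
have /countable_injP[c cinj] := cB.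
(* Functions are indexed by the codes [c V]; a number that codes no suitable [V] gets the zero
   function. *)
have /choice[f fP] : forall n, exists g : K -> R, [/\ continuous g,
    forall x, 0 <= g x <= 1, forall x, ~ U x -> g x = 0 &
    forall V x, B V -> closure V `<=` U -> c V = n -> V x -> g x = 1].
  move=> n; have [[V [BV [VU cV]]]|nV] :=
      pselect (exists V, B V /\ closure V `<=` U /\ c V = n).
    have [g [gc g01 g0 g1]] := sep V VU; exists g; split=> // W x BW WU cW Wx.
    by apply: g1; rewrite -(cinj W V) ?inE// cV.
  exists (fun=> 0); split=> //; first by move=> ?; exact: cvg_cst.
    by move=> x; rewrite lexx ler01.
  by move=> V x BV VU cV; exfalso; apply: nV; exists V.
exists f; split=> [n|n x|n x Ux|x Ux]; try by have [] := fP n.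
  by have [_ _ ->] := fP n.
have x1 : closed [set x] by apply: accessible_closed_set1; exact: hausdorff_accessible.
have [W WO WU] : filter_from (set_nbhs [set x]) closure U.
  by apply: nK => //; apply/set_nbhsP; exists U; split=> // _ ->.
have [Q [oQ xQ QW]] := (set_nbhsP _ _).1 WO.
have [V [BV Vx] VQ] : filter_from [set V | B V /\ V x] id Q.
  by apply: Bb; apply: open_nbhs_nbhs; split=> //; exact: xQ.
exists (c V); have [_ _ _ fV] := fP (c V); apply: (fV V) => //.
by apply: subset_trans WU; apply: closureS; exact: subset_trans QW.
Qed.

(** Running maxima of the Urysohn functions. Such a sequence stands in for the indicator of [U]
    wherever monotone or dominated convergence is used below. *)
Lemma open_exhaustion (U : set K) : open U ->
  exists g : nat -> K -> R, [/\ forall n, continuous (g n),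
    forall n x, 0 <= g n x <= 1, forall n x, ~ U x -> g n x = 0,
    forall n x, g n x <= g n.+1 x &
    forall x, U x -> \forall n \near \oo, g n x = 1].
Proof.
move=> /open_countable_urysohn[f [fc f01 f0 f1]].
pose g := fix g n := if n is m.+1 then fun x => Num.max (g m x) (f m x) else fun=> 0 : R.
have g01 n x : 0 <= g n x <= 1.
  elim: n => [|n /andP[g0 g1]] /=; first by rewrite lexx ler01.
  by have /andP[? ?] := f01 n x; rewrite le_max g0 ge_max g1.
exists g; split=> //.
- elim=> [|n IH] x; first exact: cvg_cst.
  by apply: continuous_max => //; [exact: IH|exact: fc].
- by elim=> [//|n IH] x Ux /=; rewrite IH// f0// maxxx.
- by move=> n x; rewrite /= le_max lexx.
- move=> x /f1[k fk]; exists k.+1 => // n /= kn; rewrite -(subnK kn).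
  elim: (n - k.+1)%N => [|m IH].
    by rewrite add0n /= fk max_r//; have /andP[] := g01 k x.
  by rewrite addSn /= IH max_l//; have /andP[] := f01 (m + k.+1)%N x.
Qed.

End open_exhaustion.

Section borel_measurability.
Variables (K : ptopologicalType).

Lemma open_borel_measurable (U : set K) : open U -> measurable (U : set (borel K)).
Proof. by move=> oU; apply: sub_sigma_algebra. Qed.

Lemma closed_borel_measurable (U : set K) : closed U -> measurable (U : set (borel K)).
Proof.
by move=> cU; rewrite -(setCK U); apply: measurableC; apply: open_borel_measurable; exact: closed_openC.
Qed.

Lemma continuous_borel_measurable (L : ptopologicalType) (f : K -> L) :
  continuous f -> measurable_fun [set: borel K] (f : borel K -> borel L).
Proof.
move=> fc; apply: (@measurability _ _ (borel K) (borel L) _ _ (@open L)) => //.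
move=> _ [U oU <-]; rewrite setTI; apply: open_borel_measurable.
by apply: open_comp => // x _; exact: fc.
Qed.

Lemma continuous_borel_measurable_real (R : realType) (f : K -> R) :
  continuous f -> measurable_fun [set: borel K] (f : borel K -> R).
Proof.
move=> fc; apply: (measurability _ (measurable_realfun.RGenOpens.measurableE R)).
move=> _ [_ [x [y ->]] <-]; rewrite setTI; apply: open_borel_measurable.
by apply: open_comp => [? _|]; [exact: fc|exact: interval_open].
Qed.

End borel_measurability.

(** * The Riesz representation theorem *)

Section nneseries_pairs.
Variable R : realType.
Local Open Scope ereal_scope.

(** A single bijection for all arrays [a]: one interleaving of a double family of functions has to
    compute the pointwise sums and the sums of their integrals alike. *)
Lemma nneseries_pair_bij : exists e : nat -> nat * nat,
  (forall p, exists n, e n = p) /\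
  forall a : nat -> nat -> \bar R, (forall n k, 0 <= a n k) ->
    \sum_(i <oo) a (e i).1 (e i).2 = \sum_(n <oo) \sum_(k <oo) a n k.
Proof.
have /card_esym/ppcard_eqP[f] := card_nat2.
exists f; split=> [p|a a0]; first by exists (f^-1%FUN p); rewrite invK ?inE.
rewrite !nneseries_esumT//; last by move=> n; exact: nneseries_ge0.
under [RHS]eq_esum do rewrite nneseries_esumT//.
rewrite esum_esum// (_ : _ `*`` _ = [set: nat * nat]); last by apply/seteqP; split.
by rewrite (reindex_esum setT setT f).
Qed.

End nneseries_pairs.

Section continuous_real.
Variables (R : realType) (K : topologicalType).

Lemma continuous_rsum (I : Type) (s : seq I) (g : I -> K -> R) :
  (forall i, continuous (g i)) -> continuous (fun x => \sum_(i <- s) g i x).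
Proof.
move=> gc; elim: s => [|i s IH] x.
  by under eq_fun do rewrite big_nil; exact: cvg_cst.
by under eq_fun do rewrite big_cons; apply: cvgD; [exact: gc|exact: IH].
Qed.

End continuous_real.

Section positive_functional.
Variables (R : realType) (K : compactType).
Variable L : (K -> R) -> R.
Hypothesis LD : forall f g : K -> R, continuous f -> continuous g ->
  L (fun x => f x + g x) = L f + L g.
Hypothesis LZ : forall (a : R) (f : K -> R), continuous f -> L (fun x => a * f x) = a * L f.
Hypothesis L_ge0 : forall f : K -> R, continuous f -> (forall x, 0 <= f x) -> 0 <= L f.

Let cst_cts (a : R) : continuous (fun _ : K => a).
Proof. by move=> x; exact: cvg_cst. Qed.

Lemma functional_cst a : L (fun=> a) = a * L (fun=> 1).
Proof. by rewrite -LZ; [congr L; apply/funext => x; rewrite mulr1|exact: cst_cts]. Qed.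

Lemma functionalB (f g : K -> R) : continuous f -> continuous g ->
  L (fun x => f x - g x) = L f - L g.
Proof.
move=> fc gc; have gc' : continuous (fun x => -1 * g x).
  by move=> x; apply: cvgM; [exact: cvg_cst|exact: gc].
have -> : (fun x => f x - g x) = (fun x => f x + -1 * g x).
  by apply/funext => x; rewrite mulN1r.
by rewrite LD// LZ// mulN1r.
Qed.

Lemma functional_le (f g : K -> R) : continuous f -> continuous g ->
  (forall x, f x <= g x) -> L f <= L g.
Proof.
move=> fc gc fg; rewrite -subr_ge0 -functionalB//; apply: L_ge0 => x.
  by apply: cvgB; [exact: gc|exact: fc].
by rewrite subr_ge0.
Qed.

Lemma functional_sum (I : Type) (s : seq I) (g : I -> K -> R) :
  (forall i, continuous (g i)) ->
  L (fun x => \sum_(i <- s) g i x) = \sum_(i <- s) L (g i).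
Proof.
move=> gc; elim: s => [|i s IH].
  rewrite big_nil; under [X in L X]eq_fun do rewrite big_nil.
  by rewrite functional_cst mul0r.
rewrite big_cons; under [X in L X]eq_fun do rewrite big_cons.
by rewrite LD ?IH//; exact: continuous_rsum.
Qed.

(* A compactness argument of Dini type. *)
Lemma functional_le_series (f : K -> R) (g : nat -> K -> R) : continuous f ->
  (forall k, continuous (g k)) -> (forall k x, 0 <= g k x) ->
  (forall x, ((f x)%:E <= \sum_(k <oo) (g k x)%:E)%E) ->
  ((L f)%:E <= \sum_(k <oo) (L (g k))%:E)%E.
Proof.
move=> fc gc g0 fg.
have Lg0 k : (0 <= (L (g k))%:E)%E by rewrite lee_fin L_ge0.
(* The covering argument yields the error [e * L 1], which is rescaled to [e] unless [L 1 = 0]. *)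
suff H e : 0 < e -> ((L f)%:E <= \sum_(k <oo) (L (g k))%:E + (e * L (fun=> 1))%:E)%E.
  have [c0|c0] := eqVneq (L (fun=> 1)) 0.
    by have := H 1 ltr01; rewrite c0 mulr0 adde0.
  have cp : 0 < L (fun=> 1) by rewrite lt_neqAle eq_sym c0 L_ge0.
  apply/lee_addgt0Pr => e e0; have := H (e / L (fun=> 1)).
  by rewrite divfK//; apply; rewrite divr_gt0.
move=> e0; pose s n x := \sum_(0 <= k < n) g k x.
have sc n : continuous (s n) by exact: continuous_rsum.
have := @compact_space K; rewrite compact_cover.
(* The open sets where the [n]-th partial sum exceeds [f - e] cover [K] and increase with [n], so
   the largest index of a finite subcover serves all points. *)
move=> /(_ nat setT (fun n => [set x | f x - s n x < e]))[].
- move=> n _; apply: (@open_comp _ _ (fun x => f x - s n x) [set y | y < e]).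
    by move=> x _; apply: cvgB; [exact: fc|exact: sc].
  exact: open_lt.
- move=> x _.
  suff [n sn] : exists n, f x - s n x < e by exists n.
  apply: contrapT => /forallNP nn.
  have : (\sum_(k <oo) (g k x)%:E <= (f x - e)%:E)%E.
    apply: lime_le; first by apply: is_cvg_nneseries => k _ _; rewrite lee_fin.
    apply: nearW => n; rewrite sumEFin lee_fin; have /negP := nn n.
    by rewrite -leNgt /s => ?; lra.
  by move=> /(le_trans (fg x)); rewrite lee_fin; lra.
move=> D _ Dc; pose N := \max_(i <- finmap.enum_fset D) i.
have fN x : f x <= s N x + e.
  have [n /= nD fx] := Dc x I.
  have nN : (n <= N)%N by exact: leq_bigmax_seq.
  rewrite -lerBlDl (le_trans _ (ltW fx))// lerB// /s (@big_cat_nat _ _ _ n 0%N N)//= lerDl.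
  by apply: sumr_ge0 => k _.
have : L f <= L (fun x => s N x + e).
  by apply: functional_le => // x; apply: cvgD; [exact: sc|exact: cvg_cst].
rewrite LD; [|exact: sc|exact: cst_cts].
rewrite functional_sum// functional_cst -lee_fin EFinD => /le_trans; apply.
rewrite leeD2r// -sumEFin; apply: nneseries_lim_ge => k _ _; exact: Lg0.
Qed.

End positive_functional.

Section riesz.
Variables (R : realType) (K : compactType).
Hypotheses (hK : hausdorff_space K) (sK : @second_countable K).
Variable L : (K -> R) -> R.
Hypothesis LD : forall f g : K -> R, continuous f -> continuous g ->
  L (fun x => f x + g x) = L f + L g.
Hypothesis LZ : forall (a : R) (f : K -> R), continuous f -> L (fun x => a * f x) = a * L f.
Hypothesis L_ge0 : forall f : K -> R, continuous f -> (forall x, 0 <= f x) -> 0 <= L f.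

(** Majorants for a Daniell upper integral, written as series of nonnegative functions rather than
    as increasing limits: countably many of them merge into one by reindexing. *)
Definition upper_cover (h : K -> \bar R) : set (nat -> K -> R) :=
  [set f : nat -> K -> R | [/\ forall k, continuous (f k), forall k x, 0 <= f k x &
     forall x, (h x <= \sum_(k <oo) (f k x)%:E)%E]].

Definition upper_integral (h : K -> \bar R) : \bar R :=
  ereal_inf [set (\sum_(k <oo) (L (f k))%:E)%E | f in upper_cover h].

Local Notation uint := upper_integral.

Let cover_ge0 h f : upper_cover h f -> forall k, (0 <= (L (f k))%:E)%E.
Proof. by move=> [fc f0 _] k; rewrite lee_fin L_ge0. Qed.

Lemma upper_integral_ge0 h : (0 <= uint h)%E.
Proof.
apply: le_ereal_inf_tmp => _ [f hf <-]; apply: nneseries_ge0 => k _ _.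
exact: cover_ge0 hf k.
Qed.

Lemma upper_integral_cover h f : upper_cover h f ->
  (uint h <= \sum_(k <oo) (L (f k))%:E)%E.
Proof. by move=> hf; apply: ereal_inf_lbound; exists f. Qed.

Lemma le_upper_integral h1 h2 : (forall x, h1 x <= h2 x)%E -> (uint h1 <= uint h2)%E.
Proof.
move=> h12; apply: le_ereal_inf => _ [f [fc f0 hf] <-]; exists f => //.
by split=> // x; exact: le_trans (hf x).
Qed.

(** Covers of the [H n] that are optimal up to [e / 2 ^ n.+1] are interleaved into a cover of [h].
    An infinite term is set apart, since near-optimal covers exist for finite infima. *)
Lemma upper_integral_series (h : K -> \bar R) (H : nat -> K -> \bar R) :
  (forall x, h x <= \sum_(n <oo) H n x)%E -> (forall n x, 0 <= H n x)%E ->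
  (uint h <= \sum_(n <oo) uint (H n))%E.
Proof.
move=> hH H0; have [[i ioo]|] := pselect (exists i, uint (H i) = +oo%E).
  rewrite (eseries_pinfty _ _ ioo) ?leey// => n _.
  by rewrite -ltNye (lt_le_trans _ (upper_integral_ge0 _)).
rewrite -forallNE => fin; apply/lee_addgt0Pr => e e0.
rewrite (le_trans _ (epsilon_trick _ _ (ltW e0)))//; last first.
  by move=> n; exact: upper_integral_ge0.
have /choice[G GP] : forall n, exists g, upper_cover (H n) g /\
    (\sum_(k <oo) (L (g k))%:E <= uint (H n) + (e / (2 ^ n.+1)%:R)%:E)%E.
  move=> n; have en0 : 0 < e / (2 ^ n.+1)%:R by rewrite divr_gt0.
  have fn : uint (H n) \is a fin_num.
    by rewrite fin_numElt (lt_le_trans _ (upper_integral_ge0 _))//= ltey; exact/eqP/fin.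
  have [_ [g gH <-] gle] := lb_ereal_inf_adherent en0 fn.
  by exists g; split=> //; exact: ltW.
have G0 n k x : 0 <= G n k x by have [[_ + _] _] := GP n; exact.
have LG0 n k : (0 <= (L (G n k))%:E)%E by apply: cover_ge0 (GP n).1 k.
have [b [bsurj bsum]] := nneseries_pair_bij R.
have cov : upper_cover h (fun i => G (b i).1 (b i).2).
  split=> [i|i x|x]; [by have [[+ _ _] _] := GP (b i).1; exact|exact: G0|].
  rewrite (bsum (fun n k => (G n k x)%:E)); last by move=> n k; rewrite lee_fin.
  apply: (le_trans (hH x)); apply: lee_nneseries => n _ //.
  by have [[_ _ +] _] := GP n; exact.
apply: (le_trans (upper_integral_cover cov)).
rewrite (bsum (fun n k => (L (G n k))%:E))//.
apply: lee_nneseries => n _; last exact: (GP n).2.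
by move=> _; apply: nneseries_ge0 => k _ _; exact: LG0.
Qed.

Let single (a : \bar R) : (\sum_(k <oo) (if k == 0%N then a else 0))%E = a.
Proof.
apply/cvg_lim => //; rewrite -cvg_shiftS; apply: cvg_near_cst.
by apply: nearW => n /=; rewrite big_mkord big_ord_recl /= big1 ?adde0//.
Qed.

(** The cover [f, 0, 0, ...] gives one inequality; the other is the compactness argument of
    [functional_le_series]. *)
Lemma upper_integral_cts (f : K -> R) : continuous f -> (forall x, 0 <= f x) ->
  uint (fun x => (f x)%:E) = (L f)%:E.
Proof.
move=> fc f0; apply/eqP; rewrite eq_le; apply/andP; split; last first.
  apply: le_ereal_inf_tmp => _ [g [gc g0 fg] <-].
  exact: (functional_le_series LD LZ L_ge0).
pose g k := if k == 0%N then f else fun=> 0.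
have -> : (L f)%:E = (\sum_(k <oo) (L (g k))%:E)%E.
  rewrite -[LHS]single; apply: eq_eseriesr => k _; rewrite /g; case: eqP => // _.
  by rewrite (functional_cst LZ) mul0r.
apply: upper_integral_cover; split.
- by move=> k; rewrite /g; case: eqP => // _ x; exact: cvg_cst.
- by move=> k x; rewrite /g; case: eqP.
- move=> x; rewrite -[leLHS]single; rewrite le_eqVlt; apply/orP; left; apply/eqP.
  by apply: eq_eseriesr => k _; rewrite /g; case: eqP.
Qed.

Definition riesz_outer (A : set K) : \bar R := uint (fun x => (\1_A x)%:E).

Let riesz_outer0 : riesz_outer set0 = 0%E.
Proof.
rewrite /riesz_outer (_ : (fun _ => _) = fun=> 0%:E).
  rewrite (@upper_integral_cts (fun=> 0))//; last by move=> x; exact: cvg_cst.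
  by rewrite (functional_cst LZ) mul0r.
by apply/funext => x; rewrite indic0.
Qed.

Let riesz_outer_ge0 A : (0 <= riesz_outer A)%E.
Proof. exact: upper_integral_ge0. Qed.

Let le_riesz_outer : {homo riesz_outer : A B / A `<=` B >-> (A <= B)%E}.
Proof.
move=> A B AB; apply: le_upper_integral => x; rewrite lee_fin !indicE ler_nat.
have [xA|] := boolP (x \in A) => //=.
by rewrite mem_set//; apply: AB; exact: set_mem.
Qed.

Let riesz_outer_sigma_subadditive : sigma_subadditive riesz_outer.
Proof.
move=> F; apply: upper_integral_series => [x|n x]; last by rewrite lee_fin indicE.
rewrite indicE; have [|_] := boolP (x \in _); last first.
  by apply: nneseries_ge0 => n _ _; rewrite lee_fin indicE.
move=> /set_mem[n _ Fx].
apply: (@le_trans _ _ (\sum_(0 <= k < n.+1) (\1_(F k) x)%:E)%E).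
  rewrite big_nat_recr//= indicE mem_set//.
  by rewrite leeDr//; apply: sume_ge0 => k _; rewrite lee_fin indicE.
by apply: nneseries_lim_ge => k _ _; rewrite lee_fin indicE.
Qed.

HB.instance Definition _ := isOuterMeasure.Build R K riesz_outer riesz_outer0
  riesz_outer_ge0 le_riesz_outer riesz_outer_sigma_subadditive.

(** Caratheodory's inequality with a continuous [f] as test object. With [g n] exhausting [U], the
    increments of [f * g n] cover [f] on [U] and [f - f * g n] majorizes [f] off [U]; for each [n]
    the two contributions add up to [L f]. *)
Lemma upper_integral_open_split (f : K -> R) (U : set K) :
  continuous f -> (forall x, 0 <= f x) -> open U ->
  (uint (fun x => (f x * \1_U x)%:E) + uint (fun x => (f x * \1_(~` U) x)%:E)
   <= (L f)%:E)%E.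
Proof.
move=> fc f0 /(open_exhaustion R hK sK)[g [gc g01 g0 gS g1]].
(* Increments of [f * g n], with 0 as the function preceding [g 0]; they are nonnegative because [g]
   increases. *)
pose d k x := f x * (g k x - (if k is j.+1 then g j x else 0)).
have fgc n : continuous (fun x => f x * g n x).
  by move=> x; apply: cvgM; [exact: fc|exact: gc].
have dc k : continuous (d k).
  move=> x; apply: cvgM; first exact: fc.
  by apply: cvgB; [exact: gc|case: k => [|k]; [exact: cvg_cst|exact: gc]].
have d0 k x : 0 <= d k x.
  apply: mulr_ge0; first exact: f0.
  by rewrite subr_ge0; case: k => [|k]; [have /andP[] := g01 0%N x|exact: gS].
have dsum n x : \sum_(0 <= k < n.+1) d k x = f x * g n x.
  elim: n => [|n IH]; first by rewrite big_nat1 /d subr0.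
  by rewrite big_nat_recr//= IH /d; ring.
set c := uint (fun x => (f x * \1_(~` U) x)%:E).
have cn n : (c <= (L f - L (fun x => f x * g n x))%:E)%E.
  have fg_cts : continuous (fun x => f x - f x * g n x).
    by move=> x; apply: cvgB; [exact: fc|exact: fgc].
  have fg_ge0 x : 0 <= f x - f x * g n x.
    by rewrite -[X in X - _]mulr1 -mulrBr mulr_ge0// subr_ge0; have /andP[] := g01 n x.
  rewrite -(functionalB LD LZ)// -(upper_integral_cts fg_cts fg_ge0).
  apply: le_upper_integral => x; rewrite lee_fin indicE in_setC.
  have [xU|xU] := boolP (x \in U); first by rewrite mulr0.
  rewrite g0 ?mulr0 ?subr0 ?mulr1// => Ux; by rewrite mem_set in xU.
have cfin : c \is a fin_num.
  by rewrite ge0_fin_numE ?upper_integral_ge0// (le_lt_trans (cn 0%N))// ltry.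
have : (uint (fun x => (f x * \1_U x)%:E) <= \sum_(k <oo) (L (d k))%:E)%E.
  apply: upper_integral_cover; split=> // x; rewrite indicE.
  have [xU|_] := boolP (x \in U); last first.
    by rewrite mulr0; apply: nneseries_ge0 => k _ _; rewrite lee_fin.
  rewrite mulr1; have [n _ /(_ n (leqnn n)) /= gn] := g1 x (set_mem xU).
  apply: (@le_trans _ _ (\sum_(0 <= k < n.+1) (d k x)%:E)%E).
    by rewrite sumEFin dsum gn mulr1.
  by apply: nneseries_lim_ge => k _ _; rewrite lee_fin.
move=> /leeD2r-/(_ c)/le_trans; apply.
rewrite -leeBrDr//; apply: lime_le.
  by apply: is_cvg_nneseries => k _ _; rewrite lee_fin L_ge0.
(* The telescoping formula [dsum] is about sums of [n.+1] terms, so the empty partial sum is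
   skipped. *)
exists 1%N => // -[//|n] _ /=.
rewrite sumEFin -(functional_sum LD LZ)//; under [X in L X]eq_fun do rewrite dsum.
by rewrite leeBrDr// addeC -leeBrDr// -EFinB; exact: cn.
Qed.

(** Each term of a cover of [X] is cut by the indicators of [U] and of its complement;
    [upper_integral_open_split] treats the terms one by one, and countable subadditivity reassembles
    them. *)
Lemma riesz_outer_open (U : set K) : open U -> caratheodory_measurable riesz_outer U.
Proof.
move=> oU; apply: le_caratheodory_measurable => X.
apply: le_ereal_inf_tmp => _ [f [fc f0 fX] <-].
have sub V : (riesz_outer (X `&` V) <= \sum_(k <oo) uint (fun x => (f k x * \1_V x)%:E))%E.
  apply: upper_integral_series => [x|n x]; last by rewrite lee_fin mulr_ge0// indicE.
  have [xV|xV] := boolP (x \in V).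
    rewrite indicE in_setI xV andbT -indicE (le_trans (fX x))//.
    by apply: lee_nneseries => k _ //; rewrite ?lee_fin// indicE xV mulr1.
  rewrite indicE in_setI (negbTE xV) andbF.
  by apply: nneseries_ge0 => k _ _; rewrite lee_fin mulr_ge0// indicE.
apply: (le_trans (leeD (sub U) (sub (~` U)))).
rewrite -nneseriesD; try by move=> *; exact: upper_integral_ge0.
apply: lee_nneseries => k _; last exact: upper_integral_open_split.
by move=> _; apply: adde_ge0; exact: upper_integral_ge0.
Qed.

Lemma riesz_outer_borel (A : set (borel K)) :
  measurable A -> caratheodory_measurable riesz_outer A.
Proof.
apply: smallest_sub; last exact: riesz_outer_open.
split=> [|B mB|F mF]; first exact: caratheodory_measurable_set0.
  by rewrite setTD; exact: caratheodory_measurable_setC.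
exact: caratheodory_measurable_bigcup.
Qed.

(** The function [riesz_outer] again, on the type that carries the Borel sigma-algebra, so that it
    can receive a measure structure beside the outer measure structure. *)
Definition riesz_measure (A : set (borel K)) : \bar R := riesz_outer A.

Let riesz_measure_sigma_additive : semi_sigma_additive riesz_measure.
Proof.
move=> F mF tF mUF.
apply: (@caratheodory_measure_sigma_additive R K riesz_outer) => //.
  by move=> i; exact: riesz_outer_borel.
exact: riesz_outer_borel.
Qed.

HB.instance Definition _ := isMeasure.Build _ _ _ riesz_measure
  riesz_outer0 riesz_outer_ge0 riesz_measure_sigma_additive.

Lemma riesz_measureT : riesz_measure setT = (L (fun=> 1))%:E.
Proof.
rewrite -(@upper_integral_cts (fun=> 1))//; last by move=> x; exact: cvg_cst.
by congr uint; apply/funext => x; rewrite indicT.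
Qed.

(** Truncation to [[0, 1]]; its shifts by integers cut a nonnegative number into slices of height
    1. *)
Let layer (y : R) : R := Num.max 0 (Num.min 1 y).

Let layer_sum (y : R) n : 0 <= y -> \sum_(0 <= i < n) layer (y - i%:R) = Num.min y n%:R.
Proof.
move=> y0; elim: n => [|n IH]; first by rewrite big_geq// min_r.
rewrite big_nat_recr//= IH /layer -[in RHS]natr1.
have n0 : 0 <= n%:R :> R by rewrite ler0n.
have /orP[yn|ny] : (y <= n%:R) || (n%:R < y) by rewrite leNgt orNb.
  by rewrite (min_l yn) (min_r (_ : y - n%:R <= 1)) ?(max_l (_ : y - n%:R <= 0)) ?min_l ?addr0//; lra.
have /orP[yn1|ny1] : (y <= n%:R + 1) || (n%:R + 1 < y) by rewrite leNgt orNb.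
  by rewrite (min_r (ltW ny)) (min_l yn1) (min_r (_ : y - n%:R <= 1)) ?max_r; lra.
by rewrite (min_r (ltW ny)) (min_r (ltW ny1)) (min_l (_ : 1 <= y - n%:R)) ?max_r//; lra.
Qed.

Let step_sum (y : R) n : 0 <= y ->
  \sum_(0 <= i < n) ((i%:R < y)%R%:R : R) <= Num.min n%:R (y + 1).
Proof.
move=> y0; elim: n => [|n IH]; first by rewrite big_geq// le_min lexx addr_ge0.
rewrite big_nat_recr//=; move: IH; set S := \sum_(_ <= _ < _) _; rewrite -natr1.
case: (ltP n%:R y) => ny /=; rewrite ?mulr0n ?mulr1n !le_min => /andP[S1 S2];
  apply/andP; split; lra.
Qed.

(** The slices [phi i] of [N * f] lie below the indicators of the [A i], whence
    [L (phi i) <= riesz_measure (A i)]. These indicators sum to at most [N * f + 1], and the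
    resulting error [L 1] does not grow with [N]. *)
Let layer_bound (f : K -> R) (N : nat) : continuous f -> (forall x, 0 <= f x <= 1) ->
  ((N%:R * L f)%:E <= N%:R%:E * \int[riesz_measure]_x (f x)%:E + (L (fun=> 1))%:E)%E.
Proof.
move=> fc f01; have f0 x : 0 <= f x by have /andP[] := f01 x.
have mf := continuous_borel_measurable_real fc.
pose phi i x := layer (N%:R * f x - i%:R).
pose A i : set (borel K) := [set x | i%:R < N%:R * f x].
have Nfc : continuous (fun x => N%:R * f x).
  by move=> x; apply: cvgM; [exact: cvg_cst|exact: fc].
have phic i : continuous (phi i).
  move=> x; apply: (@continuous_max R K (cst 0)
    (fun z => Num.min 1 (N%:R * f z - i%:R)) x); first exact: cvg_cst.
  apply: (@continuous_min R K (cst 1) (fun z => N%:R * f z - i%:R) x).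
    exact: cvg_cst.
  by apply: cvgB; [exact: Nfc|exact: cvg_cst].
have phi0 i x : 0 <= phi i x by rewrite le_max lexx.
have mA i : measurable (A i).
  apply: open_borel_measurable.
  apply: (@open_comp _ _ (fun x => N%:R * f x) [set y | i%:R < y]) => [x _|]; first exact: Nfc.
  exact: open_gt.
have AE i x : \1_(A i) x = (i%:R < N%:R * f x)%R%:R :> R.
  by rewrite indicE; congr (nat_of_bool _)%:R; apply/idP/idP => [/set_mem|/mem_set].
have -> : N%:R * L f = \sum_(0 <= i < N) L (phi i).
  rewrite -LZ// -(functional_sum LD LZ)//; congr L; apply/funext => x.
  by rewrite layer_sum ?mulr_ge0// min_l// ler_piMr//; have /andP[] := f01 x.
apply: (@le_trans _ _ (\sum_(0 <= i < N) riesz_measure (A i))%E).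
  rewrite -sumEFin; apply: lee_sum => i _.
  rewrite -(upper_integral_cts (phic i) (phi0 i)); apply: le_upper_integral => x.
  rewrite lee_fin AE /phi /layer; case: ltP => /= h.
    by rewrite ge_max ler01 ge_min lexx.
  by rewrite ge_max lexx ge_min orbC subr_le0 h.
have -> : (\sum_(0 <= i < N) riesz_measure (A i) =
    \int[riesz_measure]_x \sum_(0 <= i < N) (\1_(A i) x)%:E)%E.
  rewrite ge0_integral_sum//; first by apply: eq_bigr => i _; rewrite integral_indic// setIT.
  by move=> i; apply/measurable_EFinP; exact: measurable_indic.
rewrite -riesz_measureT -[riesz_measure setT]mul1e -integral_cst// -ge0_integralZl//; last 2 first.
- exact/measurable_EFinP.
- by move=> x _; rewrite lee_fin.
rewrite -ge0_integralD//; last 2 first.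
- by move=> x _; rewrite mule_ge0// lee_fin.
- by apply: measurable_funeM; exact/measurable_EFinP.
apply: ge0_le_integral => //.
- by move=> x _; apply: sume_ge0 => i _; rewrite lee_fin indicE.
- by apply: emeasurable_sum => i; apply/measurable_EFinP; exact: measurable_indic.
- apply: emeasurable_funD => //; apply: measurable_funeM; exact/measurable_EFinP.
- move=> x _; rewrite sumEFin -EFinM -EFinD lee_fin.
  under eq_bigr do rewrite AE.
  by rewrite (le_trans (step_sum _ _)) ?mulr_ge0// ge_min lexx orbT.
Qed.

Let riesz_measure_fin : fin_num_fun riesz_measure.
Proof.
move=> A mA; rewrite ge0_fin_numE ?measure_ge0//.
apply: (@le_lt_trans _ _ (riesz_measure setT)).
  by apply: le_measure; rewrite ?inE.
by rewrite riesz_measureT ltry.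
Qed.

HB.instance Definition _ := Measure_isFinite.Build _ _ _ riesz_measure riesz_measure_fin.

Let unit_integrable (f : K -> R) : continuous f -> (forall x, 0 <= f x <= 1) ->
  riesz_measure.-integrable setT (EFin \o f).
Proof.
move=> fc f01.
apply: (@le_integrable _ _ _ riesz_measure _ measurableT _ (EFin \o cst 1)).
- by apply/measurable_EFinP; exact: continuous_borel_measurable_real.
- move=> x _ /=; rewrite lee_fin normr1; have /andP[f0 f1] := f01 x.
  by rewrite ger0_norm.
- exact: finite_measure_integrable_cst.
Qed.

Let le_unit_integral (f : K -> R) : continuous f -> (forall x, 0 <= f x <= 1) ->
  ((L f)%:E <= \int[riesz_measure]_x (f x)%:E)%E.
Proof.
move=> fc f01; have := integrable_fin_num measurableT (unit_integrable fc f01).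
move=> /fineK <-; set I := fine _; rewrite lee_fin leNgt; apply/negP => IL.
have LI : 0 < L f - I by rewrite subr_gt0.
(* A gap [L f - I] multiplied by a large [N] outgrows the constant error [L 1] of [layer_bound]. *)
have [N NLI] : exists N : nat, L (fun=> 1) < N%:R * (L f - I).
  exists (Num.truncn (L (fun=> 1) / (L f - I))).+1.
  by rewrite -ltr_pdivrMr// truncnS_gt.
have := layer_bound N fc f01.
rewrite -[(\int[_]_x _)%E]fineK; last exact: (integrable_fin_num measurableT (unit_integrable fc f01)).
rewrite -/I -EFinM -EFinD lee_fin; move: NLI; rewrite mulrBr; lra.
Qed.

Let cst_integral (a : R) : (\int[riesz_measure]_x a%:E = (a * L (fun=> 1))%:E)%E.
Proof. by rewrite EFinM -riesz_measureT -integral_cst. Qed.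

(** The reverse inequality is [le_unit_integral] for [1 - f], as [L] and the integral agree on
    constants. *)
Let unit_integral (f : K -> R) : continuous f -> (forall x, 0 <= f x <= 1) ->
  (\int[riesz_measure]_x (f x)%:E = (L f)%:E)%E.
Proof.
move=> fc f01; apply/eqP; rewrite eq_le le_unit_integral// andbT.
have c1 : continuous (fun _ : K => 1 : R) by move=> x; exact: cvg_cst.
have gc : continuous (fun x => 1 - f x) by move=> x; apply: cvgB; [exact: c1|exact: fc].
have /(le_unit_integral gc) : forall x, 0 <= 1 - f x <= 1.
  by move=> x; have := f01 x; lra.
rewrite (functionalB LD LZ)// EFinB.
under eq_integral do rewrite EFinB.
rewrite (integralB_EFin measurableT (finite_measure_integrable_cst _ 1 measurableT) (unit_integrable fc f01)).
rewrite /= cst_integral mul1r.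
rewrite -[(\int[_]_x _)%E]fineK; last exact: (integrable_fin_num measurableT (unit_integrable fc f01)).
by rewrite -!EFinB !lee_fin; lra.
Qed.

Let affine_cts (f : K -> R) (a b : R) : continuous f -> continuous (fun x => a * f x + b).
Proof.
by move=> fc x; apply: cvgD; [apply: cvgM; [exact: cvg_cst|exact: fc]|exact: cvg_cst].
Qed.

Lemma integral_riesz_measure (f : K -> R) : continuous f ->
  (\int[riesz_measure]_x (f x)%:E = (L f)%:E)%E.
Proof.
move=> fc; have [M M0 fM] : exists2 M, 0 < M & forall x, `|f x| <= M.
  have fc' : {within [set: K], continuous (fun x => `|f x|)}.
    by apply: continuous_subspaceT => x; apply: continuous_comp; [exact: fc|exact: norm_continuous].
  have [c _ cmax] := compact_EVT_max (ex_intro _ point I) compact_space fc'.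
  by exists (`|f c| + 1) => [|x]; rewrite ?ltr_pwDr// (le_trans (cmax x _)) ?inE// lerDl.
(* The affine map that brings [[- M, M]] onto [[0, 1]]. *)
pose g x := (2 * M)^-1 * f x + 2^-1.
have gc : continuous g by exact: affine_cts.
have fE x : f x = 2 * M * (g x - 2^-1) by rewrite /g addrK mulrA mulfV ?mul1r// mulf_neq0// gt_eqF.
have g01 x : 0 <= g x <= 1.
  have := fM x; rewrite ler_norml => /andP[f1 f2].
  have M2 : 0 < 2 * M by rewrite mulr_gt0.
  have : 2 * M * (g x - 2^-1) = f x by rewrite fE.
  move=> h; apply/andP; split.
    by rewrite -(ler_pM2l M2); lra.
  by rewrite -(ler_pM2l M2); lra.
have ig := unit_integrable gc g01.
have -> : f = (fun x => 2 * M * (g x - 2^-1)) by apply/funext => x.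
have c1 a : continuous (fun _ : K => a : R) by move=> x; exact: cvg_cst.
rewrite LZ; last by move=> x; apply: cvgB; [exact: gc|exact: c1].
under eq_integral do rewrite EFinM.
have ih : riesz_measure.-integrable setT (EFin \o (fun x => g x - 2^-1)).
  exact: (integrableB measurableT ig (finite_measure_integrable_cst _ 2^-1 measurableT)).
rewrite integralZl// [in RHS]EFinM; congr (_ * _)%E.
under eq_integral do rewrite EFinB.
rewrite (integralB_EFin measurableT ig (finite_measure_integrable_cst _ 2^-1 measurableT)).
rewrite unit_integral//= cst_integral -EFinB (functionalB LD LZ)//.
by rewrite (functional_cst LZ (2^-1)).
Qed.

Theorem riesz_representation : exists mu : {measure set (borel K) -> \bar R},
  forall f : K -> R, continuous f -> (\int[mu]_x (f x)%:E = (L f)%:E)%E.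
Proof. by exists riesz_measure => f; exact: integral_riesz_measure. Qed.

End riesz.

(** * Total variation *)

Section bounded_integrals.
Context d (T : measurableType d) (R : realType) (mu : {finite_measure set T -> \bar R}).

Lemma bounded_integrable (f : T -> R) (M : R) : measurable_fun setT f ->
  (forall x, `|f x| <= M) -> mu.-integrable setT (EFin \o f).
Proof.
move=> mf fM.
apply: (@le_integrable _ _ _ mu _ measurableT _ (EFin \o cst M)).
- exact/measurable_EFinP.
- by move=> x _ /=; rewrite lee_fin (le_trans (fM x))// ler_norm.
- exact: finite_measure_integrable_cst.
Qed.

Lemma bounded_cvg_Rintegral (f_ : nat -> T -> R) (f : T -> R) (M : R) :
  (forall n, measurable_fun setT (f_ n)) -> measurable_fun setT f ->
  (forall x, f_ n x @[n --> \oo] --> f x) -> (forall n x, `|f_ n x| <= M) ->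
  (\int[mu]_x f_ n x)%R @[n --> \oo] --> (\int[mu]_x f x)%R.
Proof.
move=> mf_ mf f_f fM.
have [] := @dominated_convergence _ T R mu setT measurableT
  (fun n => EFin \o f_ n) (EFin \o f) (EFin \o cst M).
- by move=> n; exact/measurable_EFinP.
- exact/measurable_EFinP.
- by apply: aeW => x _; apply: cvg_EFin; [exact: nearW|exact: f_f].
- exact: finite_measure_integrable_cst.
- by apply: aeW => x n _ /=; rewrite lee_fin.
move=> fi _ fcvg; apply: fine_cvg; rewrite fineK//.
exact: (integrable_fin_num measurableT fi).
Qed.

End bounded_integrals.

Lemma dist_max (R : realDomainType) (a b c d : R) :
  `|Num.max a b - Num.max c d| <= `|a - c| + `|b - d|.
Proof.
have := ler_norm (a - c); have := ler_norm (b - d).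
have := ler_norm (c - a); have := ler_norm (d - b); rewrite distrC [`|c - a|]distrC.
have := normr_ge0 (a - c); have := normr_ge0 (b - d).
move: `|a - c| `|b - d| => u v ? ? ? ? ? ?; rewrite ler_norml.
by rewrite /Num.max; case: ltP => ?; case: ltP => ?; lra.
Qed.

Section continuous_approximation.
Variables (R : realType) (K : compactType).
Hypotheses (hK : hausdorff_space K) (sK : @second_countable K).
Variables (mu nu : {finite_measure set (borel K) -> \bar R}).
Implicit Types (h : borel K -> R) (f : K -> R).

Let unit_valued h := measurable_fun setT h /\ forall x, 0 <= h x <= 1.

Let unit_dist h h' : unit_valued h -> unit_valued h' ->
  measurable_fun setT (fun x => `|h x - h' x|) /\
  forall x, `|h x - h' x| <= 1.
Proof.
move=> [mh h01] [mh' h01']; split.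
  by apply: measurableT_comp => //; exact: measurable_funB.
by move=> x; rewrite ler_norml; have := h01 x; have := h01' x; lra.
Qed.

Let dist_integrable (m : {finite_measure set (borel K) -> \bar R}) h h' :
  unit_valued h -> unit_valued h' ->
  m.-integrable setT (EFin \o (fun x => `|h x - h' x|)).
Proof.
move=> uh uh'; have [md d1] := unit_dist uh uh'.
by apply: (bounded_integrable _ (M := 1)) => // x; rewrite normr_id.
Qed.

(** One [f] has to serve [mu] and [nu] at once and to stay within [[0, 1]], the class of test
    functions in [measure_dist_le]. *)
Definition L1_approximable h := forall e : R, 0 < e -> exists f,
  [/\ continuous f, forall x, 0 <= f x <= 1,
      (\int[mu]_x `|h x - f x| <= e)%R & (\int[nu]_x `|h x - f x| <= e)%R].

Let cts_unit f : continuous f -> (forall x, 0 <= f x <= 1) -> unit_valued f.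
Proof. by move=> fc f01; split=> //; exact: continuous_borel_measurable_real. Qed.

Lemma L1_approximable_cts f : continuous f -> (forall x, 0 <= f x <= 1) ->
  L1_approximable f.
Proof.
move=> fc f01 e e0; exists f; split=> //; under eq_Rintegral do rewrite subrr normr0.
  by rewrite Rintegral_cst// mul0r ltW.
by rewrite Rintegral_cst// mul0r ltW.
Qed.

Let dist_triangle (m : {finite_measure set (borel K) -> \bar R}) h1 h2 h3 :
  unit_valued h1 -> unit_valued h2 -> unit_valued h3 ->
  (\int[m]_x `|h1 x - h3 x| <= \int[m]_x `|h1 x - h2 x| + \int[m]_x `|h2 x - h3 x|)%R.
Proof.
move=> u1 u2 u3; rewrite -RintegralD//; try exact: dist_integrable.
apply: le_Rintegral => //; first exact: dist_integrable.
- apply: (bounded_integrable _ (M := 2)).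
    by apply: measurable_funD; [exact: (unit_dist u1 u2).1|exact: (unit_dist u2 u3).1].
  move=> x; rewrite ger0_norm ?addr_ge0//.
  by have := (unit_dist u1 u2).2 x; have := (unit_dist u2 u3).2 x; lra.
- by move=> x _; exact: ler_distD.
Qed.

Lemma L1_approximable_cvg (h_ : nat -> borel K -> R) h :
  (forall n, unit_valued (h_ n)) -> unit_valued h ->
  (forall x, h_ n x @[n --> \oo] --> h x) ->
  (forall n, L1_approximable (h_ n)) -> L1_approximable h.
Proof.
move=> uh_ uh h_h ah_ e e0.
have cvg0 (m : {finite_measure set (borel K) -> \bar R}) :
    \forall n \near \oo, (\int[m]_x `|h x - h_ n x| <= e / 2)%R.
  have : (\int[m]_x `|h x - h_ n x|)%R @[n --> \oo] --> (\int[m]_x 0)%R.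
    apply: (bounded_cvg_Rintegral (M := 1)).
    - by move=> n; exact: (unit_dist uh (uh_ n)).1.
    - exact: measurable_cst.
    - move=> x; rewrite -(normr0 R) -(subrr (h x)); apply: cvg_norm.
      by apply: cvgB; [exact: cvg_cst|exact: h_h].
    - by move=> n x; rewrite normr_id; exact: (unit_dist uh (uh_ n)).2.
  rewrite Rintegral_cst// mul0r => /cvgrPdist_le/(_ (e / 2) ltac:(lra)).
  apply: filterS => n; rewrite sub0r normrN; apply: le_trans; exact: ler_norm.
have [n [/= hn hn']] := filter_ex (filterI (cvg0 mu) (cvg0 nu)).
have [f [fc f01 fmu fnu]] := ah_ n (e / 2) ltac:(lra).
exists f; split=> //.
  by have := dist_triangle mu uh (uh_ n) (cts_unit fc f01); lra.
by have := dist_triangle nu uh (uh_ n) (cts_unit fc f01); lra.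
Qed.

Let indic_unit (A : set (borel K)) : measurable A -> unit_valued \1_A.
Proof. by move=> mA; split=> [|x]; [exact: measurable_indic|rewrite indicE; case: (x \in A) => /=; rewrite lexx ler01]. Qed.

Let approximable_open (U : set K) : open U -> L1_approximable (\1_U : borel K -> R).
Proof.
move=> oU; have [g [gc g01 g0 gS g1]] := open_exhaustion R hK sK oU.
apply: (L1_approximable_cvg (h_ := g)) => [n| |x|n].
- exact: cts_unit.
- by apply: indic_unit; exact: open_borel_measurable.
- rewrite indicE; have [xU|xU] := boolP (x \in U).
    by apply: cvg_near_cst; apply: g1; exact: set_mem.
  apply: cvg_near_cst; apply: nearW => n; apply: g0 => Ux.
  by rewrite mem_set in xU.
- exact: L1_approximable_cts.
Qed.

Let approximableC (A : set (borel K)) :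
  L1_approximable (\1_A : borel K -> R) -> L1_approximable (\1_(~` A) : borel K -> R).
Proof.
move=> aA e e0; have [f [fc f01 fmu fnu]] := aA e e0.
exists (fun x => 1 - f x); split.
- by move=> x; apply: cvgB; [exact: cvg_cst|exact: fc].
- by move=> x; have := f01 x; lra.
all: have -> : (fun x => `|\1_(~` A) x - (1 - f x)|) = (fun x => `|\1_A x - f x|) => //.
all: apply/funext => x; rewrite !indicE in_setC -normrN; congr `|_|.
all: by case: (x \in A) => /=; lra.
Qed.

(** The maximum of the two approximants; by [dist_max] the errors add up. *)
Let approximableU (A B : set (borel K)) : measurable A -> measurable B ->
  L1_approximable (\1_A : borel K -> R) -> L1_approximable (\1_B : borel K -> R) ->
  L1_approximable (\1_(A `|` B) : borel K -> R).
Proof.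
move=> mA mB aA aB e e0.
have [f [fc f01 fmu fnu]] := aA (e / 2) ltac:(lra).
have [g [gc g01 gmu gnu]] := aB (e / 2) ltac:(lra).
pose k x := Num.max (f x) (g x).
have kc : continuous k by move=> x; apply: continuous_max; [exact: fc|exact: gc].
have k01 x : 0 <= k x <= 1.
  have /andP[f0 f1] := f01 x; have /andP[g0 g1] := g01 x.
  by rewrite /k le_max f0 ge_max f1 g1.
have uA := indic_unit mA; have uB := indic_unit mB.
have bound (m : {finite_measure set (borel K) -> \bar R}) :
    (\int[m]_x `|\1_(A `|` B) x - k x| <=
     \int[m]_x `|\1_A x - f x| + \int[m]_x `|\1_B x - g x|)%R.
  have iA := dist_integrable m uA (cts_unit fc f01).
  have iB := dist_integrable m uB (cts_unit gc g01).
  rewrite -RintegralD//; apply: le_Rintegral => //.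
  - by apply: dist_integrable; [apply: indic_unit; exact: measurableU|exact: cts_unit].
  - exact: (integrableD measurableT iA iB).
  - move=> x _; have -> : \1_(A `|` B) x = Num.max (\1_A x) (\1_B x) :> R.
      rewrite !indicE in_setU; case: (x \in A); case: (x \in B) => /=.
      - by rewrite maxxx.
      - by rewrite max_l.
      - by rewrite max_r.
      - by rewrite maxxx.
    exact: dist_max.
exists k; split=> //.
  by have := bound mu; lra.
by have := bound nu; lra.
Qed.

(** The approximable measurable sets contain the open sets and form a sigma-algebra: a countable
    union is the limit of its finite partial unions, whose indicators converge pointwise. *)
Lemma L1_approximable_measurable (A : set (borel K)) : measurable A ->
  L1_approximable (\1_A : borel K -> R).
Proof.
move=> mA; suff [] : measurable A /\ L1_approximable (\1_A : borel K -> R) by [].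
move: A mA; apply: smallest_sub; last first.
  by move=> U oU; split; [exact: open_borel_measurable|exact: approximable_open].
split=> [|B [mB aB]|F mF].
- split=> //; rewrite indic0; apply: L1_approximable_cts => [x|x]; first exact: cvg_cst.
  by rewrite lexx ler01.
- by rewrite setTD; split; [exact: measurableC|exact: approximableC].
- have mU : measurable (\bigcup_k F k : set (borel K)).
    by apply: bigcupT_measurable => k; exact: (mF k).1.
  split=> //.
  pose B n : set (borel K) := \big[setU/set0]_(k < n) F k.
  have mB n : measurable (B n) /\ L1_approximable (\1_(B n) : borel K -> R).
    elim: n => [|n [IH1 IH2]].
      rewrite /B big_ord0; split=> //; rewrite indic0.
      by apply: L1_approximable_cts => [x|x]; [exact: cvg_cst|rewrite lexx ler01].
    rewrite /B big_ord_recr /= -/(B n); split; first by apply: measurableU => //; exact: (mF n).1.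
    by apply: approximableU => //; [exact: (mF n).1|exact: (mF n).2].
  apply: (L1_approximable_cvg (h_ := fun n => \1_(B n))) => [n| |x|n].
  + by apply: indic_unit; exact: (mB n).1.
  + exact: indic_unit.
  + have [[k _ Fkx]|nF] := pselect ((\bigcup_k F k) x).
      apply: cvg_near_cst; exists k.+1 => // n /= kn.
      rewrite !indicE !mem_set//; first by exists k.
      by rewrite /B -bigcup_mkord; exists k.
    apply: cvg_near_cst; apply: nearW => n; rewrite !indicE !memNset//.
    by rewrite /B -bigcup_mkord => -[k _ Fkx]; apply: nF; exists k.
  + exact: (mB n).2.
Qed.

(** Vector states give estimates on continuous test functions only, whereas the total variation is
    about Borel sets; this is the passage from the former to the latter. *)
Lemma measure_dist_le (c : R) :
  (forall f, continuous f -> (forall x, 0 <= f x <= 1) ->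
    `|\int[mu]_x f x - \int[nu]_x f x| <= c)%R ->
  forall A : set (borel K), measurable A -> (`|fine (mu A) - fine (nu A)| <= c)%R.
Proof.
move=> fcts A mA; apply/ler_addgt0Pr => e e0.
have [f [fc f01 fmu fnu]] := L1_approximable_measurable mA (ltac:(lra) : 0 < e / 2).
have near_f (m : {finite_measure set (borel K) -> \bar R}) :
    (\int[m]_x `|\1_A x - f x| <= e / 2 -> `|fine (m A) - \int[m]_x f x| <= e / 2)%R.
  apply: le_trans.
  have -> : (fine (m A) = \int[m]_x \1_A x)%R.
    by rewrite /Rintegral integral_indic// setIT.
  have iA : m.-integrable setT (EFin \o \1_A).
    apply: (bounded_integrable _ (M := 1)) => [|x]; first exact: (indic_unit mA).1.
    by rewrite ger0_norm; have /andP[] := (indic_unit mA).2 x.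
  have jf : m.-integrable setT (EFin \o f).
    apply: (bounded_integrable _ (M := 1)) => [|x]; first exact: (cts_unit fc f01).1.
    by have /andP[? ?] := f01 x; rewrite ger0_norm.
  rewrite -RintegralB//; apply: le_normr_Rintegral => //.
  exact: (integrableB measurableT iA jf).
have h1 := near_f mu fmu; have h2 := near_f nu fnu; have h3 := fcts f fc f01.
move: h1 h2 h3; rewrite !ler_norml; lra.
Qed.

End continuous_approximation.

Section variation_norm_theory.
Context d (T : measurableType d) (R : realType).
Variables (mu nu : {finite_measure set T -> \bar R}).

Let fin_mu A : measurable A -> mu A = (fine (mu A))%:E.
Proof. by move=> mA; rewrite fineK// fin_num_measure. Qed.

Let fin_nu A : measurable A -> nu A = (fine (nu A))%:E.
Proof. by move=> mA; rewrite fineK// fin_num_measure. Qed.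

(** The cells of a partition where [mu - nu] is nonnegative have a union to which the hypothesis
    applies, and so have the other cells; hence the factor 2. *)
Lemma variation_norm_le (c : R) :
  (forall A, measurable A -> `|fine (mu A) - fine (nu A)| <= c) ->
  (variation_norm (fun A => mu A - nu A) <= (2 * c)%:E)%E.
Proof.
move=> Ac; apply: ge_ereal_sup => _ [n [A [mA tA _ ->]]].
pose w i := fine (mu (A i)) - fine (nu (A i)).
have wE (P : pred 'I_n) : \sum_(i < n | P i) w i =
    fine (mu (\big[setU/set0]_(i < n | P i) A i)) -
    fine (nu (\big[setU/set0]_(i < n | P i) A i)).
  by rewrite !measure_bigsetU_ord// -!sum_fine ?sumrB// => i _; exact: fin_num_measure.
have mP (P : pred 'I_n) : measurable (\big[setU/set0]_(i < n | P i) A i).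
  by apply: bigsetU_measurable => i _; exact: mA.
rewrite (eq_bigr (fun i => `|w i|%:E)); last first.
  by move=> i _; rewrite (fin_mu (mA i)) (fin_nu (mA i)).
rewrite sumEFin lee_fin (bigID (fun i => 0 <= w i))/=.
rewrite (eq_bigr w); last by move=> i /ger0_norm.
rewrite [X in _ + X](eq_bigr (fun i => - w i)); last first.
  by move=> i; rewrite -ltNge => /ltW /ler0_norm.
rewrite sumrN !wE; have := Ac _ (mP (fun i => 0 <= w i)).
have := Ac _ (mP (fun i => ~~ (0 <= w i))).
rewrite !ler_norml; lra.
Qed.

(** The partition into [A] and its complement. For the set where one density exceeds another it
    yields their L1 distance, and for [setT] the nonnegativity of the variation norm. *)
Lemma le_variation_norm (A : set T) : measurable A ->
  ((`|fine (mu A) - fine (nu A)| + `|fine (mu (~` A)) - fine (nu (~` A))|)%:E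
   <= variation_norm (fun A => mu A - nu A))%E.
Proof.
move=> mA; apply: ereal_sup_ubound.
exists 2%N, (fun i => if i == ord0 then A else ~` A); split.
- by move=> i; case: ifP => // _; exact: measurableC.
- apply/trivIsetP => i j _ _; move: i j => [[|[|//]] ?] [[|[|//]] ?] //= _.
    by rewrite setICr.
  by rewrite setICl.
- apply/seteqP; split=> // x _; have [Ax|nAx] := pselect (A x).
    by exists ord0.
  by exists ord_max.
rewrite !big_ord_recl big_ord0 /= adde0.
by rewrite (fin_mu mA) (fin_nu mA) (fin_mu (measurableC mA)) (fin_nu (measurableC mA)).
Qed.

End variation_norm_theory.

(** * Measures from unit vectors *)

Section normalized_measure.
Context d (T : measurableType d) (R : realType) (mu : {measure set T -> \bar R}).
Hypothesis mu1 : mu setT = 1%E.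

(** A copy of [mu] on which the hypothesis [mu1] installs the structure of a probability. *)
Definition unit_mass_measure : set T -> \bar R := mu.
HB.instance Definition _ := Measure.on unit_mass_measure.
HB.instance Definition _ := Measure_isProbability.Build _ _ _ unit_mass_measure mu1.

Lemma unit_mass_probability : exists P : probability T R,
  forall f : T -> \bar R, (\int[P]_x f x = \int[mu]_x f x)%E.
Proof. by exists unit_mass_measure. Qed.

End normalized_measure.

Section complex_functions.
Variables (R : realType) (K : topologicalType).

Lemma Cx_reB (z w : Cx R) : Cx_re (z - w) = Cx_re z - Cx_re w.
Proof. by case: z w => [? ?] [? ?]. Qed.

Lemma Cx_imB (z w : Cx R) : Cx_im (z - w) = Cx_im z - Cx_im w.
Proof. by case: z w => [? ?] [? ?]. Qed.

Lemma Cx_re_continuous : continuous (@Cx_re R).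
Proof.
move=> z; apply/(@cvgrPdist_lt _ _ _ (nbhs z)) => e e0.
have e0' := etrans (realC_gt0 e) e0.
near=> w.
have : ball z (e%:C%C : Cx R) w by near: w; exact: nbhsx_ballx.
rewrite -ball_normE /= [`|z - w|]Cx_normE real_ltC; apply: le_lt_trans.
by rewrite -Cx_reB; exact: Cx_re_le.
Unshelve. all: by end_near. Qed.

Lemma Cx_im_continuous : continuous (@Cx_im R).
Proof.
move=> z; apply/(@cvgrPdist_lt _ _ _ (nbhs z)) => e e0.
have e0' := etrans (realC_gt0 e) e0.
near=> w.
have : ball z (e%:C%C : Cx R) w by near: w; exact: nbhsx_ballx.
rewrite -ball_normE /= [`|z - w|]Cx_normE real_ltC; apply: le_lt_trans.
by rewrite -Cx_imB; exact: Cx_im_le.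
Unshelve. all: by end_near. Qed.

Lemma Cfun_re_continuous (F : Cfun R K) : continuous (fun x => Cx_re (F x)).
Proof.
by move=> x; apply: continuous_comp; [exact: (@cts_fun _ _ F)|exact: Cx_re_continuous].
Qed.

Lemma Cfun_im_continuous (F : Cfun R K) : continuous (fun x => Cx_im (F x)).
Proof.
by move=> x; apply: continuous_comp; [exact: (@cts_fun _ _ F)|exact: Cx_im_continuous].
Qed.

Lemma realC_continuous : continuous (fun a : R => a%:C%C : Cx R).
Proof.
move=> a; apply/(@cvgrPdist_lt _ _ _ (nbhs a)) => e e0.
have er := ge0_Cx (ltW e0); have re0 : 0 < Cx_re e by rewrite -realC_gt0 -er.
near=> b; rewrite -(rmorphB (real_complex R)) Cx_normr_real er real_ltC.
by near: b; apply: (@cvgr_dist_lt _ _ _ (nbhs a) _ id a) => //; exact: cvg_id.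
Unshelve. all: by end_near. Qed.

Lemma realC_fun_continuous (f : K -> R) : continuous f ->
  continuous (fun x => (f x)%:C%C : Cx R).
Proof.
by move=> fc x; apply: continuous_comp; [exact: fc|exact: realC_continuous].
Qed.

Definition Cfun_real (f : K -> R) (fc : continuous f) : Cfun R K :=
  mkcts (realC_fun_continuous fc).

End complex_functions.

Section vector_states.
Variables (R : realType) (K : compactType) (H : hilbertType (Cx R)).
Hypotheses (hK : hausdorff_space K) (sK : @second_countable K).
Variables (r : Cfun R K -> H -> H) (xi : H).
Hypothesis rep_r : representation r.

Local Notation state F := (inner (r F xi) xi).

Let stateD F G : state (F + G) = state F + state G.
Proof. by case: rep_r => _ rl _ _ _; rewrite (linfD (rl xi)) innerDl. Qed.

Let stateZ a F : state (a *: F) = a * state F.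
Proof. by case: rep_r => _ rl _ _ _; rewrite (linfZ (rl xi)) innerZl. Qed.

Let state_square F : state (cmul (star F) F) = `|r F xi| ^+ 2.
Proof. by case: rep_r => _ _ _ rM rs; rewrite rM rs norm_inner. Qed.

Let state_real (f : K -> R) (fc : continuous f) :
  state (Cfun_real fc) = (Cx_re (state (Cfun_real fc)))%:C%C.
Proof.
have : (state (Cfun_real fc))^* = state (Cfun_real fc).
  case: rep_r => _ _ _ _ rs; rewrite -inner_conj -rs; congr (inner (r _ _) _).
  apply: CfunP => x; apply: (congr1 (fun z : R => (f x +i* z)%C)); exact: oppr0.
case: (state _) => a b; rewrite /Cx_re /= => -[] /eqP.
by rewrite eqNr => /eqP ->.
Qed.

(** The Riesz theorem takes a functional on arbitrary functions [K -> R], of which only the values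
    at continuous functions count; 0 is a default. *)
Let L (f : K -> R) : R :=
  if pselect (continuous f) is left fc then Cx_re (state (Cfun_real fc)) else 0.

Let LE (f : K -> R) (fc : continuous f) : state (Cfun_real fc) = (L f)%:C%C.
Proof.
rewrite state_real /L; case: pselect => // fc'.
by congr ((Cx_re (inner (r _ _) _))%:C%C); exact: CfunP.
Qed.

Let LD (f g : K -> R) : continuous f -> continuous g ->
  L (fun x => f x + g x) = L f + L g.
Proof.
move=> fc gc; have fgc : continuous (fun x => f x + g x).
  by move=> x; apply: cvgD; [exact: fc|exact: gc].
apply: (@complexI R); rewrite -(LE fgc) rmorphD /= -(LE fc) -(LE gc) -stateD.
by congr (inner (r _ _) _); apply: CfunP => x; exact: (rmorphD (real_complex R)).
Qed.

Let LZ (a : R) (f : K -> R) : continuous f -> L (fun x => a * f x) = a * L f.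
Proof.
move=> fc; have afc : continuous (fun x => a * f x).
  by move=> x; apply: cvgM; [exact: cvg_cst|exact: fc].
apply: (@complexI R); rewrite -(LE afc) rmorphM /= -(LE fc) -stateZ.
by congr (inner (r _ _) _); apply: CfunP => x; exact: (rmorphM (real_complex R)).
Qed.

Let L_ge0 (f : K -> R) : continuous f -> (forall x, 0 <= f x) -> 0 <= L f.
Proof.
move=> fc f0; have gc : continuous (fun x => Num.sqrt (f x)).
  by move=> x; apply: continuous_comp; [exact: fc|exact: sqrt_continuous].
rewrite -real_leC -(LE fc).
suff -> : Cfun_real fc = cmul (star (Cfun_real gc)) (Cfun_real gc).
  by rewrite state_square exprn_ge0.
apply: CfunP => x; rewrite -[RHS]/(((Num.sqrt (f x))%:C%C)^* * (Num.sqrt (f x))%:C%C : Cx R).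
rewrite geC0_conj; last by rewrite -[0]/(0%:C%C : Cx R) real_leC sqrtr_ge0.
by rewrite -(rmorphM (real_complex R)) -expr2 sqr_sqrtr.
Qed.

Lemma state_measure : exists mu : {measure set (borel K) -> \bar R},
  forall F : Cfun R K, state F = Cfun_integral mu F.
Proof.
have [mu muE] := riesz_representation hK sK LD LZ L_ge0.
exists mu => F; pose fr := @Cfun_re_continuous _ _ F; pose fi := @Cfun_im_continuous _ _ F.
have cE (a b : R) : a%:C%C + ((0 +i* 1)%C : Cx R) * b%:C%C = (a +i* b)%C.
  by apply/eqP; rewrite eq_complex /=; apply/andP; split; apply/eqP; ring.
have FE : F = Cfun_real fr + ((0 +i* 1)%C : Cx R) *: Cfun_real fi.
  by apply: CfunP => x; rewrite CfunD CfunZ /= cE; case: (F x).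
rewrite {1}FE stateD stateZ !LE cE /Cfun_integral /Rintegral.
by rewrite (muE _ fr) (muE _ fi).
Qed.

Lemma state_probability : `|xi| = 1 -> exists mu : probability (borel K) R,
  forall F : Cfun R K, state F = Cfun_integral mu F.
Proof.
move=> xi1; have [mu muE] := state_measure.
have mu1 : mu setT = 1%E.
  have c1 : Cfun_integral mu (cst 1 : Cfun R K) = 1.
    rewrite -muE; case: rep_r => _ _ r1 _ _.
    by rewrite (r1 xi) -norm_inner xi1 expr1n.
  move: c1; rewrite /Cfun_integral /= => /(congr1 (@Cx_re R)) /=.
  rewrite Rintegral_cst// mul1r; case: (mu setT) => [a /= ->//| |] /= /esym/eqP;
    by rewrite oner_eq0.
have [P PE] := unit_mass_probability mu1.
by exists P => F; rewrite muE /Cfun_integral /Rintegral !PE.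
Qed.

Variable mu : probability (borel K) R.
Hypothesis muE : forall F : Cfun R K, state F = Cfun_integral mu F.

(** The map sending [F] to [r F xi] is isometric for the L2 norm of [mu], so distances between such
    vectors can be computed as integrals. *)
Lemma norm_state (F : Cfun R K) :
  `|r F xi| ^+ 2 = (\int[mu]_x (Cx_mod (F x)) ^+ 2)%:C%C.
Proof.
rewrite -state_square muE /Cfun_integral.
have E x : cmul (star F) F x = (Cx_mod (F x) ^+ 2)%:C%C.
  by rewrite -[LHS]/((F x)^* * F x) -normCKC Cx_normE rmorphXn.
have -> : (fun x => Cx_re (cmul (star F) F x)) = (fun x => Cx_mod (F x) ^+ 2).
  by apply/funext => x; rewrite E.
have -> : (fun x => Cx_im (cmul (star F) F x)) = (fun=> 0).
  by apply/funext => x; rewrite E.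
by rewrite [X in (_ +i* X)%C]Rintegral_cst// mul0r.
Qed.

(** By [norm_state] the limit [eta] of the vectors [v n] has square norm [mu [set x0]], and it is
    fixed because [(E - E x0) * h n] tends to 0 in mean square for every [E]. *)
Lemma state_null_set1 (x0 : K) :
  (forall eta, (forall F : Cfun R K, r F eta = F x0 *: eta) -> eta = 0) ->
  mu [set x0] = 0%E.
Proof.
move=> no_inv.
have cx0 : closed [set x0] by apply: accessible_closed_set1; exact: hausdorff_accessible.
have mx0 := closed_borel_measurable cx0.
have [g [gc g01 g0 gS g1]] := open_exhaustion R hK sK (closed_openC cx0).
have hc n : continuous (fun x => 1 - g n x).
  by move=> x; apply: cvgB; [exact: cvg_cst|exact: gc].
pose h n x := 1 - g n x; pose F n := Cfun_real (hc n).
have h01 n x : 0 <= h n x <= 1 by have := g01 n x; rewrite /h; lra.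
have modF n x : Cx_mod (F n x) = h n x.
  by apply: (@complexI R); rewrite -Cx_normE Cx_normr_real ger0_norm//; have /andP[] := h01 n x.
have h_cvg x : h n x @[n --> \oo] --> (\1_[set x0] x : R).
  have [->|xx0] := eqVneq x x0.
    rewrite indicE mem_set//; apply: cvg_near_cst; apply: nearW => n.
    by rewrite /h g0 ?subr0//; apply.
  rewrite indicE memNset//=; last by move/eqP: xx0.
  apply: cvg_near_cst; have := g1 x (elimN eqP xx0); apply: filterS => n gn.
  by rewrite /h gn subrr.
pose d n := (\int[mu]_x (h n x) ^+ 2)%R.
have mh n : measurable_fun [set: borel K] (h n).
  by apply: continuous_borel_measurable_real; exact: hc.
have h2_le n x : `|h n x ^+ 2| <= 1.
  by have /andP[? ?] := h01 n x; rewrite ger0_norm ?sqr_ge0// expr_le1.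
have ih n : mu.-integrable setT (EFin \o (fun x => h n x ^+ 2)).
  by apply: (bounded_integrable _ (M := 1)) => //; exact: measurable_funX.
have d_cvg : d n @[n --> \oo] --> fine (mu [set x0]).
  have -> : fine (mu [set x0]) = (\int[mu]_x (\1_[set x0] x))%R.
    by rewrite /Rintegral integral_indic// setIT.
  apply: (bounded_cvg_Rintegral (M := 1)) => //.
  - by move=> n; exact: measurable_funX.
  - move=> x; have -> : \1_[set x0] x = \1_[set x0] x ^+ 2 :> R.
      by rewrite indicE; case: (x \in _); rewrite ?expr1n ?expr0n.
    by rewrite expr2; under eq_fun do rewrite expr2; apply: cvgM; exact: h_cvg.
have h_dec n m x : (n <= m)%N -> h m x <= h n x.
  move=> /subnK <-; elim: (m - n)%N => // k; apply: le_trans.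
  by rewrite /h lerB//; exact: gS.
have d_dec : nonincreasing_seq d.
  move=> n m nm; apply: le_Rintegral => // x _.
  have /andP[? ?] := h01 n x; have /andP[? ?] := h01 m x.
  by rewrite ler_pXn2r ?nnegrE//; exact: h_dec.
have d_ge n : fine (mu [set x0]) <= d n.
  rewrite -(cvg_lim _ d_cvg)//; apply: nonincreasing_cvgn_ge => //.
  by apply/cvg_ex; exists (fine (mu [set x0])).
pose v n := r (F n) xi.
have mod_diff n m x : Cx_mod ((F n - F m) x) = `|h n x - h m x|.
  apply: (@complexI R); rewrite -Cx_normE -Cx_normr_real.
  by congr `|_|; rewrite rmorphB.
(* For [a >= b >= 0] one has [(a - b) ^+ 2 <= a ^+ 2 - b ^+ 2], so the convergent decreasing
   integrals [d n] control the distances. *)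
have v_dist n m : (n <= m)%N -> `|v n - v m| ^+ 2 <= (d n - d m)%:C%C.
  move=> nm; rewrite /v; case: rep_r => _ rl _ _ _.
  rewrite -(linfB (rl xi)) norm_state real_leC -RintegralB//.
  apply: le_Rintegral => //.
  - rewrite (_ : (fun x => _) = (fun x => (h n x - h m x) ^+ 2)); last first.
      by apply/funext => x; rewrite mod_diff real_normK// num_real.
    apply: (bounded_integrable _ (M := 1)) => [|x].
      by apply: measurable_funX; apply: measurable_funB.
    rewrite ger0_norm ?sqr_ge0// -real_normK ?num_real// expr_le1//.
    by rewrite ler_norml; have := h01 n x; have := h01 m x; lra.
  - exact: (integrableB measurableT (ih n) (ih m)).
  - move=> x _; rewrite mod_diff real_normK ?num_real//.
    have /andP[? ?] := h01 n x; have /andP[? ?] := h01 m x; have := h_dec n m x nm.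
    nra.
have v_cauchy : cauchy (v n @[n --> \oo]).
  apply/cauchyP => e e0; have er := ge0_Cx (ltW e0).
  have re0 : 0 < Cx_re e by rewrite -realC_gt0 -er.
  have e2 : 0 < Cx_re e ^+ 2 by rewrite exprn_gt0.
  have /cvgrPdist_lt/(_ _ e2)[n _ /(_ n (leqnn n)) dn] := d_cvg.
  exists (v n), n => // m /= nm; rewrite -ball_normE /=.
  rewrite -(@ltr_pXn2r _ 2)// ?nnegrE// ?ltW//.
  apply: (le_lt_trans (v_dist n m nm)).
  rewrite er -(rmorphXn (real_complex R)) real_ltC.
  have := d_ge m; move: dn; rewrite ltr_norml; lra.
have /cauchy_cvgP/cvg_ex[eta v_eta] := v_cauchy.
have sq_cvg (u : nat -> H) (l : H) (a : nat -> R) (b : R) : u n @[n --> \oo] --> l ->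
    a n @[n --> \oo] --> b -> (forall n, `|u n| ^+ 2 = (a n)%:C%C) -> `|l| ^+ 2 = b%:C%C.
  move=> ul ab ua; apply: (@cvg_unique _ (@norm_hausdorff _ (Cx R)) (`|u n| ^+ 2 @[n --> \oo])).
    exact: (cvgM (cvg_norm ul) (cvg_norm ul)).
  have -> : (fun n => `|u n| ^+ 2) = (fun n => (a n)%:C%C) by apply/funext.
  exact: (cvg_comp _ _ ab (@realC_continuous R b)).
have eta0 : eta = 0.
  apply: no_inv => E; pose G n := cmul (E - E x0 *: (cst 1 : Cfun R K)) (F n).
  have modG n x : Cx_mod (G n x) ^+ 2 = (Cx_mod (E x - E x0) * h n x) ^+ 2.
    rewrite -[G n x]/((E x - E x0 * 1) * F n x) mulr1.
    by rewrite Cx_modM modF.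
  have G_cvg : r (G n) xi @[n --> \oo] --> r E eta - E x0 *: eta.
    have -> : (fun n => r (G n) xi) = (fun n => r E (v n) - E x0 *: v n).
      apply/funext => n; case: rep_r => _ rl r1 rM _.
      by rewrite /G rM (linfB (rl _)) (linfZ (rl _)) (r1 (r (F n) xi)).
    apply: cvgB; last exact: cvgZl_tmp.
    by case: rep_r => rc _ _ _ _; apply: (cvg_comp _ _ v_eta); exact: (rc E).2.
  have cd : continuous (fun x => Cx_mod (E x - E x0)).
    move=> x; apply: continuous_comp; last exact: Cx_mod_continuous.
    by apply: cvgB; [exact: (@cts_fun _ _ E)|exact: cvg_cst].
  pose M := sup_mod (E - E x0 *: (cst 1 : Cfun R K)).
  have modM x : Cx_mod (E x - E x0) <= M.
    by have := le_sup_mod (E - E x0 *: (cst 1 : Cfun R K)) x; rewrite -[X in Cx_mod X]/(E x - E x0 * 1) mulr1.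
  have M0 : 0 <= M := le_trans (Cx_mod_ge0 _) (modM x0).
  have int0 : (\int[mu]_x Cx_mod (G n x) ^+ 2)%R @[n --> \oo] --> (\int[mu]_x (0 : R))%R.
    have mG n : measurable_fun [set: borel K] (fun x => (Cx_mod (E x - E x0) * h n x) ^+ 2).
      apply: measurable_funX; apply: measurable_funM => //.
      exact: (continuous_borel_measurable_real cd).
    apply: (bounded_cvg_Rintegral (M := M ^+ 2)) => [n| |x|n x].
    - rewrite (_ : (fun x => _) = (fun x => (Cx_mod (E x - E x0) * h n x) ^+ 2))//.
      exact/funext/modG.
    - exact: measurable_cst.
    - rewrite (_ : (fun n => _) = (fun n => (Cx_mod (E x - E x0) * h n x) ^+ 2)); last first.
        by apply/funext => n; exact: modG.
      have : (Cx_mod (E x - E x0) * h n x) @[n --> \oo] --> (0 : R).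
        have -> : (0 : R) = Cx_mod (E x - E x0) * \1_[set x0] x.
          rewrite indicE; have [->|/eqP xx0] := eqVneq x x0; first by rewrite subrr Cx_mod0 mul0r.
          by rewrite memNset// mulr0.
        by apply: cvgMr.
      by move=> c; have := cvgM c c; rewrite mulr0 => c2; exact: c2.
    - have /andP[hn0 hn1] := h01 n x.
      rewrite modG ger0_norm ?sqr_ge0// ler_pXn2r ?nnegrE ?mulr_ge0 ?Cx_mod_ge0//.
      by rewrite -[leRHS]mulr1 ler_pM ?Cx_mod_ge0.
  apply/eqP; rewrite -subr_eq0 -normr_eq0 -sqrf_eq0; apply/eqP.
  rewrite (sq_cvg _ _ _ _ G_cvg int0 (fun n => norm_state (G n))).
  by rewrite Rintegral_cst// mul0r.
have := sq_cvg _ _ _ _ v_eta d_cvg.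
rewrite eta0 normr0 expr0n /= => /(_ _)/(@complexI R) fmu0.
rewrite -[mu _]fineK ?fin_num_measure// -fmu0// => n.
rewrite norm_state; congr (_%:C%C); apply: eq_Rintegral => x _; by rewrite modF.
Qed.

End vector_states.

Lemma pushforward_probability d d' (T : measurableType d) (T' : measurableType d')
    (R : realType) (P : probability T R) (f : T -> T') : measurable_fun setT f ->
  exists Q : probability T' R, (forall A, Q A = pushforward P f A) /\
    forall h : T' -> \bar R, measurable_fun setT h -> (forall y, 0 <= h y)%E ->
      (\int[Q]_y h y = \int[P]_x h (f x))%E.
Proof.
move=> mf; pose mf_mixin := isMeasurableFun.Build _ _ _ _ _ mf.
pose X : {mfun T >-> T'} := HB.pack f mf_mixin.
exists (distribution P X); split=> // h mh h0.
exact: (@ge0_integral_distribution _ _ _ _ _ P X h).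
Qed.

Lemma cvg_near_Cx (R : realType) (u : nat -> Cx R) (l : Cx R) :
  (forall e : R, 0 < e -> \forall n \near \oo, `|u n - l| <= e%:C%C) ->
  u n @[n --> \oo] --> l.
Proof.
move=> ul; apply/cvgrPdist_le => e e0; rewrite (ge0_Cx (ltW e0)).
have := ul (Cx_re e); rewrite -realC_gt0 -(ge0_Cx (ltW e0)) => /(_ e0).
by apply: filterS => n; rewrite distrC.
Qed.

Lemma Cfun_integral_dirac (R : realType) (K : ptopologicalType) (a : borel K) (F : Cfun R K) :
  Cfun_integral (\d_a) F = F a.
Proof.
rewrite /Cfun_integral /Rintegral !integral_dirac//.
- by rewrite diracE mem_set// !mul1e /=; case: (F a).
- by apply/measurable_EFinP; exact: (continuous_borel_measurable_real (@Cfun_im_continuous _ _ F)).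
- by apply/measurable_EFinP; exact: (continuous_borel_measurable_real (@Cfun_re_continuous _ _ F)).
Qed.

(** * From almost invariant vectors to almost invariant measures *)

Section forward.
Variables (R : realType) (Gam : discreteGroupType) (G : compactGroupType).
Variables (mp : matched_pair R Gam G) (GG : bicrossed_product mp).

Let hG : hausdorff_space G := hausdorff_subproof.
Let sG : @second_countable G := second_countable_subproof.

Variables (H : hilbertType (Cx R)) (q : bp_alg GG -> H -> H).
Hypothesis rep_q : representation q.

Lemma restricted_representation : representation (fun F => q (bp_iota GG F)).
Proof.
have [iL i1 iM iS] := bp_iota_hom GG; have [qc ql q1 qM qs] := rep_q.
split=> [F|x a F E|x|F E x|F x y]; first exact: qc.
- by rewrite iL ql.
- by rewrite i1 q1.
- by rewrite iM qM.
- by rewrite iS qs.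
Qed.

Let r F := q (bp_iota GG F).
Let u g := q (bp_u GG g).

Lemma counit_iota F : bp_counit (bp_iota GG F) = F 1%g.
Proof. by rewrite -(bp_counitE GG 1%g) bp_u1 cmul1x. Qed.

Lemma counit_u g : bp_counit (bp_u GG g) = 1.
Proof.
rewrite -[bp_u GG g]cmulx1; have [_ <- _ _] := bp_iota_hom GG.
by rewrite bp_counitE.
Qed.

Lemma star_bp_u g : star (bp_u GG g) = bp_u GG g^-1%g.
Proof.
have [_ uu] := bp_u_unitary GG g^-1%g.
rewrite -[LHS]cmul1x -(bp_u1 GG) -(mulVg g) bp_uM -cmulA.
by have [_ ->] := bp_u_unitary GG g; rewrite cmulx1.
Qed.

Lemma u_isometry g x : `|u g x| = `|x|.
Proof.
have [_ _ q1 qM qs] := rep_q.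
apply/eqP; rewrite -(@eqrXn2 _ 2)// !norm_inner /u -qs.
by rewrite -qM; have [-> _] := bp_u_unitary GG g; rewrite q1.
Qed.

(** Covariance at [g^-1] moves the translation from the function to the vector: the image under
    [mp_alpha mp g] of the measure of [x] is the measure of [u g x]. *)
Lemma state_translate g F x :
  inner (r (Cfun_comp F (mp_alpha mp g)) x) x = inner (r F (u g x)) (u g x).
Proof.
have [_ _ q1 qM qs] := rep_q.
have := bp_covariant GG g^-1%g F; rewrite invgK star_bp_u invgK /r => <-.
by rewrite !qM -[bp_u GG g^-1%g]star_bp_u qs.
Qed.

(** The vector changes in both slots of the inner product, and either change costs at most [2 * |F|]
    times the displacement of [x]. *)
Lemma state_translate_dist g F x : `|x| = 1 ->
  `|inner (r (Cfun_comp F (mp_alpha mp g)) x) x - inner (r F x) x| <=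
  4 * `|F| * `|u g x - x|.
Proof.
move=> x1; have rr := restricted_representation; have [rc rl _ _ _] := rr.
have -> : inner (r (Cfun_comp F (mp_alpha mp g)) x) x - inner (r F x) x =
    inner (r F (u g x - x)) (u g x) + inner (r F x) (u g x - x).
  rewrite state_translate /r (linfB (rc F).1) innerDl innerNl innerDr innerNr.
  by rewrite addrA subrK.
rewrite (le_trans (ler_normD _ _))//.
have rb := representation_bound rr F.
have cs1 := cauchy_schwarz (r F (u g x - x)) (u g x).
have cs2 := cauchy_schwarz (r F x) (u g x - x).
have b1 := rb (u g x - x); have b2 := rb x.
rewrite u_isometry x1 mulr1 in cs1; rewrite x1 mulr1 in b2.
rewrite (le_trans (lerD (le_trans cs1 b1) (le_trans cs2 (ler_wpM2r _ b2))))//.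
by rewrite -mulrDl -mulrDl -natrD.
Qed.

Lemma weakly_contained_measures :
  weakly_contained (@bp_counit _ _ _ _ GG) q ->
  ~ contained (fun F : Cfun R G => F 1%g) (fun F => q (bp_iota GG F)) ->
  exists mu : nat -> probability (borel G) R,
    [/\ forall n, mu n [set 1%g : G] = 0%E,
        weak_star_cvg mu (\d_(1%g : borel G)) &
        forall g : Gam,
          variation_norm
            (fun A : set (borel G) =>
               pushforward (mu n) (mp_alpha mp g : borel G -> borel G) A
               - mu n A)%E
          @[n --> \oo] --> (0 : \bar R)%E].
Proof.
move=> [xi [xi1 wc]] ninv; have rr := restricted_representation.
have /choice[mu muE] n := state_probability hG sG rr (xi1 n).
exists mu; split=> [n|F|g].
- apply: (state_null_set1 hG sG rr (muE n)) => eta etaE.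
  apply: contrapT => eta0; apply: ninv; exists eta; split=> //; exact/eqP.
- rewrite Cfun_integral_dirac.
  have := wc (bp_iota GG F); rewrite counit_iota => F0.
  apply: cvg_near_Cx => e e0; have /norm_cvg0_near/(_ e e0) := F0.
  apply: filterS => n; apply: le_trans; rewrite -muE.
  have -> : inner (r F (xi n)) (xi n) - F 1%g =
      inner (r F (xi n) - F 1%g *: xi n) (xi n).
    by rewrite innerDl innerNl innerZl -norm_inner xi1 expr1n mulr1.
  by rewrite (le_trans (cauchy_schwarz _ _))// xi1 mulr1.
have := wc (bp_u GG g); rewrite counit_u => u0.
pose delta n := Cx_re `|u g (xi n) - xi n|.
have dE n : `|u g (xi n) - xi n| = (delta n)%:C%C by exact: ge0_Cx.
have delta_ge0 n : 0 <= delta n by rewrite -real_leC -dE; exact: normr_ge0.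
have delta0 : delta n @[n --> \oo] --> (0 : R).
  apply/cvgrPdist_le => e e0; have /norm_cvg0_near/(_ e e0) := u0.
  apply: filterS => n; rewrite scale1r [X in X <= _]dE real_leC.
  by rewrite sub0r normrN ger0_norm.
(* The factor 2 comes from [variation_norm_le], the factor 4 from [state_translate_dist] for test
   functions of norm at most 1. *)
apply: (@squeeze_cvge _ _ _ _ (fun=> 0%E) _ (fun n => (2 * (4 * delta n))%:E)).
- apply: nearW => n.
  have ma : measurable_fun setT (mp_alpha mp g : borel G -> borel G).
    by apply: continuous_borel_measurable; exact: (@cts_fun _ _ (mp_alpha mp g)).
  have [Q [QE intQ]] := pushforward_probability (mu n) ma.
  have -> : (fun A : set (borel G) => pushforward (mu n) (mp_alpha mp g : borel G -> borel G) A - mu n A)%E = (fun A => Q A - mu n A)%E.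
    by apply/funext => A; rewrite QE.
  apply/andP; split.
    apply: le_trans (le_variation_norm Q (mu n) measurableT).
    by rewrite lee_fin addr_ge0.
  apply: variation_norm_le; apply: (measure_dist_le hG sG) => f fc f01.
  pose F := Cfun_real fc.
  have fE : (\int[mu n]_x f x)%R = Cx_re (inner (r F (xi n)) (xi n)).
    by rewrite muE.
  have faE : (\int[Q]_x f x)%R = Cx_re (inner (r (Cfun_comp F (mp_alpha mp g)) (xi n)) (xi n)).
    rewrite muE /= /Rintegral intQ//.
    + by apply/measurable_EFinP; exact: continuous_borel_measurable_real.
    + by move=> y; rewrite lee_fin; have /andP[] := f01 y.
  rewrite fE faE -Cx_reB (le_trans (Cx_re_le _))// -Cx_mod_le.
  rewrite (le_trans (state_translate_dist _ _ (xi1 n)))//.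
  have F1 : `|F| <= 1.
    rewrite Cfun_normE -[1]/(1%:C%C : Cx R) real_leC; apply: sup_mod_le => x.
    rewrite -real_leC -Cx_normE Cx_normr_real ger0_norm; last by have /andP[] := f01 x.
    by rewrite real_leC; have /andP[] := f01 x.
  rewrite dE rmorphM /= ler_wpM2r//; first by rewrite -dE.
  rewrite (_ : 4%:C%C = 4 :> Cx R); last exact: (rmorph_nat (real_complex R) 4).
  by rewrite ler_piMr ?ler0n.
- exact: cvg_cst.
- rewrite -[X in _ --> X](_ : (2 * (4 * 0))%:E = _); last by rewrite !mulr0.
  apply: cvg_EFin; first exact: nearW.
  by apply: cvgMr; apply: cvgMr.
Qed.

End forward.

(** * The Hilbert space L2 *)

Section Cx_coordinates.
Variable R : realType.
Implicit Types z w : Cx R.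

Lemma Cx_reD z w : Cx_re (z + w) = Cx_re z + Cx_re w.
Proof. by case: z w => [? ?] [? ?]. Qed.

Lemma Cx_imD z w : Cx_im (z + w) = Cx_im z + Cx_im w.
Proof. by case: z w => [? ?] [? ?]. Qed.

Lemma Cx_reM z w : Cx_re (z * w) = Cx_re z * Cx_re w - Cx_im z * Cx_im w.
Proof. by case: z w => [? ?] [? ?]. Qed.

Lemma Cx_imM z w : Cx_im (z * w) = Cx_re z * Cx_im w + Cx_im z * Cx_re w.
Proof. by case: z w => [? ?] [? ?]. Qed.

Lemma Cx_re_conj z : Cx_re z^* = Cx_re z.
Proof. by case: z. Qed.

Lemma Cx_im_conj z : Cx_im z^* = - Cx_im z.
Proof. by case: z. Qed.

Lemma Cx_mod_sqr z : Cx_mod z ^+ 2 = Cx_re z ^+ 2 + Cx_im z ^+ 2.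
Proof. by rewrite sqr_sqrtr// addr_ge0// sqr_ge0. Qed.

Lemma Cx_modD z w : Cx_mod (z + w) <= Cx_mod z + Cx_mod w.
Proof.
by rewrite -real_leC rmorphD /= -!Cx_normE; exact: ler_normD.
Qed.

Lemma Cx_mod_real (a : R) : Cx_mod (a%:C%C : Cx R) = `|a|.
Proof. by apply: (@complexI R); rewrite -Cx_normE Cx_normr_real. Qed.

Lemma Cx_mod_conj z : Cx_mod z^* = Cx_mod z.
Proof. by rewrite /Cx_mod Cx_re_conj Cx_im_conj sqrrN. Qed.

(** Young's inequality with a free parameter: [s = 1] gives the square integrability of sums, the
    optimal [s] the triangle inequality in [L2]. *)
Lemma Cx_modD_sqr (s : R) z w : 0 < s ->
  Cx_mod (z + w) ^+ 2 <= (1 + s) * Cx_mod z ^+ 2 + (1 + s^-1) * Cx_mod w ^+ 2.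
Proof.
move=> s0; apply: (@le_trans _ _ ((Cx_mod z + Cx_mod w) ^+ 2)).
  by rewrite ler_pXn2r ?nnegrE ?addr_ge0 ?Cx_mod_ge0// Cx_modD.
rewrite -subr_ge0; set u := Cx_mod z; set v := Cx_mod w.
have -> : (1 + s) * u ^+ 2 + (1 + s^-1) * v ^+ 2 - (u + v) ^+ 2 = s^-1 * (s * u - v) ^+ 2.
  by field; rewrite gt_eqF.
by rewrite mulr_ge0 ?invr_ge0 ?sqr_ge0 ?(ltW s0).
Qed.

End Cx_coordinates.

Section Cx_integral.
Context d (T : measurableType d) (R : realType) (mu : {finite_measure set T -> \bar R}).
Implicit Types f g h : T -> Cx R.

Definition Cx_measurable f :=
  measurable_fun setT (fun x => Cx_re (f x)) /\ measurable_fun setT (fun x => Cx_im (f x)).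

Lemma Cx_measurable_cst c : Cx_measurable (cst c).
Proof. by split; exact: measurable_cst. Qed.

Lemma Cx_measurableD f g : Cx_measurable f -> Cx_measurable g ->
  Cx_measurable (fun x => f x + g x).
Proof.
move=> [fr fi] [gr gi]; split.
  by under eq_fun do rewrite Cx_reD; exact: measurable_funD.
by under eq_fun do rewrite Cx_imD; exact: measurable_funD.
Qed.

Lemma Cx_measurableM f g : Cx_measurable f -> Cx_measurable g ->
  Cx_measurable (fun x => f x * g x).
Proof.
move=> [fr fi] [gr gi]; split.
  under eq_fun do rewrite Cx_reM.
  by apply: measurable_funB; exact: measurable_funM.
under eq_fun do rewrite Cx_imM.
by apply: measurable_funD; exact: measurable_funM.
Qed.

Lemma Cx_measurable_conj f : Cx_measurable f -> Cx_measurable (fun x => (f x)^*).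
Proof.
move=> [fr fi]; split.
  by under eq_fun do rewrite Cx_re_conj.
by under eq_fun do rewrite Cx_im_conj; exact: measurableT_comp.
Qed.

Lemma Cx_measurable_mod_sqr f : Cx_measurable f ->
  measurable_fun setT (fun x => Cx_mod (f x) ^+ 2).
Proof.
move=> [fr fi]; under eq_fun do rewrite Cx_mod_sqr.
by apply: measurable_funD; exact: measurable_funX.
Qed.

Lemma Cx_measurable_mod f : Cx_measurable f -> measurable_fun setT (fun x => Cx_mod (f x)).
Proof.
move=> mf; rewrite (_ : (fun x => _) = Num.sqrt \o (fun x => Cx_mod (f x) ^+ 2)).
  apply: measurableT_comp; last exact: Cx_measurable_mod_sqr.
  by apply: continuous_measurable_fun; exact: sqrt_continuous.
by apply/funext => x /=; rewrite sqrtr_sqr ger0_norm// Cx_mod_ge0.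
Qed.

Definition square_integrable f := Cx_measurable f /\
  mu.-integrable setT (EFin \o (fun x => Cx_mod (f x) ^+ 2)).

Definition sq_norm f : R := (\int[mu]_x Cx_mod (f x) ^+ 2)%R.

Lemma sq_norm_ge0 f : 0 <= sq_norm f.
Proof. by apply: Rintegral_ge0 => x _; exact: sqr_ge0. Qed.

Lemma le_square_integrable (c : R) f g h : Cx_measurable h ->
  square_integrable f -> square_integrable g ->
  (forall x, Cx_mod (h x) ^+ 2 <= c * (Cx_mod (f x) ^+ 2 + Cx_mod (g x) ^+ 2)) ->
  square_integrable h.
Proof.
move=> mh [mf sf] [mg sg] hc; split=> //.
have sfg := integrableZl measurableT c (integrableD measurableT sf sg).
apply: (le_integrable measurableT _ _ sfg).
  by apply/measurable_EFinP; exact: Cx_measurable_mod_sqr.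
move=> x _; rewrite [leLHS]/= [leRHS]/= lee_fin ger0_norm ?sqr_ge0//.
exact: le_trans (hc x) (ler_norm _).
Qed.

Lemma square_integrable0 : square_integrable (cst 0).
Proof.
split; first exact: Cx_measurable_cst.
rewrite (_ : _ \o _ = cst 0%E) ?integrable0//.
by apply/funext => x /=; rewrite Cx_mod0 expr0n.
Qed.

Lemma square_integrableD f g : square_integrable f -> square_integrable g ->
  square_integrable (fun x => f x + g x).
Proof.
move=> sf sg; apply: (le_square_integrable (c := 2) _ sf sg) => [|x].
  by apply: Cx_measurableD; [exact: sf.1|exact: sg.1].
have := Cx_modD_sqr (f x) (g x) ltr01; rewrite invr1; lra.
Qed.

Lemma square_integrableM (c : R) f g : Cx_measurable f -> (forall x, Cx_mod (f x) <= c) ->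
  square_integrable g -> square_integrable (fun x => f x * g x).
Proof.
move=> mf fc sg; apply: (le_square_integrable (c := c ^+ 2) _ square_integrable0 sg) => [|x].
  by apply: Cx_measurableM => //; exact: sg.1.
rewrite /= Cx_mod0 expr0n add0r Cx_modM exprMn ler_wpM2r ?sqr_ge0//.
by rewrite ler_pXn2r ?nnegrE ?Cx_mod_ge0//; exact: le_trans (Cx_mod_ge0 _) (fc x).
Qed.

Lemma square_integrableZ (c : Cx R) g :
  square_integrable g -> square_integrable (fun x => c * g x).
Proof. by move=> sg; apply: (@square_integrableM (Cx_mod c) (cst c)). Qed.

Lemma square_integrableN g : square_integrable g -> square_integrable (fun x => - g x).
Proof.
by move=> /(square_integrableZ (-1)); under eq_fun do rewrite mulN1r.
Qed.

Lemma square_integrable_re f g : square_integrable f -> square_integrable g ->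
  mu.-integrable setT (EFin \o (fun x => Cx_re (f x * (g x)^*))).
Proof.
move=> [mf sf] [mg sg]; apply: (le_integrable measurableT _ _ (integrableD measurableT sf sg)).
  apply/measurable_EFinP.
  exact: (Cx_measurableM mf (Cx_measurable_conj mg)).1.
move=> x _; rewrite [leLHS]/= [leRHS]/= lee_fin (le_trans (Cx_re_le _))// Cx_modM Cx_mod_conj.
rewrite ger0_norm ?addr_ge0 ?sqr_ge0//.
have := sqr_ge0 (Cx_mod (f x) - Cx_mod (g x)); have := sqr_ge0 (Cx_mod (f x) + Cx_mod (g x)); nra.
Qed.

Lemma square_integrable_im f g : square_integrable f -> square_integrable g ->
  mu.-integrable setT (EFin \o (fun x => Cx_im (f x * (g x)^*))).
Proof.
move=> [mf sf] [mg sg]; apply: (le_integrable measurableT _ _ (integrableD measurableT sf sg)).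
  apply/measurable_EFinP.
  exact: (Cx_measurableM mf (Cx_measurable_conj mg)).2.
move=> x _; rewrite [leLHS]/= [leRHS]/= lee_fin (le_trans (Cx_im_le _))// Cx_modM Cx_mod_conj.
rewrite ger0_norm ?addr_ge0 ?sqr_ge0//.
have := sqr_ge0 (Cx_mod (f x) - Cx_mod (g x)); have := sqr_ge0 (Cx_mod (f x) + Cx_mod (g x)); nra.
Qed.

Definition sq_inner f g : Cx R :=
  ((\int[mu]_x Cx_re (f x * (g x)^*))%R +i* (\int[mu]_x Cx_im (f x * (g x)^*))%R)%C.

Lemma sq_inner_conj f g : square_integrable f -> square_integrable g ->
  sq_inner f g = (sq_inner g f)^*.
Proof.
move=> sf sg; rewrite /sq_inner; congr (_ +i* _)%C.
  apply: eq_Rintegral => x _; by rewrite !Cx_reM !Cx_re_conj !Cx_im_conj; ring.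
rewrite /= -[RHS]mulN1r -RintegralZl//; last exact: square_integrable_im.
by apply: eq_Rintegral => x _; rewrite !Cx_imM !Cx_re_conj !Cx_im_conj; ring.
Qed.

Lemma sq_inner_linear c f g h : square_integrable f -> square_integrable g ->
  square_integrable h ->
  sq_inner (fun x => c * f x + g x) h = c * sq_inner f h + sq_inner g h.
Proof.
move=> sf sg sh.
have ifr := square_integrable_re sf sh; have ifi := square_integrable_im sf sh.
have igr := square_integrable_re sg sh; have igi := square_integrable_im sg sh.
have Z (a : R) (u : T -> R) : mu.-integrable setT (EFin \o u) ->
    mu.-integrable setT (EFin \o (fun x => a * u x)).
  by move=> iu; exact: (integrableZl measurableT a iu).
have D (u v : T -> R) : mu.-integrable setT (EFin \o u) -> mu.-integrable setT (EFin \o v) ->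
    mu.-integrable setT (EFin \o (fun x => u x + v x)).
  by move=> iu iv; exact: (integrableD measurableT iu iv).
apply/eqP; rewrite eq_complex; apply/andP; split; apply/eqP.
  rewrite -[RHS]/(Cx_re (c * sq_inner f h + sq_inner g h)) Cx_reD Cx_reM /=.
  rewrite -[X in _ - X]RintegralZl// -RintegralZl// -RintegralB//; try exact: Z.
  rewrite -RintegralD//; last exact: (integrableB measurableT (Z _ _ ifr) (Z _ _ ifi)).
  by apply: eq_Rintegral => x _; rewrite !Cx_reM !Cx_reD !Cx_imM !Cx_reM !Cx_imD !Cx_imM; ring.
rewrite -[RHS]/(Cx_im (c * sq_inner f h + sq_inner g h)) Cx_imD Cx_imM /=.
rewrite -[X in X + _ + _]RintegralZl// -[X in _ + X + _]RintegralZl// -RintegralD//; try exact: Z.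
rewrite -RintegralD//; last by apply: D; exact: Z.
by apply: eq_Rintegral => x _; rewrite !(Cx_reM, Cx_imM, Cx_reD, Cx_imD); ring.
Qed.

Lemma sq_inner_norm f : square_integrable f -> sq_inner f f = (sq_norm f)%:C%C.
Proof.
move=> sf; congr (_ +i* _)%C.
  by apply: eq_Rintegral => x _; rewrite Cx_reM Cx_re_conj Cx_im_conj Cx_mod_sqr; ring.
rewrite (_ : (fun x => _) = (fun=> 0)) ?Rintegral_cst ?mul0r//.
by apply/funext => x; rewrite Cx_imM Cx_re_conj Cx_im_conj; ring.
Qed.

End Cx_integral.

Section almost_everywhere.
Context d (T : measurableType d) (R : realType) (mu : {finite_measure set T -> \bar R}).
Implicit Types f g h : T -> Cx R.

Definition ae_equal f g := {ae mu, forall x, f x = g x}.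

Lemma ae_equal_refl f : ae_equal f f. Proof. exact: aeW. Qed.

Lemma ae_equal_sym f g : ae_equal f g -> ae_equal g f.
Proof. by apply: filterS => x. Qed.

Lemma ae_equal_trans f g h : ae_equal f g -> ae_equal g h -> ae_equal f h.
Proof. by apply: filterS2 => x -> ->. Qed.

Lemma ae_Rintegral (u v : T -> R) :
  measurable_fun setT u -> measurable_fun setT v ->
  {ae mu, forall x, u x = v x} -> (\int[mu]_x u x = \int[mu]_x v x)%R.
Proof.
move=> mU mV uv; rewrite /Rintegral; congr fine; apply: ae_eq_integral => //.
- exact/measurable_EFinP.
- exact/measurable_EFinP.
- by apply: filterS uv => x -> _.
Qed.

Lemma ae_sq_norm f g : Cx_measurable f -> Cx_measurable g -> ae_equal f g ->
  sq_norm mu f = sq_norm mu g.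
Proof.
move=> mf mg fg; apply: ae_Rintegral; try exact: Cx_measurable_mod_sqr.
by apply: filterS fg => x ->.
Qed.

Lemma ae_sq_inner f f' g g' : Cx_measurable f -> Cx_measurable f' ->
  Cx_measurable g -> Cx_measurable g' -> ae_equal f f' -> ae_equal g g' ->
  sq_inner mu f g = sq_inner mu f' g'.
Proof.
move=> mf mf' mg mg' ff' gg'; congr (_ +i* _)%C; apply: ae_Rintegral.
- exact: (Cx_measurableM mf (Cx_measurable_conj mg)).1.
- exact: (Cx_measurableM mf' (Cx_measurable_conj mg')).1.
- by apply: filterS2 ff' gg' => x -> ->.
- exact: (Cx_measurableM mf (Cx_measurable_conj mg)).2.
- exact: (Cx_measurableM mf' (Cx_measurable_conj mg')).2.
- by apply: filterS2 ff' gg' => x -> ->.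
Qed.

Lemma sq_norm_eq0 f : square_integrable mu f -> sq_norm mu f = 0 -> ae_equal f (cst 0).
Proof.
move=> [mf sf] f0.
have : (\int[mu]_x `|(Cx_mod (f x) ^+ 2)%:E| = 0)%E.
  rewrite (eq_integral (EFin \o (fun x => Cx_mod (f x) ^+ 2))); last first.
    by move=> x _; rewrite gee0_abs// lee_fin sqr_ge0.
  by rewrite -[LHS]fineK ?(integrable_fin_num measurableT sf)// -[fine _]/(sq_norm mu f) f0.
move=> /ae_eq_integral_abs-/(_ measurableT) h.
have /h : measurable_fun setT (fun x => (Cx_mod (f x) ^+ 2)%:E).
  by apply/measurable_EFinP; exact: Cx_measurable_mod_sqr.
apply: filterS => x /(_ I) [] /eqP; rewrite sqrf_eq0 => /eqP.
exact: Cx_mod_eq0.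
Qed.

(* [L2] functions are represented by a chosen element of each almost-everywhere
   class. *)
Definition ae_repr f : T -> Cx R :=
  xget (cst 0) [set g | square_integrable mu g /\ ae_equal g f].

Lemma ae_repr_eq f g : ae_equal f g -> ae_repr f = ae_repr g.
Proof.
move=> fg; congr (xget _ _); apply/seteqP; split=> h [sh hf]; split=> //.
  exact: ae_equal_trans hf fg.
exact: ae_equal_trans hf (ae_equal_sym fg).
Qed.

Lemma ae_reprP f : square_integrable mu f ->
  square_integrable mu (ae_repr f) /\ ae_equal (ae_repr f) f.
Proof.
move=> sf; apply: (xgetPex _ (P := [set g | square_integrable mu g /\ ae_equal g f])).
by exists f; split=> //; exact: ae_equal_refl.
Qed.

(** Requiring the canonical representative turns almost everywhere equality into equality, so that
    no quotient has to be formed. *)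
Record L2 := MkL2 {
  L2fun :> T -> Cx R;
  L2_square_integrable : square_integrable mu L2fun;
  L2_canonical : ae_repr L2fun = L2fun }.

Lemma L2_ext (a b : L2) : ae_equal a b -> a = b.
Proof.
case: a b => [f sf cf] [g sg cg] /= /ae_repr_eq; rewrite cf cg => fg.
by case: _ / fg in sg cg *; congr MkL2; exact: Prop_irrelevance.
Qed.

Definition L2_class_of f (sf : square_integrable mu f) : L2 :=
  MkL2 (ae_reprP sf).1 (ae_repr_eq (ae_reprP sf).2).

Lemma L2_zero_subproof : square_integrable mu (cst 0). Proof. exact: square_integrable0. Qed.

(* the class of [f], with junk value the class of [0] *)
Definition toL2 f : L2 :=
  if pselect (square_integrable mu f) is left sf then L2_class_of sf
  else L2_class_of L2_zero_subproof.

Lemma toL2E f : square_integrable mu f -> ae_equal (toL2 f) f.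
Proof. by move=> sf; rewrite /toL2; case: pselect => // sf'; exact: (ae_reprP sf').2. Qed.

End almost_everywhere.

Section L2_module.
Context d (T : measurableType d) (R : realType) (mu : {finite_measure set T -> \bar R}).
Local Notation L := (L2 mu).
Implicit Types a b c : L.

HB.instance Definition _ := gen_eqMixin L.
HB.instance Definition _ := gen_choiceMixin L.

Definition L2_zero : L := toL2 mu (cst 0).
Definition L2_add a b : L := toL2 mu (fun x => a x + b x).
Definition L2_opp a : L := toL2 mu (fun x => - a x).
Definition L2_scale (z : Cx R) a : L := toL2 mu (fun x => z * a x).

Lemma L2_zeroE : ae_equal mu L2_zero (cst 0).
Proof. exact: toL2E (square_integrable0 mu). Qed.

Lemma L2_addE a b : ae_equal mu (L2_add a b) (fun x => a x + b x).
Proof. apply: toL2E; apply: square_integrableD; exact: L2_square_integrable. Qed.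

Lemma L2_oppE a : ae_equal mu (L2_opp a) (fun x => - a x).
Proof. apply: toL2E; apply: square_integrableN; exact: L2_square_integrable. Qed.

Lemma L2_scaleE z a : ae_equal mu (L2_scale z a) (fun x => z * a x).
Proof. apply: toL2E; apply: square_integrableZ; exact: L2_square_integrable. Qed.

Let addA : associative L2_add.
Proof.
move=> a b c; apply: L2_ext.
have h1 := L2_addE a (L2_add b c); have h2 := L2_addE (L2_add a b) c.
have h3 := L2_addE b c; have h4 := L2_addE a b.
apply: filterS2 (filterI h1 h2) (filterI h3 h4) => x [-> ->] [-> ->].
exact: addrA.
Qed.

Let addC : commutative L2_add.
Proof.
move=> a b; apply: L2_ext.
apply: filterS2 (L2_addE a b) (L2_addE b a) => x -> ->; exact: addrC.
Qed.

Let add0 : left_id L2_zero L2_add.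
Proof.
move=> a; apply: L2_ext.
by apply: filterS2 (L2_addE L2_zero a) L2_zeroE => x -> ->; exact: add0r.
Qed.

Let addN : left_inverse L2_zero L2_opp L2_add.
Proof.
move=> a; apply: L2_ext.
have h1 := L2_addE (L2_opp a) a; have h2 := L2_oppE a; have h3 := L2_zeroE.
by apply: filterS3 h1 h2 h3 => x -> -> ->; exact: addNr.
Qed.

HB.instance Definition _ := GRing.isZmodule.Build L addA addC add0 addN.

Let scaleA z w a : L2_scale z (L2_scale w a) = L2_scale (z * w) a.
Proof.
apply: L2_ext.
have h1 := L2_scaleE z (L2_scale w a); have h2 := L2_scaleE w a.
by apply: filterS3 h1 h2 (L2_scaleE (z * w) a) => x -> -> ->; exact: mulrA.
Qed.

Let scale1 : left_id 1 L2_scale.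
Proof.
by move=> a; apply: L2_ext; apply: filterS (L2_scaleE 1 a) => x ->; exact: mul1r.
Qed.

Let scaleDr : right_distributive L2_scale +%R.
Proof.
move=> z a b; apply: L2_ext.
have h1 := L2_scaleE z (L2_add a b); have h2 := L2_addE a b.
have h3 := L2_addE (L2_scale z a) (L2_scale z b).
have h4 := L2_scaleE z a; have h5 := L2_scaleE z b.
by apply: filterS3 (filterI h1 h2) h3 (filterI h4 h5) => x [-> ->] -> [-> ->]; exact: mulrDr.
Qed.

Let scaleDl a : {morph L2_scale^~ a : z w / z + w}.
Proof.
move=> z w; apply: L2_ext.
have h1 := L2_scaleE (z + w) a.
have h3 := L2_addE (L2_scale z a) (L2_scale w a).
have h4 := L2_scaleE z a; have h5 := L2_scaleE w a.
by apply: filterS3 h1 h3 (filterI h4 h5) => x -> -> [-> ->]; exact: mulrDl.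
Qed.

HB.instance Definition _ :=
  GRing.Zmodule_isLmodule.Build (Cx R) L scaleA scale1 scaleDr scaleDl.

Lemma L2D a b : ae_equal mu (a + b : L) (fun x => a x + b x).
Proof. exact: L2_addE. Qed.

Lemma L2N a : ae_equal mu (- a : L) (fun x => - a x).
Proof. exact: L2_oppE. Qed.

Lemma L2B a b : ae_equal mu (a - b : L) (fun x => a x - b x).
Proof.
have h1 := L2D a (- b); have h2 := L2N b.
by apply: filterS2 h1 h2 => x -> ->.
Qed.

Lemma L2Z z a : ae_equal mu (z *: a : L) (fun x => z * a x).
Proof. exact: L2_scaleE. Qed.

Lemma L20 : ae_equal mu (0 : L) (cst 0).
Proof. exact: L2_zeroE. Qed.

Let sqL a : square_integrable mu a := L2_square_integrable a.
Let mL a : Cx_measurable a := (sqL a).1.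

Definition L2_norm a : Cx R := (Num.sqrt (sq_norm mu a))%:C%C.

Let norm0 a : L2_norm a = 0 -> a = 0.
Proof.
move=> /(@complexI R)/eqP; rewrite sqrtr_eq0 => a0.
have {}a0 : sq_norm mu a = 0 by apply/eqP; rewrite eq_le a0 sq_norm_ge0.
apply: L2_ext; apply: ae_equal_trans (ae_equal_sym L20).
exact: sq_norm_eq0.
Qed.

Let normZ z a : L2_norm (z *: a) = `|z| * L2_norm a.
Proof.
rewrite /L2_norm Cx_normE -(rmorphM (real_complex R)); congr (_%:C%C).
rewrite (ae_sq_norm (mL (z *: a)) (Cx_measurableM (Cx_measurable_cst _ z) (mL a)) (L2Z z a)).
have -> : sq_norm mu (fun x => z * a x) = Cx_mod z ^+ 2 * sq_norm mu a.
  rewrite /sq_norm -RintegralZl//; last exact: (sqL a).2.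
  by apply: eq_Rintegral => x _; rewrite Cx_modM exprMn.
by rewrite sqrtrM ?sqr_ge0// sqrtr_sqr ger0_norm// Cx_mod_ge0.
Qed.

(* Integrate [|z + w|^2 <= (1 + s) |z|^2 + (1 + 1/s) |w|^2] and take [s] to be
   the quotient of the norms. *)
Let normD a b : L2_norm (a + b) <= L2_norm a + L2_norm b.
Proof.
rewrite /L2_norm -(rmorphD (real_complex R)) real_leC.
have [a0|a0] := eqVneq (sq_norm mu a) 0.
  have -> : a = 0 by apply: norm0; rewrite /L2_norm a0 sqrtr0.
  by rewrite add0r lerDr sqrtr_ge0.
have [b0|b0] := eqVneq (sq_norm mu b) 0.
  have -> : b = 0 by apply: norm0; rewrite /L2_norm b0 sqrtr0.
  by rewrite addr0 lerDl sqrtr_ge0.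
set u := Num.sqrt (sq_norm mu a); set v := Num.sqrt (sq_norm mu b).
have u0 : 0 < u by rewrite sqrtr_gt0 lt_neqAle eq_sym a0 sq_norm_ge0.
have v0 : 0 < v by rewrite sqrtr_gt0 lt_neqAle eq_sym b0 sq_norm_ge0.
rewrite -[leRHS]ger0_norm ?addr_ge0 ?(ltW u0) ?(ltW v0)// -sqrtr_sqr ler_wsqrtr//.
rewrite (ae_sq_norm (mL _) (Cx_measurableD (mL a) (mL b)) (L2D a b)).
pose s := v / u; have s0 : 0 < s by rewrite divr_gt0.
have iZ (k : R) c : mu.-integrable setT (EFin \o (fun x => k * Cx_mod (c x) ^+ 2)).
  exact: (integrableZl measurableT k (sqL c).2).
have -> : (u + v) ^+ 2 = (1 + s) * sq_norm mu a + (1 + s^-1) * sq_norm mu b.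
  rewrite -[sq_norm mu a]sqr_sqrtr ?sq_norm_ge0// -[sq_norm mu b]sqr_sqrtr ?sq_norm_ge0//.
  by rewrite -/u -/v /s; field; rewrite !gt_eqF.
rewrite /sq_norm -[X in X + _]RintegralZl//; last exact: (sqL a).2.
rewrite -[X in _ + X]RintegralZl//; last exact: (sqL b).2.
rewrite -RintegralD//.
apply: le_Rintegral => //.
- exact: (square_integrableD (sqL a) (sqL b)).2.
- exact: (integrableD measurableT (iZ _ a) (iZ _ b)).
- by move=> x _; exact: Cx_modD_sqr.
Qed.

HB.instance Definition _ := Lmodule_isNormed.Build (Cx R) L normD normZ norm0.

Lemma L2_normE a : `|a| = (Num.sqrt (sq_norm mu a))%:C%C :> Cx R. Proof. by []. Qed.

End L2_module.

(** * Completeness of L2 *)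

Section riesz_fischer.
Context d (T : measurableType d) (R : realType) (mu : {finite_measure set T -> \bar R}).
Local Notation L := (L2 mu).

Lemma fatou_bound (u : nat -> T -> R) (v : T -> R) (c : R) (k : nat) :
  (forall n, measurable_fun setT (u n)) -> (forall n x, 0 <= u n x) ->
  (forall x, u n x @[n --> \oo] --> v x) ->
  (forall n, (k <= n)%N -> (\int[mu]_x (u n x)%:E <= c%:E)%E) ->
  (\int[mu]_x (v x)%:E <= c%:E)%E.
Proof.
move=> mU u0 uv uc.
have := @fatou _ T R mu setT measurableT (fun n x => (u n x)%:E).
move=> /(_ (fun n => (measurable_EFinP _ _).2 (mU n)))
  /(_ (fun n x _ => u0 n x)) h.
have -> : (\int[mu]_x (v x)%:E = \int[mu]_x limn_einf (fun n => (u n x)%:E))%E.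
  apply: eq_integral => x _; have cx : (u n x)%:E @[n --> \oo] --> (v x)%:E.
    by apply: cvg_EFin; [exact: nearW|exact: uv].
  rewrite is_cvg_limn_einfE; last by apply/cvg_ex; exists (v x)%:E.
  by apply/esym/cvg_lim.
apply: (le_trans h); rewrite limn_einf_lim; apply: lime_le; first exact: is_cvg_einfs.
apply: nearW => n; apply: le_trans (uc (maxn n k) (leq_maxr _ _)).
by apply: ereal_inf_lbound; exists (maxn n k); rewrite //= leq_maxl.
Qed.

Let sqL (a : L) : square_integrable mu a := L2_square_integrable a.
Let mL (a : L) : Cx_measurable a := (sqL a).1.

Lemma L2_norm_sqr (a : L) : `|a| ^+ 2 = (sq_norm mu a)%:C%C.
Proof.
by rewrite L2_normE -(rmorphXn (real_complex R)) sqr_sqrtr// sq_norm_ge0.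
Qed.

Lemma L2_norm_le (a : L) (c : R) : 0 <= c -> (`|a| <= c%:C%C) = (sq_norm mu a <= c ^+ 2).
Proof.
move=> c0; rewrite -(@ler_pXn2r _ 2)// ?nnegrE//; last by rewrite -[0]/(0%:C%C : Cx R) real_leC.
by rewrite L2_norm_sqr -(rmorphXn (real_complex R)) real_leC.
Qed.

Lemma sq_norm_integral (f : T -> Cx R) : square_integrable mu f ->
  (\int[mu]_x (Cx_mod (f x) ^+ 2)%:E)%E = (sq_norm mu f)%:E.
Proof. by move=> [_ sf]; rewrite fineK// (integrable_fin_num measurableT sf). Qed.

(* As [mu] is finite, the L1 norms of the increments are summable as well (by
   AM-GM), so the sequence converges almost everywhere. *)
Lemma L2_half_pow_cvg (F : nat -> L) :
  (forall k, `|F k.+1 - F k| <= ((2^-1) ^+ k)%:C%C) ->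
  exists G : L, forall k, `|G - F k| <= (2 * (2^-1) ^+ k)%:C%C.
Proof.
move=> FS; pose D k x := Cx_mod (F k.+1 x - F k x).
have h0 k : 0 < (2^-1 : R) ^+ k by rewrite exprn_gt0.
have mB (a b : L) : Cx_measurable (fun x => a x - b x).
  apply: Cx_measurableD; first exact: mL.
  by have [] := square_integrableN (sqL b).
have sB (a b : L) : square_integrable mu (fun x => a x - b x).
  by apply: square_integrableD => //; exact: square_integrableN.
have nB (a b : L) : sq_norm mu (a - b : L) = sq_norm mu (fun x => a x - b x).
  by apply: ae_sq_norm; [exact: mL|exact: mB|exact: L2B].
have mD k : measurable_fun setT (D k) by apply: Cx_measurable_mod; exact: mB.
have D0 k x : 0 <= D k x by exact: Cx_mod_ge0.
have D2 k : (\int[mu]_x (D k x ^+ 2)%:E <= ((2^-1) ^+ k * (2^-1) ^+ k)%:E)%E.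
  rewrite (sq_norm_integral (sB (F k.+1) (F k))) lee_fin -nB -expr2 -L2_norm_le; first exact: FS.
  exact: ltW.
pose m := fine (mu setT); have m0 : 0 <= m by rewrite fine_ge0.
have D1 k : (\int[mu]_x (D k x)%:E <= ((m + 1) * (2^-1) ^+ k)%:E)%E.
  set c := (2^-1 : R) ^+ k; have c0 : 0 < c := h0 k.
  (* [D k <= c + D k ^+ 2 / c]; for [c] the [k]-th power of 1/2 both terms have an integral of the
     order of [c]. *)
  apply: (@le_trans _ _ (\int[mu]_x (c%:E + c^-1%:E * (D k x ^+ 2)%:E))%E).
    apply: ge0_le_integral => //.
    - by move=> x _; rewrite lee_fin.
    - exact/measurable_EFinP.
    - apply: emeasurable_funD => //; apply: measurable_funeM.
      by apply/measurable_EFinP; exact: measurable_funX.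
    - move=> x _; rewrite -EFinM -EFinD lee_fin.
      have := sqr_ge0 (D k x - c); have cc : c * c^-1 = 1 by rewrite mulfV ?gt_eqF.
      move=> h; rewrite -(ler_pM2l c0) mulrDr mulrA cc mul1r.
      have := D0 k x; nra.
  rewrite ge0_integralD//.
  2: by move=> x _; rewrite lee_fin ltW.
  2: by move=> x _; rewrite -EFinM lee_fin mulr_ge0 ?invr_ge0 ?sqr_ge0 ?ltW.
  2: by apply: measurable_funeM; apply/measurable_EFinP; exact: measurable_funX.
  rewrite integral_cst// ge0_integralZl_EFin ?invr_ge0 ?(ltW c0)//; last 2 first.
  - by move=> x _; rewrite lee_fin sqr_ge0.
  - by apply/measurable_EFinP; exact: measurable_funX.
  rewrite [X in (c%:E * X)%E](_ : _ = m%:E); last by rewrite /m fineK// fin_num_measure.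
  have c0' : (0 <= (c^-1)%:E)%E by rewrite lee_fin invr_ge0 ltW.
  apply: le_trans (leeD (lexx _) (lee_wpmul2l c0' (D2 k))) _.
  rewrite -!EFinM -EFinD lee_fin -/c mulrA mulVf ?gt_eqF//; lra.
pose S x := (\sum_(k <oo) (D k x)%:E)%E.
have mS : measurable_fun setT S.
  by apply: ge0_emeasurable_sum => [k x _ _|k _]; [rewrite lee_fin|exact/measurable_EFinP].
have S0 x : (0 <= S x)%E by apply: nneseries_ge0 => k _ _; rewrite lee_fin.
have iS : mu.-integrable setT S.
  apply/integrableP; split=> //.
  rewrite (eq_integral S); last by move=> x _; rewrite gee0_abs.
  rewrite integral_nneseries//; last 2 first.
  - by move=> k; exact/measurable_EFinP.
  - by move=> k x _; rewrite lee_fin.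
  apply: (@le_lt_trans _ _ ((m + 1) * 2)%:E); last exact: ltry.
  apply: lime_le.
    by apply: is_cvg_nneseries => k _ _; apply: integral_ge0 => x _; rewrite lee_fin.
  apply: nearW => n.
  apply: (@le_trans _ _ (\sum_(0 <= k < n) ((m + 1) * (2^-1) ^+ k)%:E)%E).
    by apply: lee_sum => k _; exact: D1.
  rewrite sumEFin lee_fin -mulr_sumr ler_wpM2l ?addr_ge0//.
  have -> : \sum_(0 <= k < n) (2^-1 : R) ^+ k = 2 * (1 - 2^-1 ^+ n).
    elim: n => [|n IH]; first by rewrite big_geq// expr0 subrr mulr0.
    by rewrite big_nat_recr//= IH exprS; field.
  by have := h0 n; lra.
pose E : set T := [set x | (S x < +oo)%E].
have mE : measurable E.
  have -> : E = ~` (S @^-1` [set +oo%E]).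
    by apply/seteqP; split=> x; rewrite /E /= ltey => /eqP.
  by apply: measurableC; rewrite -[X in measurable X]setTI; exact: mS.
have cvg_part (p : Cx R -> R) : (forall z w, p (z - w) = p z - p w) ->
    (forall z, `|p z| <= Cx_mod z) -> forall x, E x -> cvgn (fun n => p (F n x)).
  move=> pB ple x Ex.
  have -> : (fun n => p (F n x)) =
      (fun n => p (F 0%N x) + series (telescope (fun n => p (F n x))) n).
    by apply/funext => n; rewrite -eq_sum_telescope.
  apply: is_cvgD; first exact: is_cvg_cst.
  apply: normed_cvg; apply: nondecreasing_is_cvgn.
    exact: (@nondecreasing_series R (fun k => `|telescope (fun n => p (F n x)) k|) xpredT 0%N (fun k _ _ => normr_ge0 _)).
  exists (fine (S x)) => _ [n _ <-].
  have fS : S x \is a fin_num by rewrite ge0_fin_numE.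
  rewrite -lee_fin fineK// /series /= -sumEFin.
  apply: (@le_trans _ _ (\sum_(0 <= k < n) (D k x)%:E)%E).
    by apply: lee_sum => k _; rewrite lee_fin /telescope /= -pB; exact: ple.
  by apply: nneseries_lim_ge => k _ _; rewrite lee_fin.
(* Multiplied by the indicator of [E], a set of full measure, the sequence converges at every point,
   so that its limit is measurable and Fatou's lemma applies. *)
pose h n x : Cx R := (\1_E x)%:C%C * F n x.
pose g x : Cx R := (\1_E x)%:C%C *
  (limn (fun n => Cx_re (F n x)) +i* limn (fun n => Cx_im (F n x)))%C.
have re_h n x : Cx_re (h n x) = \1_E x * Cx_re (F n x).
  by rewrite /h Cx_reM /= mul0r subr0.
have im_h n x : Cx_im (h n x) = \1_E x * Cx_im (F n x).
  by rewrite /h Cx_imM /= mul0r addr0.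
have h_re x : Cx_re (h n x) @[n --> \oo] --> Cx_re (g x).
  rewrite /g Cx_reM /= mul0r subr0.
  rewrite (_ : (fun n => _) = (fun n => \1_E x * Cx_re (F n x))); last exact/funext.
  have [Ex|nEx] := pselect (E x).
    by apply: cvgMr; apply: (cvg_part (@Cx_re R)) => //; [exact: Cx_reB|exact: Cx_re_le].
  rewrite indicE memNset//= mul0r.
  by under eq_fun do rewrite mul0r; exact: cvg_cst.
have h_im x : Cx_im (h n x) @[n --> \oo] --> Cx_im (g x).
  rewrite /g Cx_imM /= mul0r addr0.
  rewrite (_ : (fun n => _) = (fun n => \1_E x * Cx_im (F n x))); last exact/funext.
  have [Ex|nEx] := pselect (E x).
    by apply: cvgMr; apply: (cvg_part (@Cx_im R)) => //; [exact: Cx_imB|exact: Cx_im_le].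
  rewrite indicE memNset//= mul0r.
  by under eq_fun do rewrite mul0r; exact: cvg_cst.
have sh n : square_integrable mu (h n).
  apply: (square_integrableM (c := 1) (f := fun x => (\1_E x)%:C%C)) => //.
  - by split; [exact: measurable_indic|exact: measurable_cst].
  - by move=> x; rewrite Cx_mod_real indicE; case: (x \in E); rewrite ?normr1 ?normr0.
have mg : Cx_measurable g.
  split.
    by apply: (@measurable_fun_cvg _ _ _ setT (fun n x => Cx_re (h n x))) => // n; exact: (sh n).1.1.
  by apply: (@measurable_fun_cvg _ _ _ setT (fun n x => Cx_im (h n x))) => // n; exact: (sh n).1.2.
have h_le n k x : Cx_mod (h n x - h k x) ^+ 2 <= Cx_mod (F n x - F k x) ^+ 2.
  rewrite /h -mulrBr Cx_modM exprMn Cx_mod_real.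
  by rewrite ler_piMl ?sqr_ge0// indicE; case: (x \in E); rewrite ?normr1 ?normr0 ?expr1n ?expr0n.
have g_bound k : (\int[mu]_x (Cx_mod (g x - h k x) ^+ 2)%:E <=
    ((2 * (2^-1) ^+ k) ^+ 2)%:E)%E.
  have mhk n : Cx_measurable (fun x => h n x - h k x).
    by have := square_integrableD (sh n) (square_integrableN (sh k)) => -[].
  apply: (fatou_bound (u := fun n x => Cx_mod (h n x - h k x) ^+ 2) (k := k)).
  - by move=> n; exact: Cx_measurable_mod_sqr.
  - by move=> n x; exact: sqr_ge0.
  - move=> x.
    have -> : Cx_mod (g x - h k x) ^+ 2 =
        (Cx_re (g x) - Cx_re (h k x)) * (Cx_re (g x) - Cx_re (h k x)) +
        (Cx_im (g x) - Cx_im (h k x)) * (Cx_im (g x) - Cx_im (h k x)).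
      by rewrite Cx_mod_sqr Cx_reB Cx_imB.
    rewrite (_ : (fun n => _) = (fun n =>
        (Cx_re (h n x) - Cx_re (h k x)) * (Cx_re (h n x) - Cx_re (h k x)) +
        (Cx_im (h n x) - Cx_im (h k x)) * (Cx_im (h n x) - Cx_im (h k x)))); last first.
      by apply/funext => n; rewrite Cx_mod_sqr Cx_reB Cx_imB.
    have cr : Cx_re (h n x) - Cx_re (h k x) @[n --> \oo] --> Cx_re (g x) - Cx_re (h k x).
      by apply: cvgB; [exact: h_re|exact: cvg_cst].
    have ci : Cx_im (h n x) - Cx_im (h k x) @[n --> \oo] --> Cx_im (g x) - Cx_im (h k x).
      by apply: cvgB; [exact: h_im|exact: cvg_cst].
    by apply: cvgD; apply: cvgM.
  - move=> n kn; apply: (@le_trans _ _ (\int[mu]_x (Cx_mod (F n x - F k x) ^+ 2)%:E)%E).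
      apply: ge0_le_integral => //.
      + by move=> x _; rewrite lee_fin sqr_ge0.
      + by apply/measurable_EFinP; exact: Cx_measurable_mod_sqr.
      + by apply/measurable_EFinP; exact: Cx_measurable_mod_sqr.
      + by move=> x _; rewrite lee_fin.
    rewrite (sq_norm_integral (sB (F n) (F k))) lee_fin -nB -L2_norm_le.
      have FS' j : `|F j.+1 - F j| <= (1 * (2^-1) ^+ j)%:C%C by rewrite mul1r.
      by have := half_pow_tail FS' k (n - k)%N; rewrite subnKC// mulr1.
    by rewrite mulr_ge0// ltW.
(* [g] is the sum of [g - h 0], square integrable by [g_bound], and of [h 0]. *)
have sg : square_integrable mu g.
  have sgh : square_integrable mu (fun x => g x - h 0%N x).
    have mgh : Cx_measurable (fun x => g x - h 0%N x).
      by apply: Cx_measurableD => //; have [] := square_integrableN (sh 0%N).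
    split=> //; apply/integrableP; split.
      by apply/measurable_EFinP; exact: Cx_measurable_mod_sqr.
    rewrite (eq_integral (fun x => (Cx_mod (g x - h 0%N x) ^+ 2)%:E)); last first.
      by move=> x _ /=; rewrite ger0_norm// sqr_ge0.
    exact: le_lt_trans (g_bound 0%N) (ltry _).
  have := square_integrableD sgh (sh 0%N).
  by rewrite (_ : (fun x => _) = g)//; apply/funext => x; rewrite subrK.
exists (toL2 mu g) => k.
have mgh : Cx_measurable (fun x => g x - h k x).
  by apply: Cx_measurableD => //; have [] := square_integrableN (sh k).
rewrite L2_norm_le; last by rewrite mulr_ge0// ltW.
have -> : sq_norm mu (toL2 mu g - F k : L) = sq_norm mu (fun x => g x - h k x).
  apply: ae_sq_norm => //.
  have aE : {ae mu, forall x, E x}.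
    apply: filterS (integrable_ae measurableT iS) => x /(_ I).
    by rewrite ge0_fin_numE.
  have e1 := L2B (toL2 mu g) (F k); have e2 := toL2E sg.
  apply: filterS3 e1 e2 aE => x -> -> Ex.
  by rewrite /h indicE mem_set// mul1r.
rewrite -lee_fin; apply: le_trans (g_bound k); rewrite le_eqVlt; apply/orP; left; apply/eqP.
have sgh : square_integrable mu (fun x => g x - h k x).
  by apply: square_integrableD => //; exact: square_integrableN.
by rewrite sq_norm_integral.
Qed.

End riesz_fischer.

Section L2_hilbert.
Context d (T : measurableType d) (R : realType) (mu : {finite_measure set T -> \bar R}).
Local Notation L := (L2 mu).

Let L2_complete (D : set_system L) : ProperFilter D -> cauchy D -> cvg D.
Proof.
move=> DD Dc; pose r k : R := (2^-1) ^+ k.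
have r0 k : 0 < r k by rewrite exprn_gt0.
(* Some member of the filter lies within [r k.+1] of [f k]. Members of a proper filter meet, so
   consecutive [f k] are at most [r k] apart. *)
have /choice[f fD] : forall k, exists f : L, D [set g | `|f - g| <= (r k.+1)%:C%C].
  move=> k; have /cauchyP/(_ _ (etrans (realC_gt0 _) (r0 k.+1)))[f Df] := Dc.
  exists f; apply: filterS Df => g; rewrite -ball_normE => /ltW; exact.
have fS k : `|f k.+1 - f k| <= (r k)%:C%C.
  have [g [/= g1 g2]] := filter_ex (filterI (fD k.+1) (fD k)).
  rewrite -(subrKA g) (le_trans (ler_normD _ _))// [X in _ + X]distrC.
  rewrite (le_trans (lerD g1 g2))// -(rmorphD (real_complex R)) real_leC /r !exprS.
  by have := r0 k; rewrite /r; lra.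
have [G Gf] := L2_half_pow_cvg fS.
apply/cvg_ex; exists G; apply/cvgrPdist_le => e e0; rewrite (ge0_Cx (ltW e0)).
have re0 : 0 < Cx_re e by rewrite -realC_gt0 -(ge0_Cx (ltW e0)).
have [k rk] : exists k, 3 * r k <= Cx_re e.
  have : (fun k => 3 * r k) @ \oo --> (3 * 0 : R).
    by apply: cvgMr; apply: cvg_expr; rewrite ger0_norm//; lra.
  rewrite mulr0 => /cvgrPdist_le/(_ _ re0)[k _ /(_ k (leqnn k)) /= kk].
  exists k; apply: le_trans kk; rewrite sub0r normrN; exact: ler_norm.
apply: filterS (fD k) => g /= fg.
rewrite -(subrKA (f k)) (le_trans (ler_normD _ _))// (le_trans (lerD (Gf k) fg))//.
rewrite -(rmorphD (real_complex R)) real_leC -/(r k) /r exprS.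
by have := r0 k; move: rk; rewrite /r; lra.
Qed.

HB.instance Definition _ := Uniform_isComplete.Build L L2_complete.

Definition L2_inner (a b : L) : Cx R := sq_inner mu a b.

Let sqL (a : L) : square_integrable mu a := L2_square_integrable a.
Let mL (a : L) : Cx_measurable a := (sqL a).1.

Let inner_linear (c : L) (z : Cx R) (a b : L) :
  L2_inner (z *: a + b) c = z * L2_inner a c + L2_inner b c.
Proof.
rewrite /L2_inner -sq_inner_linear//; apply: ae_sq_inner => //.
- have := square_integrableD (square_integrableZ z (sqL a)) (sqL b).
  by case.
- have h1 := L2D (z *: a) b; have h2 := L2Z z a.
  by apply: filterS2 h1 h2 => x -> ->.
- exact: ae_equal_refl.
Qed.

Let inner_sym (a b : L) : L2_inner a b = (-1) ^+ false * (L2_inner b a)^*.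
Proof. by rewrite expr0 mul1r; exact: sq_inner_conj. Qed.

Let inner_bilinear : bilinear_for *%R (Num.conj \; *%R) L2_inner.
Proof.
split=> c z a b; first exact: inner_linear.
rewrite inner_sym expr0 mul1r inner_linear rmorphD rmorphM /=.
by rewrite [L2_inner c a]inner_sym [L2_inner c b]inner_sym expr0 !mul1r.
Qed.

Let inner_self (a : L) : L2_inner a a = `|a| ^+ 2.
Proof. by rewrite L2_norm_sqr; exact: sq_inner_norm. Qed.

Let inner_pos (a : L) : a != 0 -> 0 < L2_inner a a.
Proof. by move=> a0; rewrite inner_self exprn_gt0// normr_gt0. Qed.

HB.instance Definition _ := bilinear_isBilinear.Build (Cx R) L L (Cx R) *%R
  (Num.conj \; *%R) L2_inner inner_bilinear.
HB.instance Definition _ := isHermitianSesquilinear.Build (Cx R) L false Num.conj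
  L2_inner inner_sym.
HB.instance Definition _ := isDotProduct.Build (Cx R) L L2_inner inner_pos.

HB.instance Definition _ := isHilbertSpace.Build (Cx R) L
  (fun a => esym (inner_self a)).

End L2_hilbert.

(** * Densities and Koopman operators *)

Lemma linear_bounded_cts (R : realType) (V W : normedModType (Cx R)) (f : V -> W) (M : R) :
  linear f -> (forall x, `|f x| <= M%:C%C * `|x|) -> continuous f.
Proof.
move=> fl fM x; apply/(@cvgrPdist_le _ _ _ (nbhs x)) => e e0.
have er := ge0_Cx (ltW e0); have re0 : 0 < Cx_re e by rewrite -realC_gt0 -er.
pose N := `|M| + 1; have N0 : 0 < N by rewrite ltr_wpDl.
have d0 : (0 : Cx R) < (Cx_re e / N)%:C%C by rewrite realC_gt0 divr_gt0.
near=> y.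
have : ball x ((Cx_re e / N)%:C%C : Cx R) y by near: y; exact: nbhsx_ballx.
rewrite -ball_normE /= => /ltW xy; rewrite -(linfB fl) (le_trans (fM _))//.
rewrite (@le_trans _ _ (N%:C%C * `|x - y|))//.
  by rewrite ler_wpM2r// real_leC (le_trans (ler_norm _))// lerDl.
rewrite (le_trans (ler_wpM2l _ xy))//; first by rewrite ltW// realC_gt0.
by rewrite -(rmorphM (real_complex R)) er real_leC mulrCA mulfV ?mulr1// gt_eqF.
Unshelve. all: by end_near. Qed.

Section densities.
Context d (T : measurableType d) (R : realType).
Implicit Types mu nu : {finite_measure set T -> \bar R}.

(** A Radon-Nikodym derivative with finite values, characterized by integrals of nonnegative
    functions: densities then compose by substitution. *)
Definition is_density mu nu (w : T -> R) := [/\ measurable_fun setT w,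
  forall x, 0 <= w x, mu.-integrable setT (EFin \o w) &
  forall f : T -> \bar R, (forall x, 0 <= f x)%E -> measurable_fun setT f ->
    (\int[nu]_x f x = \int[mu]_x (f x * (w x)%:E))%E].

Lemma density_exists mu nu : (forall A, measurable A -> mu A = 0%E -> nu A = 0%E) ->
  exists w, is_density mu nu w.
Proof.
move=> ac; have numu : nu `<< mu by apply/null_content_dominatesP.
pose f := Radon_Nikodym_SigmaFinite.f nu mu.
have f0 := Radon_Nikodym_SigmaFinite.f_ge0 numu.
have ffin := Radon_Nikodym_SigmaFinite.f_fin_num numu.
have fE : EFin \o (fun x => fine (f x)) = f by apply/funext => x /=; rewrite fineK// ffin.
have fi := Radon_Nikodym_SigmaFinite.f_integrable numu.
exists (fun x => fine (f x)); split.
- by apply/measurable_EFinP; rewrite fE; exact: measurable_int fi.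
- by move=> x; rewrite fine_ge0// f0.
- by rewrite fE.
- move=> h h0 mh; rewrite -(Radon_Nikodym_SigmaFinite.change_of_variables numu h0)//.
  by apply: eq_integral => x _; rewrite fineK// ffin.
Qed.

Lemma densityE mu nu w A : is_density mu nu w -> measurable A ->
  nu A = (\int[mu]_(x in A) (w x)%:E)%E.
Proof.
move=> [mw w0 iw wE] mA.
have := wE (fun x => (\1_A x)%:E); rewrite integral_indic// setIT => ->; last 2 first.
- by move=> x; rewrite lee_fin indicE.
- by apply/measurable_EFinP; exact: measurable_indic.
rewrite [RHS]integral_mkcond; apply: eq_integral => x _.
by rewrite -EFinM epatch_indic /= muleC EFinM.
Qed.

(** The source of the cocycle identities below, which compare two expressions for the density of one
    measure. *)
Lemma density_unique mu nu w w' : is_density mu nu w -> is_density mu nu w' ->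
  {ae mu, forall x, w x = w' x}.
Proof.
move=> dw dw'; have [_ _ iw _] := dw; have [mw' _ _ _] := dw'.
have : ae_eq mu setT (EFin \o w) (EFin \o w').
  apply: integral_ae_eq => //; first exact/measurable_EFinP.
  by move=> A _ mA; rewrite -(densityE dw mA) -(densityE dw' mA).
by apply: filterS => x /(_ I) [].
Qed.

(** Integrability comes for free, as [w] integrates to the finite mass of [nu]. *)
Lemma density_intro mu nu (w : T -> R) : measurable_fun setT w -> (forall x, 0 <= w x) ->
  (forall f : T -> \bar R, (forall x, 0 <= f x)%E -> measurable_fun setT f ->
    (\int[nu]_x f x = \int[mu]_x (f x * (w x)%:E))%E) -> is_density mu nu w.
Proof.
move=> mw w0 wE; split=> //; apply/integrableP; split; first exact/measurable_EFinP.
rewrite (eq_integral (fun x => (cst 1%E x * (w x)%:E)%E)); last first.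
  by move=> x _; rewrite mul1e /= ger0_norm.
by rewrite -wE// integral_cst// mul1e ltey_eq fin_num_measure.
Qed.

End densities.

(** The defect [B] vanishes on the diagonal, hence [B x y = - B y x]; with ['i *: y] in place of [y]
    this becomes [B x y = B y x]. *)
Lemma linear_isometry_inner (R : realType) (H1 H2 : hilbertType (Cx R)) (f : H1 -> H2) :
  linear f -> (forall x, `|f x| = `|x|) -> forall x y, inner (f x) (f y) = inner x y.
Proof.
move=> fl fn x y; pose B x y := inner (f x) (f y) - inner x y.
have Bd z : B z z = 0 by rewrite /B -!norm_inner fn subrr.
have B2 x' y' : B x' y' + B y' x' = 0.
  have := Bd (x' + y'); rewrite /B (linfD fl) !innerDl !innerDr -!norm_inner !fn => <-.
  ring.
have Bi x' y' : B x' ('i *: y') = - 'i * B x' y'.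
  by rewrite /B (linfZ fl) !innerZr conjCi; ring.
have Bi' x' y' : B ('i *: x') y' = 'i * B x' y'.
  by rewrite /B (linfZ fl) !innerZl; ring.
have h1 := B2 x y; have h2 := B2 x ('i *: y).
rewrite Bi Bi' mulNr addrC -mulrBr in h2.
have /eqP := h2; rewrite mulf_eq0 (negbTE (neq0Ci _)) /= subr_eq0 => /eqP Byx.
have /eqP := h1; rewrite Byx -mulr2n mulrn_eq0 /= => /eqP.
by rewrite /B => /eqP; rewrite subr_eq0 => /eqP.
Qed.

Section pushforward_finite_measure.
Context d d' (T : measurableType d) (T' : measurableType d') (R : realType).
Variables (mu : {finite_measure set T -> \bar R}) (X : {mfun T >-> T'}).

Definition finite_pushforward : set T' -> \bar R := pushforward mu X.

Let finite_pushforward0 : finite_pushforward set0 = 0%E.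
Proof. exact: measure0. Qed.

Let finite_pushforward_ge0 A : (0 <= finite_pushforward A)%E.
Proof. exact: measure_ge0. Qed.

Let finite_pushforward_sigma_additive : semi_sigma_additive finite_pushforward.
Proof. exact: measure_semi_sigma_additive. Qed.

HB.instance Definition _ := isMeasure.Build _ _ _ finite_pushforward
  finite_pushforward0 finite_pushforward_ge0 finite_pushforward_sigma_additive.

Let finite_pushforward_fin : fin_num_fun finite_pushforward.
Proof.
move=> A mA; apply: fin_num_measure.
by rewrite -[X in measurable X]setTI; exact: (measurable_funPT X).
Qed.

HB.instance Definition _ := Measure_isFinite.Build _ _ _ finite_pushforward
  finite_pushforward_fin.

End pushforward_finite_measure.

Lemma pushforward_finite_measure d d' (T : measurableType d) (T' : measurableType d')
    (R : realType) (mu : {finite_measure set T -> \bar R}) (f : T -> T') :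
  measurable_fun setT f ->
  exists nu : {finite_measure set T' -> \bar R}, (forall A, nu A = pushforward mu f A) /\
    forall h : T' -> \bar R, (forall y, 0 <= h y)%E -> measurable_fun setT h ->
      (\int[nu]_y h y = \int[mu]_x h (f x))%E.
Proof.
move=> mf; pose mf_mixin := isMeasurableFun.Build _ _ _ _ _ mf.
pose X : {mfun T >-> T'} := HB.pack f mf_mixin.
exists (finite_pushforward mu X); split=> // h h0 mh.
by rewrite ge0_integral_pushforward.
Qed.

Section koopman.
Context d (T : measurableType d) (R : realType) (mu : {finite_measure set T -> \bar R}).
Variables (Gam : groupType) (act : Gam -> T -> T).
Hypothesis mact : forall g, measurable_fun setT (act g).
Hypothesis act1 : forall x, act 1%g x = x.
Hypothesis actM : forall g h x, act (g * h)%g x = act g (act h x).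
Variable w : Gam -> T -> R.
Hypothesis mw : forall g, measurable_fun setT (w g).
Hypothesis w0 : forall g x, 0 <= w g x.
Hypothesis wE : forall g (f : T -> \bar R), (forall x, 0 <= f x)%E ->
  measurable_fun setT f ->
  (\int[mu]_x f (act g x) = \int[mu]_x (f x * (w g x)%:E))%E.

Local Notation L := (L2 mu).

Implicit Types f : T -> Cx R.

(** By [wE], [w g] is the density of the image of [mu] under [act g]; hence the inverse of [g] in
    the argument of [f]. *)
Definition koopman_fun g (f : T -> Cx R) x : Cx R :=
  (Num.sqrt (w g x))%:C%C * f (act g^-1%g x).

Definition koopman g (a : L) : L := toL2 mu (koopman_fun g a).

Let actK g x : act g^-1%g (act g x) = x.
Proof. by rewrite -actM mulVg act1. Qed.

Lemma Cx_measurable_act g f : Cx_measurable f -> Cx_measurable (fun x => f (act g x)).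
Proof. by move=> [mr mi]; split; [exact: (measurableT_comp mr)|exact: (measurableT_comp mi)]. Qed.

Lemma koopman_fun_measurable g f : Cx_measurable f -> Cx_measurable (koopman_fun g f).
Proof.
move=> mf; apply: Cx_measurableM; last exact: Cx_measurable_act.
split; last exact: measurable_cst.
apply: measurableT_comp => //.
by apply: continuous_measurable_fun; exact: sqrt_continuous.
Qed.

Let koopman_fun_mod g f x :
  Cx_mod (koopman_fun g f x) ^+ 2 = Cx_mod (f (act g^-1%g x)) ^+ 2 * w g x.
Proof.
by rewrite Cx_modM Cx_mod_real exprMn real_normK ?num_real// sqr_sqrtr// mulrC.
Qed.

Let koopman_fun_integral g f : Cx_measurable f ->
  (\int[mu]_x (Cx_mod (koopman_fun g f x) ^+ 2)%:E = \int[mu]_x (Cx_mod (f x) ^+ 2)%:E)%E.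
Proof.
move=> mf; under eq_integral do rewrite koopman_fun_mod EFinM.
rewrite -(@wE g (fun x => (Cx_mod (f (act g^-1%g x)) ^+ 2)%:E)); last 2 first.
- by move=> x; rewrite lee_fin sqr_ge0.
- by apply/measurable_EFinP; apply: Cx_measurable_mod_sqr; exact: Cx_measurable_act.
by apply: eq_integral => x _; rewrite actK.
Qed.

Lemma koopman_fun_square_integrable g f :
  square_integrable mu f -> square_integrable mu (koopman_fun g f).
Proof.
move=> sf; have [mf /integrableP[_ ff]] := sf.
have mk := koopman_fun_measurable g mf.
split=> //; apply/integrableP; split.
  by apply/measurable_EFinP; exact: Cx_measurable_mod_sqr.
rewrite (eq_integral (fun x => (Cx_mod (koopman_fun g f x) ^+ 2)%:E)); last first.
  by move=> x _ /=; rewrite ger0_norm// sqr_ge0.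
by rewrite koopman_fun_integral// sq_norm_integral// ltry.
Qed.

Lemma koopman_fun_norm g f : square_integrable mu f ->
  sq_norm mu (koopman_fun g f) = sq_norm mu f.
Proof.
move=> sf; rewrite /sq_norm /Rintegral; congr fine.
by rewrite koopman_fun_integral//; case: sf.
Qed.

(** By [wE] for an indicator, null sets have null preimages; therefore [koopman_fun] respects almost
    everywhere classes. *)
Lemma ae_act g (P : T -> Prop) : {ae mu, forall x, P x} -> {ae mu, forall x, P (act g x)}.
Proof.
move=> [N [mN N0 PN]]; exists (act g @^-1` N); split.
- by rewrite -[X in measurable X]setTI; exact: mact.
- have mN' : measurable (act g @^-1` N) by rewrite -[X in measurable X]setTI; exact: mact.
  have := @wE g (fun x => (\1_N x)%:E).
  rewrite (eq_integral (fun x => (\1_(act g @^-1` N) x)%:E)); last first.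
    by move=> x _; rewrite !indicE.
  rewrite integral_indic// setIT => ->; last 2 first.
  + by move=> x; rewrite lee_fin indicE.
  + by apply/measurable_EFinP; exact: measurable_indic.
  rewrite (ae_eq_integral (cst 0%E)) ?integral0//.
  + apply: emeasurable_funM; last exact/measurable_EFinP.
    by apply/measurable_EFinP; exact: measurable_indic.
  + exists N; split=> // x /= h; apply: contrapT => nN; apply: h => _.
    by rewrite indicE memNset// mul0e.
- by move=> x /= nP; apply: PN.
Qed.

Lemma koopman_ae g f f' : ae_equal mu f f' -> ae_equal mu (koopman_fun g f) (koopman_fun g f').
Proof.
by move=> /(ae_act g^-1%g); apply: filterS => x; rewrite /koopman_fun => ->.
Qed.

Let sqL (a : L) : square_integrable mu a := L2_square_integrable a.

Lemma koopmanE g (a : L) : ae_equal mu (koopman g a) (koopman_fun g a).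
Proof. by apply: toL2E; exact: koopman_fun_square_integrable. Qed.

Lemma koopman_linear g : linear (koopman g).
Proof.
move=> z a b; apply: L2_ext.
have h1 := koopmanE g (z *: a + b).
have h2 := koopman_ae g (L2D (z *: a) b).
have h3 : ae_equal mu (koopman_fun g (z *: a : L)) (koopman_fun g (fun x => z * a x)).
  exact: koopman_ae (L2Z z a).
have h4 := L2D (z *: koopman g a) (koopman g b); have h5 := L2Z z (koopman g a).
have h6 := koopmanE g a; have h7 := koopmanE g b.
have h123 : ae_equal mu (koopman g (z *: a + b))
    (fun x => z * koopman_fun g a x + koopman_fun g b x).
  apply: filterS3 h1 h2 h3 => x -> ->; rewrite /koopman_fun => h3.
  by rewrite mulrDr h3; congr (_ + _); rewrite mulrCA.
apply: ae_equal_trans h123 _.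
apply: filterS2 (filterI h4 h5) (filterI h6 h7) => x [-> ->] [-> ->]; done.
Qed.

Lemma koopman_norm g a : `|koopman g a| = `|a|.
Proof.
rewrite !L2_normE; congr ((Num.sqrt _)%:C%C).
rewrite -(koopman_fun_norm g (sqL a)); apply: ae_sq_norm (koopmanE g a).
  by have [] := sqL (koopman g a).
by have [] := koopman_fun_square_integrable g (sqL a).
Qed.

(** [w 1] and the constant 1 are both densities of [mu] with respect to itself. *)
Lemma koopman1 a : koopman 1%g a = a.
Proof.
apply: L2_ext; apply: ae_equal_trans (koopmanE _ _) _.
have d1 : is_density mu mu (w 1%g).
  apply: density_intro => // f f0 mf; rewrite -wE//.
  by apply: eq_integral => x _; rewrite act1.
have d1' : is_density mu mu (cst 1).
  by apply: density_intro => // f f0 mf; apply: eq_integral => x _; rewrite mule1.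
apply: filterS (density_unique d1 d1') => x w1.
by rewrite /koopman_fun w1 sqrtr1 mul1r invg1 act1.
Qed.

(** This is the cocycle identity [w (g * h) x = w g x * w h (g^-1 x)], valid almost everywhere since
    both sides are densities of the image of [mu] under [g * h]. *)
Lemma koopmanM g h a : koopman (g * h)%g a = koopman g (koopman h a).
Proof.
apply: L2_ext; apply: ae_equal_trans (koopmanE _ _) _; apply: ae_equal_sym.
apply: ae_equal_trans (koopmanE _ _) _.
apply: ae_equal_trans (koopman_ae g (koopmanE h a)) _.
have [nu [_ nuE]] := pushforward_finite_measure mu (mact (g * h)%g).
have dgh : is_density mu nu (w (g * h)%g).
  by apply: density_intro => // f f0 mf; rewrite nuE// wE.
have dgh' : is_density mu nu (fun x => w g x * w h (act g^-1%g x)).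
  apply: density_intro => [|x|f f0 mf].
  - by apply: measurable_funM => //; exact: (measurableT_comp (mw h)).
  - exact: mulr_ge0.
  - rewrite nuE//.
    rewrite (eq_integral (fun x => f (act g (act h x)))); last by move=> x _; rewrite actM.
    rewrite (@wE h (fun x => f (act g x)))//; last exact: (measurableT_comp mf).
    rewrite (eq_integral (fun x => (fun y => f y * (w h (act g^-1%g y))%:E)%E (act g x))); last first.
      by move=> x _; rewrite actK.
    rewrite (@wE g (fun y => f y * (w h (act g^-1%g y))%:E)%E).
    + by apply: eq_integral => x _; rewrite EFinM -muleA [X in (f x * X)%E]muleC.
    + by move=> x; rewrite mule_ge0// lee_fin.
    + apply: emeasurable_funM => //; apply/measurable_EFinP.
      exact: (measurableT_comp (mw h)).
apply: filterS (density_unique dgh dgh') => x wgh.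
rewrite /koopman_fun wgh mulrA -(rmorphM (real_complex R)) -sqrtrM//.
by rewrite invgM actM.
Qed.

Lemma koopman_unitary : unitary_rep koopman.
Proof.
split=> [g|x|g h x|g x y].
- exact: koopman_linear.
- exact: koopman1.
- exact: koopmanM.
- by apply: linear_isometry_inner; [exact: koopman_linear|exact: koopman_norm].
Qed.

End koopman.

Section multiplication_representation.
Variables (R : realType) (K : compactType) (mu : {finite_measure set (borel K) -> \bar R}).
Local Notation L := (L2 mu).
Implicit Types (F E : Cfun R K) (a b : L).

Lemma Cfun_measurable F : Cx_measurable (F : borel K -> Cx R).
Proof.
split.
  exact: (continuous_borel_measurable_real (@Cfun_re_continuous _ _ F)).
exact: (continuous_borel_measurable_real (@Cfun_im_continuous _ _ F)).
Qed.

Lemma Cfun_mul_square_integrable F (f : borel K -> Cx R) :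
  square_integrable mu f -> square_integrable mu (fun x => F x * f x).
Proof.
by apply: (square_integrableM (c := sup_mod F)); [exact: Cfun_measurable|exact: le_sup_mod].
Qed.

Definition mulrep F (a : L) : L := toL2 mu (fun x => F x * a x).

Let sqL a : square_integrable mu a := L2_square_integrable a.

Lemma mulrepE F a : ae_equal mu (mulrep F a) (fun x => F x * a x).
Proof. by apply: toL2E; exact: Cfun_mul_square_integrable. Qed.

Let mulrep_linear F : linear (mulrep F).
Proof.
move=> z a b; apply: L2_ext.
have h1 := mulrepE F (z *: a + b); have h2 := L2D (z *: a) b; have h3 := L2Z z a.
have h4 := L2D (z *: mulrep F a) (mulrep F b); have h5 := L2Z z (mulrep F a).
have h6 := mulrepE F a; have h7 := mulrepE F b.
apply: filterS3 (filterI h1 h2) (filterI h3 h4) (filterI h5 (filterI h6 h7)).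
move=> x [-> ->] [-> ->] [-> [-> ->]].
by rewrite mulrDr mulrCA.
Qed.

Let mulrep_linearl a : linear (mulrep^~ a).
Proof.
move=> z F E; apply: L2_ext.
have h1 := mulrepE (z *: F + E) a.
have h4 := L2D (z *: mulrep F a) (mulrep E a); have h5 := L2Z z (mulrep F a).
have h6 := mulrepE F a; have h7 := mulrepE E a.
apply: filterS3 h1 (filterI h4 h5) (filterI h6 h7) => x -> [-> ->] [-> ->].
by rewrite CfunD CfunZ mulrDl mulrA.
Qed.

Let mulrep_bounded F a : `|mulrep F a| <= (sup_mod F)%:C%C * `|a|.
Proof.
have s0 : 0 <= sup_mod F := le_trans (Cx_mod_ge0 _) (le_sup_mod F point).
rewrite (L2_normE a) -(rmorphM (real_complex R)) L2_norm_le; last first.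
  by rewrite mulr_ge0// sqrtr_ge0.
rewrite exprMn sqr_sqrtr ?sq_norm_ge0//.
have sFa := Cfun_mul_square_integrable F (sqL a).
rewrite (ae_sq_norm _ _ (mulrepE F a)); [|by have [] := sqL (mulrep F a)|by have [] := sFa].
rewrite /sq_norm -RintegralZl//; last exact: (sqL a).2.
apply: le_Rintegral => //.
- exact: sFa.2.
- exact: (integrableZl measurableT (sup_mod F ^+ 2) (sqL a).2).
- move=> x _; rewrite Cx_modM exprMn ler_wpM2r ?sqr_ge0//.
  by rewrite ler_pXn2r ?nnegrE ?Cx_mod_ge0// le_sup_mod.
Qed.

Lemma mulrep_representation : representation mulrep.
Proof.
split.
- move=> F; split; first exact: mulrep_linear.
  exact: (linear_bounded_cts (@mulrep_linear F) (mulrep_bounded F)).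
- exact: mulrep_linearl.
- move=> a; apply: L2_ext; apply: filterS (mulrepE cone a) => x ->.
  by rewrite -[X in X * _]/(1 : Cx R) mul1r.
- move=> F E a; apply: L2_ext.
  have h1 := mulrepE (cmul F E) a; have h2 := mulrepE F (mulrep E a).
  apply: filterS3 h1 h2 (mulrepE E a) => x -> -> ->.
  by rewrite -[X in X * _]/(F x * E x) mulrA.
- move=> F a b.
  have mv (v : L) : Cx_measurable v := (sqL v).1.
  have mF E (v : L) := (Cfun_mul_square_integrable E (sqL v)).1.
  rewrite -[LHS]/(sq_inner mu (mulrep (star F) a) b) -[RHS]/(sq_inner mu a (mulrep F b)).
  rewrite (ae_sq_inner (mv _) (mF _ a) (mv b) (mv b) (mulrepE (star F) a) (ae_equal_refl mu b)).
  rewrite (ae_sq_inner (mv a) (mv a) (mv _) (mF _ b) (ae_equal_refl mu a) (mulrepE F b)).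
  congr (_ +i* _)%C; apply: eq_Rintegral => x _.
    by rewrite -[X in Cx_re (X * _ * _)]/((F x)^*) rmorphM mulrCA mulrA.
  by rewrite -[X in Cx_im (X * _ * _)]/((F x)^*) rmorphM mulrCA mulrA.
Qed.

End multiplication_representation.

(** * Measures give a covariant representation *)

Lemma countable_enumeration (I : Type) (i0 : I) : countable [set: I] ->
  exists e : nat -> I, forall i, exists n, e n = i.
Proof.
move=> /countable_injP[f finj].
have /choice[e eE] n : exists i : I, (exists j, f j = n) -> f i = n.
  by have [[j <-]|nj] := pselect (exists j, f j = n); [exists j|exists i0].
exists e => i; exists (f i); apply: finj; rewrite ?in_setT//.
by apply: eE; exists i.
Qed.

Section dominating_measure.
Context d (T : measurableType d) (R : realType) (m : nat -> probability T R).

Let weight k : {nonneg R} := (1 / (2 ^ k.+1)%:R)%:nng.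

(** The weights add up to 1, which makes the mixture finite; beyond that, its null sets are what
    matters. *)
Definition geometric_mixture : set T -> \bar R :=
  mseries (fun k => mscale (weight k) (m k) : {measure set T -> \bar R}) 0.

HB.instance Definition _ := Measure.on geometric_mixture.

Let geometric_mixture_fin : fin_num_fun geometric_mixture.
Proof.
move=> A mA; rewrite ge0_fin_numE//; apply: (@le_lt_trans _ _ 1%E); last exact: ltry.
apply: le_trans (epsilon_trick0 xpredT (@ler01 R)).
apply: lee_nneseries => // k _; rewrite /mscale /=.
rewrite -[X in (_ <= X)%E]mule1 lee_wpmul2l ?lee_fin//.
exact: probability_le1.
Qed.

HB.instance Definition _ := Measure_isFinite.Build _ _ _ geometric_mixture
  geometric_mixture_fin.

Lemma geometric_mixture_eq0 A : geometric_mixture A = 0%E <-> forall k, m k A = 0%E.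
Proof.
split=> [h k|h]; last first.
  by apply: eseries0 => k _ _; rewrite -[LHS]/(_ * m k A)%E h mule0.
have := nneseries_lim_ge k.+1 (fun i (_ : (0 <= i)%N) (_ : true) =>
  measure_ge0 (mscale (weight i) (m i)) A).
rewrite -[X in (_ <= X)%E]/(geometric_mixture A) h big_nat_recr//= => h2.
have : (mscale (weight k) (m k) A <= 0)%E.
  by apply: le_trans h2; rewrite leeDr// sume_ge0.
rewrite /mscale => h3; apply/eqP; rewrite eq_le measure_ge0 andbT.
by rewrite -(@pmule_rle0 _ (weight k)%:num%:E)// lte_fin /=.
Qed.

End dominating_measure.

Lemma dominating_measure d (T : measurableType d) (R : realType) (I : Type) (i0 : I)
    (m : I -> probability T R) : countable [set: I] ->
  exists rho : {finite_measure set T -> \bar R},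
    forall A, rho A = 0%E <-> forall i, m i A = 0%E.
Proof.
move=> /(countable_enumeration i0)[e eE].
exists (geometric_mixture (fun k => m (e k))) => A; rewrite geometric_mixture_eq0.
by split=> h i; [have [n <-] := eE i|].
Qed.

(** The difference of the square roots is at most their sum, and the product of difference and sum
    is [a - b]. *)
Lemma sqr_sqrtB_le (R : rcfType) (a b : R) : 0 <= a -> 0 <= b ->
  (Num.sqrt a - Num.sqrt b) ^+ 2 <= `|a - b|.
Proof.
move=> a0 b0; rewrite -{2}(sqr_sqrtr a0) -{2}(sqr_sqrtr b0) subr_sqr normrM.
rewrite -[leLHS]ger0_norm ?sqr_ge0// normrX expr2 ler_wpM2l//.
rewrite [leRHS]ger0_norm ?addr_ge0 ?sqrtr_ge0//.
rewrite (le_trans (ler_normB _ _))//.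
by rewrite !ger0_norm ?sqrtr_ge0.
Qed.

Section density_vectors.
Context d (T : measurableType d) (R : realType) (rho : {finite_measure set T -> \bar R}).

Definition density_sqrt (w : T -> R) (x : T) : Cx R := (Num.sqrt (w x))%:C%C.

Lemma sqrt_measurable (w : T -> R) : measurable_fun setT w ->
  measurable_fun setT (fun x => Num.sqrt (w x)).
Proof.
move=> mw; apply: (@measurableT_comp _ _ _ _ _ _ (Num.sqrt : R -> R)) => //.
by apply: continuous_measurable_fun; exact: sqrt_continuous.
Qed.

Let density_sqrt_mod w x : 0 <= w x -> Cx_mod (density_sqrt w x) ^+ 2 = w x.
Proof. by move=> w0; rewrite Cx_mod_real real_normK ?num_real// sqr_sqrtr. Qed.

Lemma density_sqrt_square_integrable (mu : {finite_measure set T -> \bar R}) w :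
  is_density rho mu w -> square_integrable rho (density_sqrt w).
Proof.
move=> [mw w0 iw _]; split.
  by split; [exact: sqrt_measurable|exact: measurable_cst].
by rewrite (_ : (fun x => _) = w)//; apply/funext => x; rewrite density_sqrt_mod.
Qed.

Lemma density_sqrt_integral (mu : {finite_measure set T -> \bar R}) w (f : T -> R) :
  is_density rho mu w -> (forall x, 0 <= f x) -> measurable_fun setT f ->
  (\int[rho]_x (f x * Cx_mod (density_sqrt w x) ^+ 2))%R = (\int[mu]_x f x)%R.
Proof.
move=> [mw w0 iw wE] f0 mf; rewrite /Rintegral wE; first last.
- exact/measurable_EFinP.
- by move=> x; rewrite lee_fin.
by congr fine; apply: eq_integral => x _; rewrite -EFinM density_sqrt_mod.
Qed.

(** On [A], where [w <= v], and on its complement [v - w] has constant sign, so the partition into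
    these two sets recovers the integral of [|v - w|]; this dominates the squared difference of the
    square roots pointwise. *)
Lemma hellinger_le_variation_norm (mu nu : {finite_measure set T -> \bar R}) v w :
  is_density rho mu v -> is_density rho nu w ->
  ((sq_norm rho (fun x => density_sqrt v x - density_sqrt w x))%:E
   <= variation_norm (fun A => mu A - nu A))%E.
Proof.
move=> dv dw; have [mv v0 iv _] := dv; have [mw w0 iw _] := dw.
pose A := [set x | w x <= v x].
have mA : measurable A by rewrite -[A]setTI; exact: measurable_fun_le.
have mCA := measurableC mA.
apply: le_trans (le_variation_norm mu nu mA); rewrite lee_fin.
have iB (D : set T) : measurable D -> rho.-integrable D (EFin \o v) /\ rho.-integrable D (EFin \o w).
  by move=> mD; split; apply: integrableS (measurableT) mD (@subsetT _ _) _.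
have ivw : rho.-integrable setT (EFin \o (fun x => `|v x - w x|)).
  by have := integrable_abse (integrableB measurableT iv iw).
have sE x : Cx_mod (density_sqrt v x - density_sqrt w x) ^+ 2 =
    (Num.sqrt (v x) - Num.sqrt (w x)) ^+ 2.
  rewrite /density_sqrt -(rmorphB (real_complex R)) Cx_mod_real.
  by rewrite real_normK// num_real.
have dE mu' v' D : is_density rho mu' v' -> measurable D ->
    fine (mu' D) = (\int[rho]_(x in D) v' x)%R.
  by move=> d' mD; rewrite (densityE d' mD).
rewrite (dE _ _ A dv)// (dE _ _ A dw)// (dE _ _ _ dv mCA) (dE _ _ _ dw mCA).
rewrite -!RintegralB//; try (by have [] := iB _ mA); try (by have [] := iB _ mCA).
apply: (@le_trans _ _ (\int[rho]_x `|v x - w x|)%R).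
  apply: le_Rintegral => //; last by move=> x _; rewrite sE sqr_sqrtB_le.
  apply: le_integrable ivw => //.
    apply/measurable_EFinP; rewrite (_ : (fun x => _) = (fun x => (Num.sqrt (v x) - Num.sqrt (w x)) ^+ 2)).
      by apply: measurable_funX; apply: measurable_funB; exact: sqrt_measurable.
    exact/funext.
  by move=> x _; rewrite /= lee_fin normr_id sE ger0_norm ?sqr_ge0// sqr_sqrtB_le.
rewrite -(setUv A) Rintegral_setU//; last 2 first.
- by rewrite setUv.
- by rewrite disj_set2E setICr.
apply: lerD.
  rewrite [leRHS]ger0_norm; last by apply: Rintegral_ge0 => x; rewrite /A /= subr_ge0.
  rewrite (@eq_Rintegral _ _ _ rho A (fun x => v x - w x))// => x.
  by rewrite inE /A /= => h; rewrite ger0_norm ?subr_ge0.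
rewrite -normrN -[X in _ <= `|X|]mulN1r -RintegralZl//; last first.
  by have [h1 h2] := iB _ mCA; have := integrableB mCA h1 h2.
rewrite [leRHS]ger0_norm.
  rewrite (@eq_Rintegral _ _ _ rho (~` A) (fun x => -1 * (v x - w x)))// => x.
  rewrite inE /A /= => /negP; rewrite -ltNge => h.
  by rewrite mulN1r ltr0_norm ?subr_lt0.
by apply: Rintegral_ge0 => x; rewrite /A /= => /negP; rewrite -ltNge mulN1r oppr_ge0 subr_le0 => /ltW.
Qed.

End density_vectors.

Section quasi_invariant.
Context d (T : measurableType d) (R : realType) (rho : {finite_measure set T -> \bar R}).
Variables (Gam : groupType) (act : Gam -> T -> T).
Hypothesis mact : forall g, measurable_fun setT (act g).
Hypothesis act1 : forall x, act 1%g x = x.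
Hypothesis actM : forall g h x, act (g * h)%g x = act g (act h x).

Lemma quasi_invariant_densities :
  (forall g A, measurable A -> rho A = 0%E -> rho (act g @^-1` A) = 0%E) ->
  exists w : Gam -> T -> R, [/\ forall g, measurable_fun setT (w g),
    forall g x, 0 <= w g x &
    forall g (f : T -> \bar R), (forall x, 0 <= f x)%E -> measurable_fun setT f ->
      (\int[rho]_x f (act g x) = \int[rho]_x (f x * (w g x)%:E))%E].
Proof.
move=> ac.
have /choice[w wE] g : exists w : T -> R, [/\ measurable_fun setT w,
    forall x, 0 <= w x &
    forall (f : T -> \bar R), (forall x, 0 <= f x)%E -> measurable_fun setT f ->
      (\int[rho]_x f (act g x) = \int[rho]_x (f x * (w x)%:E))%E].
  have [nu [nuE nui]] := pushforward_finite_measure rho (mact g).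
  have [|w [mw w0 _ wE]] := @density_exists _ _ _ rho nu.
    by move=> A mA A0; rewrite nuE /pushforward ac.
  by exists w; split=> // f f0 mf; rewrite -nui// wE.
by exists w; split=> g; have [] := wE g.
Qed.

(** The square root of this density is [koopman_fun] applied to the square root of [v]: the vector
    of the translated measure is the translated vector. *)
Lemma pushforward_density (w : Gam -> T -> R) (mu nu : {finite_measure set T -> \bar R}) v g :
  measurable_fun setT (w g) -> (forall x, 0 <= w g x) ->
  (forall f : T -> \bar R, (forall x, 0 <= f x)%E -> measurable_fun setT f ->
    (\int[rho]_x f (act g x) = \int[rho]_x (f x * (w g x)%:E))%E) ->
  is_density rho mu v ->
  (forall f : T -> \bar R, measurable_fun setT f -> (forall x, 0 <= f x)%E ->
    (\int[nu]_x f x = \int[mu]_x f (act g x))%E) ->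
  is_density rho nu (fun x => w g x * v (act g^-1%g x)).
Proof.
move=> mw w0 wE [mv v0 iv vE] nuE.
have mva : measurable_fun setT (fun x => v (act g^-1%g x)) by exact: measurableT_comp mv _.
apply: density_intro => [|x|f f0 mf]; first exact: measurable_funM.
  exact: mulr_ge0.
rewrite nuE// vE//; last exact: measurableT_comp mf _.
rewrite (eq_integral (fun x => (fun y => f y * (v (act g^-1%g y))%:E)%E (act g x))); last first.
  by move=> x _; rewrite -actM mulVg act1.
rewrite (wE (fun y => f y * (v (act g^-1%g y))%:E)%E).
- by apply: eq_integral => x _; rewrite mulrC EFinM muleA.
- by move=> x; rewrite mule_ge0// lee_fin.
- by apply: emeasurable_funM => //; exact/measurable_EFinP.
Qed.

End quasi_invariant.

(** * The action attached to a matched pair *)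

Section matched_pair_action.
Variables (R : realType) (Gam : discreteGroupType) (G : compactGroupType).
Variable mp : matched_pair R Gam G.
Local Notation i := (mp_i mp).
Local Notation j := (mp_j mp).

Let iM : {morph i : x y / (x * y)%g}. Proof. by have [] := mp_i_closed mp. Qed.
Let jM : {morph j : x y / (x * y)%g}. Proof. by have [] := mp_j_closed mp. Qed.

Let i1 : i 1%g = 1%g.
Proof. by apply: (mulgI (i 1%g)); rewrite -iM !mulg1. Qed.

Let j1 : j 1%g = 1%g.
Proof. by apply: (mulgI (j 1%g)); rewrite -jM !mulg1. Qed.

(** The image of [y^-1 * x] lies in both subgroups, which meet trivially. [mp_alpha] is known
    through [mp_factorization], so its being an action that fixes 1 rests on this uniqueness. *)
Lemma matched_factor_unique x g y h : (j x * i g = j y * i h)%g -> x = y.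
Proof.
move=> E; have [_ jI _ _] := mp_j_closed mp.
have h1 : j (y^-1 * x)%g = i (h * g^-1)%g.
  apply: (mulgI (j y)); rewrite -jM mulgA mulgV mul1g; apply: (mulIg (i g)).
  by rewrite E -mulgA -iM -mulgA mulVg mulg1.
have : (range i `&` range j) (j (y^-1 * x)%g).
  by split; [exists (h * g^-1)%g|exists (y^-1 * x)%g].
rewrite mp_trivial /= -j1 => /jI h2.
by apply: (mulgI y^-1%g); rewrite h2 mulVg.
Qed.

Lemma mp_alpha1 x : mp_alpha mp 1%g x = x.
Proof.
apply: (@matched_factor_unique _ (mp_beta mp 1%g x) _ 1%g).
by rewrite -mp_factorization i1 mul1g mulg1.
Qed.

Lemma mp_alphaM g h x : mp_alpha mp (g * h)%g x = mp_alpha mp g (mp_alpha mp h x).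
Proof.
apply: (@matched_factor_unique _ (mp_beta mp (g * h)%g x) _
  (mp_beta mp g (mp_alpha mp h x) * mp_beta mp h x)%g).
by rewrite -mp_factorization !iM -mulgA !mp_factorization mulgA mp_factorization -mulgA.
Qed.

Lemma mp_alpha_fix1 g : mp_alpha mp g 1%g = 1%g.
Proof.
apply: (@matched_factor_unique _ (mp_beta mp g 1%g) _ g).
by rewrite -mp_factorization j1 mulg1 mul1g.
Qed.

(** This is why the translates of a measure without mass at 1 have no mass at 1 either. *)
Lemma mp_alpha_preimage1 g : mp_alpha mp g @^-1` [set 1%g] = [set 1%g].
Proof.
apply/seteqP; split=> x /=; last by move=> ->; exact: mp_alpha_fix1.
move=> E; rewrite -(mp_alpha1 x) -(mulVg g) mp_alphaM E; exact: mp_alpha_fix1.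
Qed.

Lemma mp_alpha_measurable g : measurable_fun setT (mp_alpha mp g : borel G -> borel G).
Proof. by apply: continuous_borel_measurable; exact: (@cts_fun _ _ (mp_alpha mp g)). Qed.

End matched_pair_action.

Lemma ae_L2_norm_le d (T : measurableType d) (R : realType)
    (mu : {finite_measure set T -> \bar R}) (a : L2 mu) (f : T -> Cx R) (c : R) :
  0 <= c -> Cx_measurable f -> ae_equal mu a f -> (`|a| <= c%:C%C) = (sq_norm mu f <= c ^+ 2).
Proof.
move=> c0 mf af; rewrite L2_norm_le//; congr (_ <= _); apply: ae_sq_norm => //.
by have [] := L2_square_integrable a.
Qed.

Section regular_representation.
Variables (R : realType) (Gam : discreteGroupType) (G : compactGroupType).
Variable mp : matched_pair R Gam G.
Variable rho : {finite_measure set (borel G) -> \bar R}.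
Let act (g : Gam) : borel G -> borel G := mp_alpha mp g.
Let mact : forall g, measurable_fun setT (act g) := mp_alpha_measurable mp.
Let act1 : forall x, act 1%g x = x := mp_alpha1 mp.
Let actM : forall g h x, act (g * h)%g x = act g (act h x) := mp_alphaM mp.
Variable w : Gam -> borel G -> R.
Hypothesis mw : forall g, measurable_fun setT (w g).
Hypothesis w0 : forall g x, 0 <= w g x.
Hypothesis wE : forall g (f : borel G -> \bar R), (forall x, 0 <= f x)%E ->
  measurable_fun setT f ->
  (\int[rho]_x f (act g x) = \int[rho]_x (f x * (w g x)%:E))%E.

Local Notation U := (koopman (mu := rho) act w).
Local Notation p := (@mulrep R G rho).

Lemma koopman_covariant : covariant_rep mp p U.
Proof.
split; [exact: mulrep_representation|exact: koopman_unitary|].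
move=> g F a; apply: L2_ext.
have h1 := koopmanE mact act1 actM mw w0 wE g (p F a).
have h2 := koopman_ae mact mw wE g (mulrepE F a).
have h3 := mulrepE (Cfun_comp F (mp_alpha mp g^-1%g)) (U g a).
have h4 := koopmanE mact act1 actM mw w0 wE g a.
apply: filterS2 (filterI h1 h2) (filterI h3 h4) => x [-> ->] [-> ->].
by rewrite /koopman_fun mulrCA.
Qed.

Variables (mu : probability (borel G) R) (v : borel G -> R).
Hypothesis dv : is_density rho mu v.

Let sv := density_sqrt_square_integrable dv.

Definition density_vector : L2 rho := toL2 rho (density_sqrt v).

Lemma density_vector_norm : `|density_vector| = 1.
Proof.
rewrite L2_normE (ae_sq_norm _ _ (toL2E sv)); last 2 first.
- by have [] := L2_square_integrable density_vector.
- by have [] := sv.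
rewrite /sq_norm (@eq_Rintegral _ _ _ rho setT (fun x => cst 1 x * Cx_mod (density_sqrt v x) ^+ 2)); last first.
  by move=> x _; rewrite mul1r.
rewrite (density_sqrt_integral dv)// Rintegral_cst// mul1r.
by rewrite [X in fine X](probability_setT mu) sqrtr1.
Qed.

(** The squared modulus of the vector is the density of [mu], so the square norm of its product with
    [F - c] is an integral against [mu]. *)
Lemma density_vector_mulrep (F : Cfun R G) (c : Cx R) (e : R) : 0 <= e ->
  (`|p F density_vector - c *: density_vector| <= e%:C%C) =
  ((\int[mu]_x Cx_mod (F x - c) ^+ 2)%R <= e ^+ 2).
Proof.
move=> e0; have mFc : Cx_measurable (fun x : borel G => F x - c).
  by apply: Cx_measurableD; [exact: Cfun_measurable|exact: Cx_measurable_cst].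
rewrite (@ae_L2_norm_le _ _ _ _ _ (fun x : borel G => (F x - c) * density_sqrt v x))//; last first.
- have h1 := L2B (p F density_vector) (c *: density_vector).
  have h2 := L2Z c density_vector; have h3 := mulrepE F density_vector.
  apply: filterS3 (filterI h1 h2) h3 (toL2E sv) => x [-> ->] -> ->.
  by rewrite mulrBl.
- by apply: Cx_measurableM => //; have [] := sv.
congr (_ <= _); rewrite -(density_sqrt_integral dv)//; last 2 first.
- by move=> x; exact: sqr_ge0.
- exact: Cx_measurable_mod_sqr.
by apply: eq_Rintegral => x _; rewrite Cx_modM exprMn.
Qed.

(** By [pushforward_density] the translated vector is the square root of a density, and the
    Hellinger bound applies; it bounds the square of the norm, whence [e ^+ 2]. *)
Lemma density_vector_koopman g (e : R) : 0 <= e ->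
  (variation_norm (fun A : set (borel G) =>
     pushforward mu (mp_alpha mp g : borel G -> borel G) A - mu A)%E <= (e ^+ 2)%:E)%E ->
  `|U g density_vector - density_vector| <= e%:C%C.
Proof.
move=> e0; have [nu [nuE nui]] := pushforward_probability mu (mact g).
have dnu := pushforward_density mact act1 actM (mw g) (w0 g) (@wE g) dv nui.
have snu := density_sqrt_square_integrable dnu.
rewrite (@ae_L2_norm_le _ _ _ _ _ (fun x : borel G => density_sqrt (fun x => w g x * v (act g^-1%g x)) x - density_sqrt v x))//; last first.
- have h1 := L2B (U g density_vector) density_vector.
  have h2 := koopmanE mact act1 actM mw w0 wE g density_vector.
  have h3 := koopman_ae mact mw wE g (toL2E sv).
  apply: filterS3 (filterI h1 h2) h3 (toL2E sv) => x [-> ->] -> ->.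
  by rewrite /koopman_fun /density_sqrt -(rmorphM (real_complex R)) sqrtrM.
- by have [] := square_integrableD snu (square_integrableN sv).
rewrite -lee_fin; apply: le_trans; apply: le_trans (hellinger_le_variation_norm dnu dv) _.
rewrite (_ : (fun A => _) = (fun A => pushforward mu (mp_alpha mp g : borel G -> borel G) A - mu A)%E)//.
by apply/funext => A; congr (_ - _)%E; exact: nuE.
Qed.

(** A fixed vector [a] satisfies [f n * a = 0] almost everywhere for the continuous [f n] vanishing
    at the unit; at every other point some [f n] equals 1, so [a] is supported on a null set. *)
Lemma mulrep_no_fixed_vector : rho [set 1%g : G] = 0%E ->
  ~ contained (fun F : Cfun R G => F 1%g) p.
Proof.
move=> rho1 [a [/eqP a0 aF]]; apply: a0; apply: L2_ext.
have hG : hausdorff_space G := hausdorff_subproof.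
have sG : @second_countable G := second_countable_subproof.
have c1 : closed [set 1%g : G].
  exact: accessible_closed_set1 (hausdorff_accessible hG) _.
have [f [fc f01 f0 _ f1]] := open_exhaustion R hG sG (closed_openC c1).
have ae_f n : \forall x \ae rho, (f n x)%:C%C * a x = 0 :> Cx R.
  have h1 := mulrepE (Cfun_real (fc n)) a; rewrite aF in h1.
  have F1 : Cfun_real (fc n) 1%g = 0 :> Cx R.
    by rewrite -[LHS]/((f n 1%g)%:C%C) f0//; exact.
  rewrite F1 scale0r in h1.
  by apply: filterS2 h1 (L20 rho) => x <- ->.
have ae_1 : \forall x \ae rho, x <> 1%g.
  exists [set 1%g : G]; split; [exact: closed_borel_measurable|exact: rho1|].
  by move=> x /= /contrapT.
apply: filterS3 (ae_foralln ae_f) ae_1 (L20 rho) => x af x1 ->.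
have [n _ /(_ n (leqnn n))/= fn] := f1 x x1.
by have := af n; rewrite fn -[1%:C%C]/(1 : Cx R) mul1r.
Qed.

End regular_representation.

(** * From almost invariant measures to weak containment *)

Section backward.
Variables (R : realType) (Gam : discreteGroupType) (G : compactGroupType).
Hypothesis Gam_countable : countable [set: Gam].
Variables (mp : matched_pair R Gam G) (mu : nat -> probability (borel G) R).
Hypothesis mu1 : forall n, mu n [set 1%g : G] = 0%E.

(** Indexed by all pairs of an integer and a group element, the family of translates is stable under
    the action, and so are the sets that are null for all its members. *)
Lemma quasi_invariant_dominating_measure :
  exists rho : {finite_measure set (borel G) -> \bar R}, [/\ rho [set 1%g : G] = 0%E,
    forall n A, rho A = 0%E -> mu n A = 0%E &
    forall g A, rho A = 0%E -> rho (mp_alpha mp g @^-1` A) = 0%E].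
Proof.
have /choice[m mE] (k : nat * Gam) : exists Q : probability (borel G) R,
    forall A : set (borel G), Q A = mu k.1 (mp_alpha mp k.2 @^-1` A).
  by have [Q [QE _]] := pushforward_probability (mu k.1) (mp_alpha_measurable mp k.2); exists Q.
have [|rho rhoE] := @dominating_measure _ _ _ _ (0%N, 1%g : Gam) m.
  by rewrite -setXTT; apply: countableX => //; exact: countableP.
exists rho; split=> [|n A /rhoE/(_ (n, 1%g))|g A /rhoE h].
- by apply/rhoE => k; rewrite mE mp_alpha_preimage1.
- rewrite mE /= (_ : _ @^-1` A = A)//.
  by apply/seteqP; split=> x /=; rewrite mp_alpha1.
- apply/rhoE => -[n h']; have := h (n, (g * h')%g); rewrite !mE /=.
  rewrite (_ : mp_alpha mp (g * h')%g @^-1` A = mp_alpha mp h' @^-1` (mp_alpha mp g @^-1` A))//.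
  by apply/seteqP; split=> x /=; rewrite mp_alphaM.
Qed.

Variable GG : bicrossed_product mp.
Hypothesis mu_delta : weak_star_cvg mu (\d_(1%g : borel G)).
Hypothesis mu_invariant : forall g : Gam,
  variation_norm
    (fun A : set (borel G) =>
       pushforward (mu n) (mp_alpha mp g : borel G -> borel G) A - mu n A)%E
  @[n --> \oo] --> (0 : \bar R)%E.

(** Weak-star convergence tested on the squared modulus of [F - F 1], which is continuous and
    vanishes at 1. *)
Lemma mean_square_cvg0 (F : Cfun R G) (e : R) : 0 < e ->
  \forall n \near \oo, (\int[mu n]_x Cx_mod (F x - F 1%g) ^+ 2)%R <= e.
Proof.
move=> e0; pose D : Cfun R G := F - F 1%g *: cone; pose E : Cfun R G := cmul (star D) D.
have DE x : D x = F x - F 1%g.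
  by rewrite -[LHS]/(F x - F 1%g * 1) mulr1.
have EE x : Cx_re (E x) = Cx_mod (F x - F 1%g) ^+ 2.
  rewrite -[E x]/((D x)^* * D x) DE Cx_reM Cx_re_conj Cx_im_conj Cx_mod_sqr.
  by rewrite mulNr opprK -!expr2.
have := @mu_delta E; rewrite Cfun_integral_dirac -[E 1%g]/((D 1%g)^* * D 1%g) DE subrr mulr0.
move=> /cvgrPdist_le/(_ _ (etrans (realC_gt0 e) e0)); apply: filterS => n.
rewrite sub0r normrN Cx_mod_le => /(le_trans (Cx_re_le _))/(le_trans (ler_norm _)).
rewrite -[Cx_re (Cfun_integral _ _)]/(\int[mu n]_x Cx_re (E x))%R.
by rewrite (@eq_Rintegral _ _ _ (mu n) setT (fun x => Cx_mod (F x - F 1%g) ^+ 2)).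
Qed.

Lemma measures_weakly_contained : exists (H : hilbertType (Cx R)) (q : bp_alg GG -> H -> H),
  [/\ representation q, weakly_contained (@bp_counit _ _ _ _ GG) q &
      ~ contained (fun F : Cfun R G => F 1%g) (fun F => q (bp_iota GG F))].
Proof.
have [rho [rho1 rho_mu rho_act]] := quasi_invariant_dominating_measure.
have [w [mw w0 wE]] := quasi_invariant_densities (mp_alpha_measurable mp)
  (rho := rho) (fun g A _ => rho_act g A).
have /choice[v vE] n : exists v, is_density rho (mu n) v.
  by apply: density_exists => A _; exact: rho_mu.
have cov := koopman_covariant mw w0 wE.
have [q [rq qp qU]] := bp_universal GG cov.
exists (L2 rho), q; split=> //; last first.
  move=> [a [a0 aF]]; apply: (mulrep_no_fixed_vector rho1).
  by exists a; split=> // F; rewrite -qp.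
pose xi n := density_vector rho (v n).
apply: (weakly_contained_total (bp_counit_character GG) rq (@bp_generated _ _ _ _ GG) (xi := xi)).
  by move=> n; exact: density_vector_norm (vE n).
move=> _ [g [F ->]]; apply/norm_cvg0_near => e e0; rewrite bp_counitE.
have [_ [Ul _ _ _] _] := cov; have [_ _ _ qM _] := rq.
(* The error on a generator is at most [s + c * s], which equals [e] for this [s]; [1 + c] is
   positive even if [F] vanishes at 1. *)
pose c := Cx_mod (F 1%g); pose s := e / (1 + c).
have c0 : 0 <= c := Cx_mod_ge0 _.
have c1 : 0 < 1 + c by rewrite ltr_pwDl.
have s0 : 0 < s by rewrite divr_gt0.
have h1 := mean_square_cvg0 F (exprn_gt0 2 s0).
have h2 : \forall n \near \oo, (variation_norm
    (fun A : set (borel G) =>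
       pushforward (mu n) (mp_alpha mp g : borel G -> borel G) A - mu n A) < (s ^+ 2)%:E)%E.
  have s2 : (0 < (s ^+ 2)%:E)%E by rewrite lte_fin exprn_gt0.
  exact: (@mu_invariant g _ (open_ereal_lt' s2)).
apply: filterS2 h1 h2 => n; rewrite -(density_vector_mulrep (vE n))//; last exact: ltW.
move=> b1 /ltW vn; have b2 := density_vector_koopman mw w0 wE (vE n) (ltW s0) vn.
rewrite qM qU qp -[density_vector rho (v n)]/(xi n) in b1 b2 *.
set u := koopman _ _ in b2 *; have ul : linear (u g) := Ul g.
(* Separates the error of [F], carried along by the isometry [u g], from the displacement of [xi n]
   under [u g]. *)
have -> : u g (mulrep F (xi n)) - F 1%g *: xi n =
    u g (mulrep F (xi n) - F 1%g *: xi n) + F 1%g *: (u g (xi n) - xi n).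
  by rewrite (linfB ul) (linfZ ul) scalerBr addrA subrK.
rewrite (le_trans (ler_normD _ _))// normrZ (koopman_norm (mp_alpha_measurable mp) (mp_alpha1 mp) (mp_alphaM mp) mw w0 wE)//.
rewrite (le_trans (lerD b1 (ler_wpM2l (normr_ge0 _) b2)))// Cx_normE -/c.
rewrite -(rmorphM (real_complex R)) -(rmorphD (real_complex R)) real_leC.
by rewrite -{1}[s]mul1r -mulrDl mulrC mulfVK// gt_eqF.
Qed.

End backward.

Theorem theorem4p2 (R : realType) (Gam : discreteGroupType)
    (G : compactGroupType) (Gam_countable : countable [set: Gam])
    (mp : matched_pair R Gam G) (GG : bicrossed_product mp) :
  ~ relative_co_property_T (fun F : Cfun R G => F 1%g)
      (@bp_counit R Gam G mp GG) (@bp_iota R Gam G mp GG)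
  <->
  exists mu : nat -> probability (borel G) R,
    [/\ forall n, mu n [set 1%g : G] = 0%E,
        weak_star_cvg mu (\d_(1%g : borel G)) &
        forall g : Gam,
          variation_norm
            (fun A : set (borel G) =>
               pushforward (mu n) (mp_alpha mp g : borel G -> borel G) A
               - mu n A)%E
          @[n --> \oo] --> (0 : \bar R)%E].
Proof.
split=> [nT|[mu [mu1 mud mui]] T].
  apply: contrapT => nmu; apply: nT => H q rq wq.
  by apply: contrapT => nq; apply: nmu; exact: weakly_contained_measures rq wq nq.
have [H [q [rq wq nq]]] := measures_weakly_contained Gam_countable mu1 GG mud mui.
exact: nq (T H q rq wq).
Qed.
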